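(* Let $H$ be an operator on a complex Banach space $\mathcal{B}$ satisfying the standing hypothesis stated in the context, and let $\phi\in\hat{\mathcal{A}}$. Then $$\overline{\phi(\sigma(H))}\subseteq\sigma(\phi(H)).$$
   Context: Write $\langle z\rangle:=(1+|z|^2)^{1/2}$ for $z\in\mathbf{C}$. Standing hypothesis on $H$: $H$ is a closed densely defined operator on a complex Banach space $\mathcal{B}$ with spectrum $\sigma(H)\subseteq\mathbf{R}$, and there are constants $c>0$, $\alpha\ge 0$ such that $\|(z-H)^{-1}\|\le c\,|\mathrm{Im}\,z|^{-1}\left(\frac{\langle z\rangle}{|\mathrm{Im}\,z|}\right)^{\alpha}$ for all $z\notin\mathbf{R}$. Algebra $\mathcal{A}$: for $\beta\in\mathbf{R}$, $S^\beta$ is the set of smooth $f:\mathbf{R}\to\mathbf{C}$ such that for every $n\ge 0$ there is $c_n>0$ with $|f^{(n)}(x)|\le c_n\langle x\rangle^{\beta-n}$ for all $x$; $\mathcal{A}:=\bigcup_{\beta<0}S^\beta$, an algebra under pointwise multiplication. Functional calculus: let $\tau(x,y)=\tau_0(y/\langle x\rangle)$ with $\tau_0\in C^\infty(\mathbf{R})$, $\tau_0(t)=1$ for $|t|\le1$, $\tau_0(t)=0$ for $|t|\ge2$. For $f\in\mathcal{A}$ and an integer $n>\alpha$ put $\tilde f(x,y):=\left(\sum_{r=0}^n f^{(r)}(x)\frac{(iy)^r}{r!}\right)\tau(x,y)$, $\frac{\partial\tilde f}{\partial\bar z}:=\frac12\left(\frac{\partial\tilde f}{\partial x}+i\frac{\partial\tilde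 f}{\partial y}\right)$, and $$f(H):=-\frac1\pi\iint_{\mathbf{C}}\frac{\partial\tilde f}{\partial\bar z}(z-H)^{-1}\,dx\,dy,\qquad z=x+iy.$$ The integral is norm convergent and independent of the choice of $n>\alpha$ and of $\tau$. Extended algebra: $\hat{\mathcal{A}}:=\{(z,f): z\in\mathbf{C},\ f\in\mathcal{A}\}$, where $\phi=(z,f)$ is regarded as the function $\phi(x)=z+f(x)$ on $\mathbf{R}$, with pointwise addition and multiplication. For $\phi=(z,f)$ one sets $\phi(H):=f(H)+zI$. Also $\phi(\sigma(H)):=\{\phi(x):x\in\sigma(H)\}$. *)

(* Defs.v *)
From HB Require Import structures.
From mathcomp Require Import all_boot all_order all_algebra.
From mathcomp Require Import complex.
From mathcomp Require Import all_classical all_reals all_analysis.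
From mathcomp Require Import measurable_realfun.

Set Implicit Arguments.
Unset Strict Implicit.
Unset Printing Implicit Defensive.

Import Order.TTheory GRing.Theory Num.Theory.
Import numFieldNormedType.Exports.

Local Open Scope classical_set_scope.
Local Open Scope ring_scope.

(* Norms over the scalar field R[i] take values in R[i]; [rnorm] is the same
   norm seen as an element of R. *)
Definition rnorm (R : realType) (V : normedZmodType R[i]) (v : V) : R :=
  complex.Re `|v|.

Definition jap (R : realType) (z : R[i]) : R := Num.sqrt (1 + rnorm z ^+ 2).

(* Functions R -> C are differentiated componentwise, as the library does not
   make R[i] a normed space over R. *)
Definition cderive1 (R : realType) (f : R -> R[i]) (x : R) : R[i] :=
  (derive1 (@complex.Re R \o f) x +i* derive1 (@complex.Im R \o f) x)%C.

Definition cderive1n (R : realType) (n : nat) (f : R -> R[i]) : R -> R[i] :=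
  iter n (@cderive1 R) f.

Definition csmooth (R : realType) (f : R -> R[i]) : Prop :=
  forall (n : nat) (x : R),
    derivable (@complex.Re R \o cderive1n n f) x 1 /\
    derivable (@complex.Im R \o cderive1n n f) x 1.

Definition symbol_class (R : realType) (b : R) : set (R -> R[i]) :=
  [set f | csmooth f /\
    forall n : nat, exists2 c : R, 0 < c &
      forall x : R, rnorm (cderive1n n f x) <= c * jap x%:C%C `^ (b - n%:R)].

Definition algA (R : realType) : set (R -> R[i]) :=
  [set f | exists2 b : R, b < 0 & symbol_class b f].

Definition algAhat (R : realType) : set (R[i] * (R -> R[i])) :=
  [set phi | algA phi.2].

Definition ext_fun (R : realType) (phi : R[i] * (R -> R[i])) (x : R) : R[i] :=
  phi.1 + phi.2 x.

(* A partially defined operator; the values of [act] outside [dom] are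
   irrelevant. *)
Record partial_op (R : realType) (B : completeNormedModType R[i]) := PartialOp {
  dom : set B ;
  act : B -> B }.

Section operators.
Context {R : realType} {B : completeNormedModType R[i]}.
Implicit Types (H : partial_op B) (T : B -> B) (z : R[i]).

Definition linear_op H : Prop :=
  dom H 0 /\
  forall (a : R[i]) (x y : B), dom H x -> dom H y ->
    dom H (a *: x + y) /\ act H (a *: x + y) = a *: act H x + act H y.

Definition closed_op H : Prop :=
  closed ([set p | dom H p.1 /\ p.2 = act H p.1] : set (B * B)).

Definition densely_defined H : Prop := dense (dom H).

(* Infinite when T is unbounded. *)
Definition opnorm T : \bar R :=
  ereal_sup [set (rnorm (T x))%:E | x in [set x : B | rnorm x <= 1]].

Definition bounded_op T : Prop := linear T /\ (opnorm T < +oo)%E.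

Definition total_op T : partial_op B := PartialOp setT T.

Definition is_resolvent H z T : Prop :=
  [/\ bounded_op T,
      forall x, dom H (T x) /\ z *: T x - act H (T x) = x &
      forall x, dom H x -> T (z *: x - act H x) = x].

Definition spectrum H : set R[i] := [set z | ~ exists T, is_resolvent H z T].

(* (z - H)^-1, and 0 when z is in the spectrum. *)
Definition resolvent H z : B -> B := xget (0 : B -> B) (is_resolvent H z).

End operators.

(* Integration is in the sense of Bochner, for the operator norm: T is the
   integral of F when simple functions s_k satisfy \int ||F - s_k|| --> 0 and
   \int s_k --> T.  Such a T is unique. *)

Section bochner.
Context {R : realType} {B : completeNormedModType R[i]}.
Context {d : measure_display} {X : measurableType d}.
Variable mu : {measure set X -> \bar R}.

Record simple_op_fun := SimpleOpFun {
  sof_size : nat ;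
  sof_set : 'I_sof_size -> set X ;
  sof_val : 'I_sof_size -> B -> B ;
  sof_measurable : forall i, measurable (sof_set i) ;
  sof_finite : forall i, (mu (sof_set i) < +oo)%E ;
  sof_bounded : forall i, bounded_op (sof_val i) }.

Definition sof_eval (s : simple_op_fun) (t : X) : B -> B :=
  \sum_(i < sof_size s) (\1_(sof_set i) t : R[i]) *: sof_val i.

Definition sof_integral (s : simple_op_fun) : B -> B :=
  \sum_(i < sof_size s) ((fine (mu (sof_set i)))%:C)%C *: sof_val i.

Definition opdist (F G : X -> B -> B) (t : X) : \bar R := opnorm (F t - G t).

Definition is_bochner_integral (F : X -> B -> B) (T : B -> B) : Prop :=
  bounded_op T /\
  exists s : nat -> simple_op_fun,
    [/\ forall k, measurable_fun setT (opdist F (sof_eval (s k))),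
        (\int[mu]_t opdist F (sof_eval (s k)) t)%E @[k --> \oo] --> 0%E &
        opnorm (sof_integral (s k) - T) @[k --> \oo] --> 0%E].

(* 0 when F is not integrable. *)
Definition bochner_integral (F : X -> B -> B) : B -> B :=
  xget (0 : B -> B) (is_bochner_integral F).

End bochner.

Definition cutoff (R : realType) (tau0 : R -> R[i]) : Prop :=
  [/\ csmooth tau0,
      forall t : R, `|t| <= 1 -> tau0 t = 1 &
      forall t : R, 2 <= `|t| -> tau0 t = 0].

Definition almost_analytic (R : realType) (tau0 : R -> R[i]) (n : nat)
    (f : R -> R[i]) (x y : R) : R[i] :=
  (\sum_(r < n.+1) cderive1n r f x * (0 +i* y)%C ^+ r / (r`!)%:R)
  * tau0 (y / jap x%:C%C).

Definition dbar (R : realType) (g : R -> R -> R[i]) (x y : R) : R[i] :=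
  2^-1 * (cderive1 (fun s => g s y) x + 'i%C * cderive1 (fun t => g x t) y).

Section functional_calculus.
Context {R : realType} {B : completeNormedModType R[i]}.
Variables (tau0 : R -> R[i]) (n : nat) (H : partial_op B).

Definition funcalc (f : R -> R[i]) : B -> B :=
  - ((pi^-1)%:C)%C *:
    bochner_integral (@lebesgue_measure R \x @lebesgue_measure R)%E
      (fun p : R * R => dbar (almost_analytic tau0 n f) p.1 p.2
                        *: resolvent H (p.1 +i* p.2)%C).

Definition ext_funcalc (phi : R[i] * (R -> R[i])) : B -> B :=
  fun v => funcalc phi.2 v + phi.1 *: v.

End functional_calculus.

Definition standing_hypothesis (R : realType) (B : completeNormedModType R[i])
    (H : partial_op B) (c alpha : R) : Prop :=
  [/\ linear_op H, closed_op H, densely_defined H,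
      forall z, spectrum H z -> complex.Im z = 0 &
      forall z, complex.Im z != 0 ->
        (opnorm (resolvent H z) <=
         (c * `|complex.Im z|^-1 * (jap z / `|complex.Im z|) `^ alpha)%:E)%E].

(* Main.v *)
Require Import Defs.
From HB Require Import structures.
From mathcomp Require Import all_boot all_order all_algebra.
From mathcomp Require Import complex.
From mathcomp Require Import all_classical all_reals all_analysis.
From mathcomp Require Import measurable_realfun.
From mathcomp Require Import ring lra.

(** It suffices to show that [phi(s)] is an approximate eigenvalue of [phi(H)]
    for every [s] in the spectrum of [H]: if [l] had a bounded resolvent for
    [phi(H)], of norm [K], then unit vectors [v] would satisfy
    [1 <= K |(l - phi(H)) v|], which is impossible when [l] is a limit of
    approximate eigenvalues.  The closure thus costs nothing, and the constant
    part of [phi] is harmless, so let [phi = f].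

    Every [s] in the spectrum of [H] is an approximate eigenvalue of [H]
    ([approx_eigenvector]).  Otherwise [s - H] is bounded below, the resolvents
    at [s + i t] stay bounded as [t] tends to 0 and converge strongly, and since
    [H] is closed the limit inverts [s - H].  A unit vector [v] with
    [|(s - H) v| < delta] is almost an eigenvector of the resolvents:
    [|(z - H)^-1 v - (z - s)^-1 v|] is at most
    [delta ||(z - H)^-1|| / |Im z|] ([resolvent_approx_eigenvector]).

    Integrate this over the plane against [a], the image of the almost analytic
    extension of [f] under the Cauchy-Riemann operator.  The operators integrate
    to [- pi f(H)] by definition.  The scalars [a / (z - s)] integrate to
    [- pi f(s)] by the Cauchy-Pompeiu formula ([cauchy_pompeiu]).  Hence
    [pi |f(H) v - f(s) v|] is at most the integral of a function that tends to 0
    pointwise with [delta] and that lies below [|a| ||(z - H)^-1|| + |a / (z - s)|],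
    so it tends to 0 by dominated convergence
    ([funcalc_approx_eigenvector]).  The bound [delta |a| ||(z - H)^-1|| / |Im z|]
    alone would not do: its integral may diverge at the real axis when [n] only
    just exceeds [alpha].

    Four facts on integrals support this argument.
    - The function [a (z - H)^-1] is Bochner integrable
      ([resolvent_bochner_exists]).  It is norm continuous off the real axis, so
      that countably many of its values are dense among all of them; choosing
      the best of the first [k] values at each point gives simple functions that
      converge in mean ([best_approximation], [bochner_integral_exists]).
    - The norm of an integral is at most the integral of the norm
      ([rnorm_bochner_sub]), by comparison with simple functions.
    - All majorants are multiples of the functions [|y|^g <x>^d] on the cone
      [|y| <= 2 <x>], which are integrable as soon as [-1 < g] and
      [g + d + 1 < -1] ([weight_integrable]).  The bounds on [a] are in
      [almost_analytic_bounds].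
    - The Cauchy-Pompeiu formula follows from the fundamental theorem of calculus
      in each variable and the Fubini theorem, on the plane cut along the strip
      [|y| <= e].  The horizontal derivative contributes nothing, the vertical
      one contributes the jump across the strip, and this jump is a Poisson
      integral that tends to [2 pi i f(s)]. *)

Import Order.TTheory GRing.Theory Num.Theory.
Import numFieldNormedType.Exports.

Local Open Scope classical_set_scope.
Local Open Scope ring_scope.

Set Implicit Arguments.
Unset Strict Implicit.
Unset Printing Implicit Defensive.

(** * Norms with values in the reals *)

Section rnorm.
Context {R : realType}.

Section normedZmod.
Context {V : normedZmodType R[i]}.
Implicit Types u v : V.

Lemma normE v : `|v| = (rnorm v)%:C%C.
Proof. by rewrite /rnorm RRe_real// normr_real. Qed.

Lemma rnorm_ge0 v : 0 <= rnorm v.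
Proof. by rewrite -ler0c -normE. Qed.

Lemma rnorm0 : rnorm (0 : V) = 0.
Proof. by rewrite /rnorm normr0. Qed.

Lemma rnorm_eq0 v : (rnorm v == 0) = (v == 0).
Proof. by rewrite -[RHS]normr_eq0 normE -(inj_eq (@complexI R)). Qed.

Lemma rnormN v : rnorm (- v) = rnorm v.
Proof. by rewrite /rnorm normrN. Qed.

Lemma rnormD u v : rnorm (u + v) <= rnorm u + rnorm v.
Proof. by rewrite -lecR rmorphD /= -!normE ler_normD. Qed.

Lemma rnormB u v : rnorm (u - v) <= rnorm u + rnorm v.
Proof. by rewrite -(rnormN v) rnormD. Qed.

Lemma rnorm_distC u v : rnorm (u - v) = rnorm (v - u).
Proof. by rewrite -rnormN opprB. Qed.

Lemma rnorm_sum (I : Type) (s : seq I) (P : pred I) (F : I -> V) :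
  rnorm (\sum_(i <- s | P i) F i) <= \sum_(i <- s | P i) rnorm (F i).
Proof.
elim/big_rec2: _ => [|i y1 y2 _ ih]; first by rewrite rnorm0.
by rewrite (le_trans (rnormD _ _))// lerD2l.
Qed.

End normedZmod.

Lemma rnormZ (V : normedModType R[i]) (a : R[i]) (v : V) :
  rnorm (a *: v) = rnorm a * rnorm v.
Proof. by apply: (@complexI R); rewrite rmorphM /= -!normE normrZ. Qed.

Lemma rnormM (a b : R[i]) : rnorm (a * b) = rnorm a * rnorm b.
Proof. by apply: (@complexI R); rewrite rmorphM /= -!normE normrM. Qed.

Lemma rnorm1 : rnorm (1 : R[i]) = 1.
Proof. by rewrite /rnorm normr1. Qed.

Lemma rnormV (a : R[i]) : rnorm a^-1 = (rnorm a)^-1.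
Proof. by apply: (@complexI R); rewrite fmorphV /= -!normE normfV. Qed.

Lemma rnormX (a : R[i]) k : rnorm (a ^+ k) = rnorm a ^+ k.
Proof. by elim: k => [|k ih]; rewrite ?rnorm1// !exprS rnormM ih. Qed.

Lemma rnormE (z : R[i]) :
  rnorm z = Num.sqrt (complex.Re z ^+ 2 + complex.Im z ^+ 2).
Proof. by rewrite /rnorm normc_def. Qed.

Lemma rnorm_real (x : R) : rnorm x%:C%C = `|x|.
Proof. by rewrite rnormE /= expr0n /= addr0 sqrtr_sqr. Qed.

Lemma rnorm_imag (y : R) : rnorm (0 +i* y)%C = `|y|.
Proof. by rewrite rnormE /= expr0n /= add0r sqrtr_sqr. Qed.

Lemma rnorm_i : rnorm ('i%C : R[i]) = 1.
Proof. by rewrite rnorm_imag normr1. Qed.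

Lemma rnorm_nat k : rnorm (k%:R : R[i]) = k%:R.
Proof. by rewrite -(rmorph_nat (real_complex R)) /= rnorm_real normr_nat. Qed.

Lemma normRe_le (z : R[i]) : `|complex.Re z| <= rnorm z.
Proof. by rewrite -lecR -normE normc_ge_Re. Qed.

Lemma normIm_le (z : R[i]) : `|complex.Im z| <= rnorm z.
Proof.
by rewrite rnormE -[leLHS]sqrtr_sqr ler_wsqrtr// lerDr sqr_ge0.
Qed.

Lemma rnorm_leReIm (z : R[i]) :
  rnorm z <= `|complex.Re z| + `|complex.Im z|.
Proof.
case: z => a b /=; rewrite -(rnorm_real a) -(rnorm_imag b).
apply: le_trans (rnormD _ _); rewrite le_eqVlt; apply/orP; left; apply/eqP.
by congr rnorm; apply/eqP; rewrite eq_complex /= addr0 add0r !eqxx.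
Qed.

Lemma japE (x : R) : jap x%:C%C = Num.sqrt (1 + x ^+ 2).
Proof. by rewrite /jap rnorm_real -normrX ger0_norm// sqr_ge0. Qed.

Lemma jap_ge1 (z : R[i]) : 1 <= jap z.
Proof.
by rewrite /jap -[leLHS]sqrtr1 ler_wsqrtr// lerDl sqr_ge0.
Qed.

Lemma jap_gt0 (z : R[i]) : 0 < jap z.
Proof. exact: lt_le_trans (jap_ge1 z). Qed.

Lemma sqr_jap (z : R[i]) : jap z ^+ 2 = 1 + rnorm z ^+ 2.
Proof. by rewrite sqr_sqrtr// addr_ge0// sqr_ge0. Qed.

Lemma rnorm_le_jap (z : R[i]) : rnorm z <= jap z.
Proof.
rewrite -ler_sqr ?nnegrE ?rnorm_ge0 ?(ltW (jap_gt0 _))//.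
by rewrite sqr_jap lerDr.
Qed.

End rnorm.

(** * Bounded operators *)

Section ops.
Context {R : realType} {B : completeNormedModType R[i]}.
Implicit Types (H : partial_op B) (S T : B -> B) (z : R[i]) (v : B).

Lemma opnorm_ge0 T : T 0 = 0 -> (0 <= opnorm T)%E.
Proof.
move=> T0; apply: ereal_sup_ubound; exists 0 => /=; first by rewrite rnorm0.
by rewrite T0 rnorm0.
Qed.

Lemma opnorm_le T (K : R) : (forall v, rnorm (T v) <= K * rnorm v) -> 0 <= K ->
  (opnorm T <= K%:E)%E.
Proof.
move=> hK K0; apply: ge_ereal_sup => _ [v /= v1 <-]; rewrite lee_fin.
by rewrite (le_trans (hK v))// -[leRHS]mulr1 ler_wpM2l.
Qed.

Lemma linear0 T : linear T -> T 0 = 0.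
Proof.
move=> /(_ (-1) 0 0); rewrite scaler0 addr0 scaleN1r.
by move=> ->; rewrite addNr.
Qed.

Lemma linearZ T : linear T -> forall a v, T (a *: v) = a *: T v.
Proof. by move=> lT a v; rewrite -[a *: v]addr0 lT linear0// addr0. Qed.

Lemma linearB T : linear T -> forall u v, T (u - v) = T u - T v.
Proof. by move=> lT u v; rewrite addrC -scaleN1r lT scaleN1r addrC. Qed.

(** The norm is a supremum over the unit ball only; the general case follows by
    scaling. *)
Lemma le_opnorm T v : linear T -> ((rnorm (T v))%:E <= opnorm T * (rnorm v)%:E)%E.
Proof.
move=> lT; have [->|v0] := eqVneq v 0; first by rewrite linear0// !rnorm0 mule0.
have nv : 0 < rnorm v by rewrite lt_neqAle rnorm_ge0 eq_sym rnorm_eq0 v0.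
rewrite -lee_pdivrMr// muleC -EFinM; apply: ereal_sup_ubound.
exists ((rnorm v)^-1%:C%C *: v) => /=.
  by rewrite rnormZ rnorm_real gtr0_norm ?invr_gt0// mulVf ?gt_eqF.
by rewrite linearZ// rnormZ rnorm_real gtr0_norm ?invr_gt0.
Qed.

Lemma bounded_opP T : bounded_op T -> linear T /\
  exists2 K, 0 <= K & opnorm T = K%:E /\ forall v, rnorm (T v) <= K * rnorm v.
Proof.
case=> lT bT; split=> //; have n0 := opnorm_ge0 (linear0 lT).
have fT : opnorm T \is a fin_num by rewrite ge0_fin_numE.
exists (fine (opnorm T)); first exact: fine_ge0.
split; first by rewrite fineK.
by move=> v; rewrite -lee_fin EFinM fineK// le_opnorm.
Qed.

Lemma bounded_op_le T (K : R) : linear T ->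
  (forall v, rnorm (T v) <= K * rnorm v) -> 0 <= K -> bounded_op T.
Proof.
by move=> lT hK K0; split=> //; rewrite (le_lt_trans (opnorm_le hK K0))// ltry.
Qed.

Lemma opnorm_le_rnorm T (K : R) v : linear T -> (opnorm T <= K%:E)%E ->
  rnorm (T v) <= K * rnorm v.
Proof.
move=> lT hK; rewrite -lee_fin (le_trans (le_opnorm v lT))// EFinM.
by rewrite lee_wpmul2r// lee_fin rnorm_ge0.
Qed.

Lemma linear_subop S T : linear S -> linear T -> linear (S - T).
Proof.
move=> lS lT a u v; rewrite !fctE lS lT scalerBr.
by rewrite opprD addrACA.
Qed.

Lemma bounded_opB S T : bounded_op S -> bounded_op T -> bounded_op (S - T).
Proof.
move=> /bounded_opP[lS [K K0 [_ hK]]] /bounded_opP[lT [L L0 [_ hL]]].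
apply: (@bounded_op_le _ (K + L)); rewrite ?addr_ge0//.
  exact: linear_subop.
by move=> v; rewrite (le_trans (rnormB _ _))// mulrDl lerD.
Qed.

Lemma bounded_op0 : bounded_op (0 : B -> B).
Proof.
apply: (@bounded_op_le _ 0) => //; first by move=> a u v; rewrite scaler0 addr0.
by move=> v; rewrite rnorm0 mul0r.
Qed.

Lemma bounded_opZ (a : R[i]) T : bounded_op T -> bounded_op (a *: T).
Proof.
move=> /bounded_opP[lT [K K0 [_ hK]]].
apply: (@bounded_op_le _ (rnorm a * K)); rewrite ?mulr_ge0 ?rnorm_ge0//.
  move=> b u v; rewrite !fctE.
  by rewrite lT scalerDr !scalerA mulrC.
by move=> v; rewrite rnormZ -mulrA ler_wpM2l ?rnorm_ge0.
Qed.

End ops.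

(** * Convergence expressed with the real norm *)

Section cvg_rnorm.
Context {R : realType}.

Lemma complex_gt0P (e : R[i]) : 0 < e -> exists2 r : R, 0 < r & e = r%:C%C.
Proof.
case: e => a b; rewrite ltcE /= => /andP[/eqP -> a0]; exists a => //.
Qed.

Lemma ltr_norm_complex (V : normedZmodType R[i]) (v : V) (r : R) :
  (`|v| < r%:C%C) = (rnorm v < r).
Proof. by rewrite normE ltcR. Qed.

(** Norms of vectors take values in [R[i]], whose order is partial; radii are
    traded here for elements of [R]. *)
Lemma cvg_rnormP (V : normedModType R[i]) (T : Type) (F : set_system T)
    (FF : Filter F) (f : T -> V) (l : V) :
  (forall e : R, 0 < e -> \forall t \near F, rnorm (f t - l) < e) <->
  f t @[t --> F] --> l.
Proof.
split=> [h|/cvgrPdist_lt h e e0].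
  apply/cvgrPdist_lt => e /complex_gt0P[r r0 ->].
  by apply: filterS (h r r0) => t; rewrite ltr_norm_complex rnorm_distC.
have e0' : 0 < e%:C%C by rewrite ltcR.
by apply: filterS (h _ e0') => t; rewrite ltr_norm_complex rnorm_distC.
Qed.

Lemma cauchy_rnorm_cvg (B : completeNormedModType R[i]) (u : nat -> B) :
  (forall e : R, 0 < e ->
    exists N, forall k l, (N <= k)%N -> (N <= l)%N -> rnorm (u k - u l) < e) ->
  exists l : B, u @ \oo --> l.
Proof.
move=> cu; exists (lim (u @ \oo)); apply/cauchy_cvgP.
apply/cauchy_ballP => e /complex_gt0P[r r0 ->].
have [N hN] := cu r r0.
exists ([set u k | k in [set k | (N <= k)%N]],
  [set u k | k in [set k | (N <= k)%N]]) => /=.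
  by split; exists N => // k /= Nk; exists k.
move=> [_ _] /= [[k Nk <-] [l Nl <-]].
by rewrite -ball_normE /ball_ /= ltr_norm_complex hN.
Qed.

Lemma closure_rnorm (A : set (R[i])^o) (l : R[i]) : closure A l ->
  forall e : R, 0 < e -> exists2 a, A a & rnorm (l - a) < e.
Proof.
move=> /= cl e e0.
have e0' : 0 < e%:C%C by rewrite ltcR.
have [a [Aa]] := cl _ (nbhsx_ballx (l : (R[i])^o) _ e0').
by rewrite -ball_normE /ball_ /= ltr_norm_complex => la; exists a.
Qed.

End cvg_rnorm.

(** * Approximate eigenvectors *)

Section approximate_eigenvectors.
Context {R : realType} {B : completeNormedModType R[i]}.
Implicit Types (H : partial_op B) (z : R[i]) (v x : B).

Lemma resolventP H z : ~ spectrum H z -> is_resolvent H z (resolvent H z).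
Proof.
by move=> /contrapT[T hT]; apply: (@xgetPex _ 0 (is_resolvent H z)); exists T.
Qed.

Lemma resolvent_identity H z w S T x :
  is_resolvent H z S -> is_resolvent H w T ->
  S x - T x = (w - z) *: S (T x).
Proof.
move=> [/bounded_opP[lS _] _ S2] [_ T1 _].
have [domT T1x] := T1 x.
rewrite -(linearZ lS) -{1}T1x -[in X in _ - X](S2 _ domT) -linearB//.
by congr S; rewrite opprB addrA subrK scalerBl.
Qed.

(** Apply [T] to [(w - H) v = (z - H) v - (z - w) v]. *)
Lemma resolvent_approx_eigenvector H z w T v :
  is_resolvent H z T -> z != w -> dom H v ->
  rnorm (T v - (z - w)^-1 *: v) <=
    rnorm (z - w)^-1 * rnorm (T (w *: v - act H v)).
Proof.
move=> [/bounded_opP[lT _] _ T2] zw dv.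
rewrite -rnormZ le_eqVlt rnorm_distC; apply/orP; left; apply/eqP.
have -> : w *: v - act H v = (z *: v - act H v) - (z - w) *: v.
  by rewrite scalerBl opprB [RHS]addrC addrA subrK.
rewrite (linearB lT) T2// (linearZ lT) scalerBr scalerA mulVf ?scale1r//.
by rewrite subr_eq0.
Qed.

Variables (H : partial_op B) (s : R).
Hypotheses (linH : linear_op H) (closedH : closed_op H).
Hypothesis realH : forall z, spectrum H z -> complex.Im z = 0.

Let ndom0 : dom H 0. Proof. by case: linH. Qed.

Lemma dom_lin (a : R[i]) (x y : B) : dom H x -> dom H y ->
  dom H (a *: x + y) /\ act H (a *: x + y) = a *: act H x + act H y.
Proof. by case: linH => _; apply. Qed.

Lemma act_op0 : act H 0 = 0.
Proof.
have [_] := dom_lin (-1) ndom0 ndom0.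
by rewrite scaler0 addr0 scaleN1r addNr.
Qed.

Lemma dom_scale (a : R[i]) (x : B) : dom H x ->
  dom H (a *: x) /\ act H (a *: x) = a *: act H x.
Proof. by move=> dx; have := dom_lin a dx ndom0; rewrite act_op0 !addr0. Qed.

(** If [s] has no approximate eigenvectors then [s - H] is bounded below, so
    the resolvents at [s + i t] stay bounded as [t] tends to 0; they converge
    strongly, and closedness of [H] makes the limit an inverse of [s - H]. *)
Lemma approx_eigenvector (d : R) : 0 < d -> spectrum H s%:C%C ->
  exists v, [/\ dom H v, rnorm v = 1 & rnorm (s%:C%C *: v - act H v) < d].
Proof.
move=> d0 spec_s; apply: contrapT => noev; apply: spec_s.
have d0' := ltW d0.
have lower x : dom H x -> d * rnorm x <= rnorm (s%:C%C *: x - act H x).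
  move=> dx; have [->|x0] := eqVneq x 0; first by rewrite rnorm0 mulr0 rnorm_ge0.
  have nx : 0 < rnorm x by rewrite lt_neqAle rnorm_ge0 eq_sym rnorm_eq0 x0.
  have [dx' ax'] := dom_scale (rnorm x)^-1%:C%C dx.
  rewrite leNgt; apply/negP => hlt; apply: noev.
  exists ((rnorm x)^-1%:C%C *: x); split=> //.
    by rewrite rnormZ rnorm_real gtr0_norm ?invr_gt0// mulVf ?gt_eqF.
  rewrite ax' scalerA mulrC -scalerA -scalerBr rnormZ rnorm_real.
  by rewrite gtr0_norm ?invr_gt0// mulrC ltr_pdivrMr.
(* A defect below [d / 2] leaves half of the lower bound [d], uniformly in [k]. *)
pose eta k : R := d / 2 / k.+1%:R.
have eta0 k : 0 < eta k by rewrite !divr_gt0.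
have etad k : eta k <= d / 2.
  by rewrite /eta ler_pdivrMr// ler_peMr ?divr_ge0 ?(ltW d0)// ler1n.
pose zk k : R[i] := (s +i* eta k)%C.
have zkE k : zk k = s%:C%C + (0 +i* eta k)%C.
  by apply/eqP; rewrite eq_complex /= addr0 add0r !eqxx.
pose T k := resolvent H (zk k).
have TP k : is_resolvent H (zk k) (T k).
  by apply: resolventP => /realH /= etak0; have := eta0 k; rewrite etak0 ltxx.
have Tle k x : rnorm (T k x) <= 2 / d * rnorm x.
  have [_ /(_ x)[domT Tx] _] := TP k.
  have := lower _ domT.
  have -> : s%:C%C *: T k x - act H (T k x) = x - (0 +i* eta k)%C *: T k x.
    by rewrite -[X in _ = X - _]Tx zkE scalerDl [RHS]addrAC addrK.
  move=> /le_trans/(_ (rnormB _ _)); rewrite rnormZ rnorm_imag gtr0_norm//.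
  have := ler_wpM2r (rnorm_ge0 (T k x)) (etad k).
  rewrite [2 / d * _]mulrAC ler_pdivlMr// [rnorm (T k x) * d]mulrC; lra.
have sol x : exists2 y, dom H y & s%:C%C *: y - act H y = x.
  have [|y Ty] := @cauchy_rnorm_cvg _ B (T^~ x).
    move=> e e0; pose K := (2 / d) ^+ 2 * rnorm x * d + 1.
    have K0 : 0 < K.
      by rewrite /K ltr_wpDl// !mulr_ge0 ?rnorm_ge0 ?exprn_ge0 ?divr_ge0 ?invr_ge0.
    pose N := Num.bound (K / e).
    have hN : K / e < N%:R by apply: archi_boundP; rewrite divr_ge0// ltW.
    exists N => k l Nk Nl.
    rewrite (resolvent_identity x (TP k) (TP l)) rnormZ.
    have -> : rnorm (zk l - zk k) = `|eta l - eta k|.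
      rewrite -rnorm_imag; congr rnorm; apply/eqP.
      by rewrite eq_complex /= subrr !eqxx.
    have etaN j : (N <= j)%N -> eta j <= d / N.+1%:R.
      move=> Nj; rewrite ler_pM ?invr_ge0 ?divr_ge0//; first lra.
      by rewrite lef_pV2 ?posrE// ler_nat.
    have dk : `|eta l - eta k| <= d / N.+1%:R.
      have := etaN _ Nk; have := etaN _ Nl; have := eta0 k; have := eta0 l.
      by rewrite ler_norml; move: (eta l) (eta k) (d / _) => a b c; lra.
    have := ler_pM (normr_ge0 _) (rnorm_ge0 _) dk (Tle k (T l x)).
    move=> /le_lt_trans; apply.
    have h : d / N.+1%:R * (2 / d * rnorm (T l x)) <= K / N.+1%:R.
      rewrite mulrAC ler_pM2r ?invr_gt0// ler_wpDr//.
      rewrite [d * _]mulrC ler_wpM2r//.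
      have -> : (2 / d) ^+ 2 * rnorm x = 2 / d * (2 / d * rnorm x).
        by rewrite expr2 -!mulrA.
      by rewrite ler_wpM2l ?divr_ge0.
    apply: le_lt_trans h _; rewrite ltr_pdivrMr// mulrC -ltr_pdivrMr//.
    by rewrite (lt_le_trans hN)// ler_nat.
  have eta_cvg : (0 +i* eta k)%C *: T k x @[k --> \oo] --> (0 : B).
    apply/cvg_rnormP => e e0; pose K := d / 2 * (2 / d * rnorm x) + 1.
    have K0 : 0 < K by rewrite /K ltr_wpDl// !mulr_ge0 ?rnorm_ge0 ?divr_ge0 ?invr_ge0.
    pose N := Num.bound (K / e).
    have hN : K / e < N%:R by apply: archi_boundP; rewrite divr_ge0// ltW.
    exists N => // k /= Nk; rewrite subr0 rnormZ rnorm_imag gtr0_norm//.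
    apply: (le_lt_trans (ler_wpM2l (ltW (eta0 k)) (Tle k x))).
    have : eta k * (2 / d * rnorm x) <= K / k.+1%:R.
      by rewrite /eta mulrAC ler_pM2r ?invr_gt0// lerDl.
    move=> /le_lt_trans; apply; rewrite ltr_pdivrMr// mulrC -ltr_pdivrMr//.
    by rewrite (lt_le_trans hN)// ler_nat (leq_trans Nk).
  have /= : [set p | dom H p.1 /\ p.2 = act H p.1] (y, s%:C%C *: y - x).
    pose u k := (T k x, zk k *: T k x - x).
    have ucvg : zk k *: T k x - x @[k --> \oo] --> s%:C%C *: y - x.
      under eq_cvg do rewrite zkE scalerDl -addrA.
      apply: cvgD; first exact: cvgZl_tmp.
      by rewrite -[X in _ --> X]add0r; apply: cvgD => //; exact: cvg_cst.
    have pcvg : u @ \oo --> ((y, s%:C%C *: y - x) : (B * B)%type).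
      exact: cvg_pair Ty ucvg.
    have := @closed_cvg nat (B * B)%type \oo _ u _ closedH _ _ pcvg; apply.
    apply: nearW => k /=; have [_ /(_ x)[domT Tx] _] := TP k; split=> //.
    by rewrite -[X in _ - X]Tx opprB addrCA subrr addr0.
  by move=> [dy e]; exists y => //; rewrite -e opprB addrCA subrr addr0.
have inj x y : dom H x -> dom H y ->
    s%:C%C *: x - act H x = s%:C%C *: y - act H y -> x = y.
  move=> dx dy /eqP; rewrite -subr_eq0 => /eqP exy.
  have [dxy axy] := dom_lin (-1) dy dx.
  apply/eqP; rewrite -subr_eq0 -rnorm_eq0 eq_le rnorm_ge0 andbT.
  have := lower _ dxy; rewrite axy !scaleN1r scalerDr scalerN.
  have -> : - (s%:C%C *: y) + s%:C%C *: x - (- act H y + act H x) = 0.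
    rewrite -exy opprD opprK opprB [- _ + _]addrC.
    by rewrite [X in _ + X = _]addrC [X in _ = _ + X]addrC addrACA.
  by rewrite rnorm0 pmulr_rle0// addrC.
have [T0 T0P] := choice (fun x => let: ex_intro2 y dy ey := sol x in
  ex_intro (fun y => dom H y /\ s%:C%C *: y - act H y = x) y (conj dy ey)).
have lT0 : linear T0.
  move=> a u v; have [du eu] := T0P u; have [dv ev] := T0P v.
  have [dw ew] := T0P (a *: u + v); have [dl al] := dom_lin a du dv.
  apply: inj => //; rewrite ew al -{1}eu -{1}ev scalerBr scalerDr !scalerA.
  by rewrite mulrC opprD addrACA.
exists T0; split.
- apply: (@bounded_op_le _ _ _ d^-1) => //; last by rewrite invr_ge0 ltW.
  move=> x; have [dx ex] := T0P x; rewrite mulrC ler_pdivlMr// mulrC.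
  by rewrite -[in leRHS]ex lower.
- by move=> x; have [] := T0P x.
- by move=> x dx; have [d' e'] := T0P (s%:C%C *: x - act H x); exact: inj.
Qed.

End approximate_eigenvectors.

(** * Simple functions *)

Section simple_functions.
Context {R : realType} {d : measure_display} {X : measurableType d}.
Variable mu : {measure set X -> \bar R}.

Section vector_valued.
Context {V : normedModType R[i]} {I : eqType}.
Variables (A : I -> set X) (v : I -> V).
Hypothesis mA : forall i, measurable (A i).

Let f (s : seq I) (w : V) (t : X) : R :=
  rnorm (w + \sum_(i <- s) (\1_(A i) t : R[i]) *: v i).

Let f_in i s w t : A i t -> f (i :: s) w t = f s (w + v i) t.
Proof. by move=> At; rewrite /f big_cons indicE mem_set//= scale1r addrA. Qed.

Let f_notin i s w t : ~ A i t -> f (i :: s) w t = f s w t.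
Proof. by move=> At; rewrite /f big_cons indicE memNset//= scale0r add0r. Qed.

(** The offset [w] makes the induction on [s] work: on [A i] the first term is
    absorbed into it. *)
Lemma measurable_rnorm_simple (s : seq I) (D : set X) (w : V) : measurable D ->
  measurable_fun D (fun t => rnorm (w + \sum_(i <- s) (\1_(A i) t : R[i]) *: v i)).
Proof.
rewrite -/(f s w); elim: s D w => [|i s ih] D w mD.
  apply: (eq_measurable_fun (cst (rnorm w))) => // t _.
  by rewrite /f big_nil addr0.
have DE : D = (D `&` A i) `|` (D `\` A i) by rewrite setUIDK.
rewrite DE; apply/measurable_funU; [exact: measurableI|exact: measurableD|split].
  apply: (eq_measurable_fun (f s (w + v i))); last exact/ih/measurableI.
  by move=> t; rewrite inE => -[_ At]; rewrite f_in.
apply: (eq_measurable_fun (f s w)); last exact/ih/measurableD.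
by move=> t; rewrite inE => -[_ At]; rewrite f_notin.
Qed.

Hypothesis fA : forall i, (mu (A i) < +oo)%E.

(** Splitting the domain along the sets one at a time reduces the triangle
    inequality for the integral to the one for a sum of two vectors. *)
Lemma rnorm_simple_integral_on (s : seq I) (D : set X) (w : V) :
  measurable D -> (mu D < +oo)%E ->
  ((rnorm ((fine (mu D))%:C%C *: w +
           \sum_(i <- s) (fine (mu (D `&` A i)))%:C%C *: v i))%:E <=
   \int[mu]_(t in D)
     (rnorm (w + \sum_(i <- s) (\1_(A i) t : R[i]) *: v i))%:E)%E.
Proof.
rewrite -/(f s w).
under eq_integral do rewrite -/(f s w _).
elim: s D w => [|i s ih] D w mD fD.
  under eq_integral do rewrite /f big_nil addr0.
  rewrite big_nil addr0 integral_cst// rnormZ rnorm_real ger0_norm ?fine_ge0//.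
  by rewrite EFinM fineK ?ge0_fin_numE// muleC.
have mI := measurableI _ _ mD (mA i); have mC := measurableD mD (mA i).
have fI : (mu (D `&` A i) < +oo)%E by rewrite (le_lt_trans _ fD)// le_measure ?inE.
have fC : (mu (D `\` A i) < +oo)%E by rewrite (le_lt_trans _ fD)// le_measure ?inE.
have split_mu E : measurable E -> fine (mu (D `&` E)) =
    fine (mu (D `&` A i `&` E)) + fine (mu ((D `\` A i) `&` E)).
  move=> mE; rewrite -fineD; last 2 first.
  - rewrite ge0_fin_numE// (le_lt_trans _ fI)// le_measure ?inE//.
    exact: (measurableI _ _ mI mE).
  - rewrite ge0_fin_numE// (le_lt_trans _ fC)// le_measure ?inE//.
    exact: (measurableI _ _ mC mE).
  rewrite -measureU; [|exact: measurableI|exact: measurableI|].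
    by rewrite -setIUl setUIDK.
  by apply/seteqP; split=> // t [[[_ At] _] [[_ nAt] _]].
have -> : (fine (mu D))%:C%C *: w +
    \sum_(j <- i :: s) (fine (mu (D `&` A j)))%:C%C *: v j =
  ((fine (mu (D `&` A i)))%:C%C *: (w + v i) +
     \sum_(j <- s) (fine (mu (D `&` A i `&` A j)))%:C%C *: v j) +
  ((fine (mu (D `\` A i)))%:C%C *: w +
     \sum_(j <- s) (fine (mu ((D `\` A i) `&` A j)))%:C%C *: v j).
  rewrite addrACA -big_split /= big_cons.
  have -> : \sum_(j <- s) (fine (mu (D `&` A j)))%:C%C *: v j =
     \sum_(j <- s) ((fine (mu (D `&` A i `&` A j)))%:C%C *: v j +
      (fine (mu ((D `\` A i) `&` A j)))%:C%C *: v j).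
    by apply: eq_bigr => j _; rewrite split_mu// rmorphD scalerDl.
  have := split_mu _ measurableT; rewrite !setIT => ->.
  by rewrite (rmorphD (real_complex R)) /= scalerDl scalerDr -!addrA; congr (_ + _);
    rewrite addrCA.
have DE : D = (D `&` A i) `|` (D `\` A i) by rewrite setUIDK.
rewrite [leRHS](_ : _ = \int[mu]_(t in D `&` A i) (f (i :: s) w t)%:E +
    \int[mu]_(t in D `\` A i) (f (i :: s) w t)%:E)%E; last first.
  rewrite -ge0_integral_setU//; first by rewrite -DE.
  - rewrite -DE; apply/measurable_EFinP; exact: measurable_rnorm_simple.
  - by move=> t _; rewrite lee_fin rnorm_ge0.
  - by apply/disj_setPS => t [[_ At] [_ nAt]].
have tri (a b : V) (x y : \bar R) : ((rnorm a)%:E <= x)%E ->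
    ((rnorm b)%:E <= y)%E -> ((rnorm (a + b))%:E <= x + y)%E.
  by move=> ax bY; rewrite (le_trans _ (leeD ax bY))// lee_fin rnormD.
apply: tri.
  rewrite (le_trans (ih _ _ mI fI))// le_eqVlt; apply/orP; left; apply/eqP.
  by apply: eq_integral => t; rewrite inE => -[_ At]; rewrite f_in.
rewrite (le_trans (ih _ _ mC fC))// le_eqVlt; apply/orP; left; apply/eqP.
by apply: eq_integral => t; rewrite inE => -[_ At]; rewrite f_notin.
Qed.

(** Both sides only see the union of the sets, which has finite measure. *)
Lemma rnorm_simple_integral (s : seq I) :
  ((rnorm (\sum_(i <- s) (fine (mu (A i)))%:C%C *: v i))%:E <=
   \int[mu]_t (rnorm (\sum_(i <- s) (\1_(A i) t : R[i]) *: v i))%:E)%E.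
Proof.
pose D := \big[setU/set0]_(i <- s) A i.
have mD : measurable D by exact: bigsetU_measurable.
have fD : (mu D < +oo)%E.
  rewrite /D; elim: (s) => [|i s' ih]; first by rewrite big_nil measure0.
  rewrite big_cons.
  have mU : measurable (\big[setU/set0]_(j <- s') A j) by exact: bigsetU_measurable.
  rewrite (@le_lt_trans _ _ (mu (A i) + mu (\big[setU/set0]_(j <- s') A j))%E)//.
    exact: measureU2.
  exact: lte_add_pinfty.
have mf := @measurable_rnorm_simple s setT 0 measurableT.
under eq_integral do rewrite -[\sum_(i <- s) _]add0r.
apply: (@le_trans _ _ (\int[mu]_(t in D)
     (rnorm (0 + \sum_(i <- s) (\1_(A i) t : R[i]) *: v i))%:E)%E).
  apply: le_trans (@rnorm_simple_integral_on s D 0 mD fD).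
  rewrite scaler0 add0r lee_fin le_eqVlt; apply/orP; left; apply/eqP.
  congr rnorm; apply: eq_big_seq => i si; congr (_%:C%C *: _); congr (fine (mu _)).
  rewrite setIidr// /D; elim: (s) si => // j s' ih; rewrite inE big_cons.
  by case/predU1P => [->|/ih sub]; [exact: subsetUl|move=> t /sub; right].
apply: ge0_subset_integral => //.
- exact/measurable_EFinP.
- by move=> t _; rewrite lee_fin rnorm_ge0.
Qed.

End vector_valued.

(** A function with a countable set of approximating values [T j] is
    approximated in mean by choosing, at each point [t], the best of the first
    [k + 1] values.  Below, [N j t] stands for the distance of the function to
    [T j] at [t], and [T 0 = 0], so that the error never exceeds the norm
    [N 0 t] of the function and dominated convergence applies. *)
Section best_approximation.
Variable N : nat -> X -> R.

Fixpoint best_index (k : nat) (t : X) : nat :=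
  if k is k'.+1 then
    if N k t < N (best_index k' t) t then k else best_index k' t
  else 0%N.

Lemma best_index_le k t : (best_index k t <= k)%N.
Proof. by elim: k => //= k ih; case: ifP => // _; rewrite leqW. Qed.

Lemma best_index_min k j t : (j <= k)%N -> N (best_index k t) t <= N j t.
Proof.
elim: k => [|k ih]; first by rewrite leqn0 => /eqP ->.
rewrite leq_eqVlt ltnS => /predU1P[->|/ih {}ih] /=; case: ltP => // /ltW.
by move=> /le_trans; apply.
Qed.

Lemma best_index_gt0 k t : (0 < best_index k t)%N ->
  N (best_index k t) t < N 0%N t.
Proof.
elim: k => //= k ih; case: ltP => // lt_k _.
by rewrite (lt_le_trans lt_k)// best_index_min.
Qed.

Hypothesis mN : forall j, measurable_fun setT (N j).

Lemma measurable_best_index k :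
  (forall j, measurable [set t | best_index k t = j]) /\
  measurable_fun setT (fun t => N (best_index k t) t).
Proof.
elim: k => [|k [ih1 ih2]] /=.
  split=> // j; have [->|j0] := eqVneq j 0%N.
    by rewrite (_ : [set _ | _] = setT)//; apply/seteqP; split.
  rewrite (_ : [set _ | _] = set0)//; apply/seteqP; split=> // t /=.
  by move=> e; rewrite -e eqxx in j0.
have mlt : measurable [set t | N k.+1 t < N (best_index k t) t].
  by rewrite -[X in measurable X]setTI; exact: measurable_fun_ltr.
split=> [j|].
  rewrite (_ : [set _ | _] =
    ([set t | N k.+1 t < N (best_index k t) t] `&` [set t | k.+1 = j]) `|`
    (~` [set t | N k.+1 t < N (best_index k t) t] `&`
       [set t | best_index k t = j])).
    apply: measurableU; apply: measurableI => //; last exact: measurableC.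
    have [->|j0] := eqVneq k.+1 j.
      by rewrite (_ : [set _ | _] = setT)//; apply/seteqP; split.
    rewrite (_ : [set _ | _] = set0)//; apply/seteqP; split=> // t /= e.
    by rewrite e eqxx in j0.
  apply/seteqP; split=> t /=.
    by case: ifPn => [lt ->|/negP nlt ->]; [left|right].
  by move=> [[-> ->]//|[/negP/negbTE -> ->]].
apply: (eq_measurable_fun (fun t => Num.min (N k.+1 t) (N (best_index k t) t))).
  by move=> t _; rewrite /Order.min; case: ifP.
exact: measurable_minr.
Qed.

Hypothesis N_ge0 : forall j t, 0 <= N j t.
Hypothesis intN : (\int[mu]_t (N 0%N t)%:E < +oo)%E.
Hypothesis N_dense : forall t e, 0 < e -> exists j, N j t < e.
Hypothesis N_away : forall j, exists2 r : R, 0 < r &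
  forall t, N j t < N 0%N t -> r <= N 0%N t.

(** Where [T j] is strictly better than 0, the norm of the function is bounded
    below by a positive constant ([N_away]), so that Markov's inequality applies. *)
Lemma best_index_finite k j : (0 < j)%N ->
  (mu [set t | best_index k t = j] < +oo)%E.
Proof.
move=> j0; have [r r0 hr] := N_away j.
have mA := (measurable_best_index k).1 j.
have : (r%:E * mu [set t | best_index k t = j] < +oo)%E.
  apply: le_lt_trans intN.
  rewrite -integral_cst//.
  apply: (@le_trans _ _ (\int[mu]_(t in [set t | best_index k t = j]) (N 0%N t)%:E)%E).
    apply: ge0_le_integral => //.
    - by move=> t _; rewrite lee_fin ltW.
    - by apply/measurable_EFinP; exact: measurable_funTS.
    - move=> t /= e; rewrite lee_fin hr// -{1}e best_index_gt0// e//.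
  apply: ge0_subset_integral => //; first exact/measurable_EFinP.
  by move=> t _; rewrite lee_fin.
rewrite !ltey; apply: contraNN => /eqP ->.
by rewrite gt0_muley// lte_fin.
Qed.

Lemma best_approximation (e : R) : 0 < e -> exists k,
  (\int[mu]_t (N (best_index k t) t)%:E < e%:E)%E.
Proof.
move=> e0.
have := @dominated_cvg _ _ _ mu setT measurableT
  (fun k t => (N (best_index k t) t)%:E) (cst 0%E) (fun t => (N 0%N t)%:E).
rewrite integral0 => cvg0.
have {}cvg0 : (\int[mu]_t (N (best_index k t) t)%:E)%E @[k --> \oo] --> 0%E.
  apply: cvg0 => //.
  - by move=> k; apply/measurable_EFinP; exact: (measurable_best_index k).2.
  - move=> t _; apply: cvg_EFin; first exact: nearW.
    apply/cvgrPdist_lt => e' e'0; have [j hj] := N_dense t e'0.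
    near=> k; rewrite /= sub0r normrN ger0_norm//.
    by rewrite (le_lt_trans _ hj)// best_index_min//; near: k; exact: nbhs_infty_ge.
  - apply/integrableP; split; first exact/measurable_EFinP.
    by under eq_integral do rewrite gee0_abs ?lee_fin//.
  - by move=> k t _; rewrite gee0_abs ?lee_fin// best_index_min.
have /fine_cvgP[_ /cvgrPdist_lt /(_ _ e0)] := cvg0.
have /fine_cvgP[fin_near _] := cvg0.
move=> near_e; have [k _ hk] := filterI fin_near near_e.
have [fk ek] := hk k (leqnn k).
exists k; rewrite -(fineK fk) lte_fin.
by rewrite sub0r normrN in ek; rewrite (le_lt_trans (ler_norm _) ek).
Unshelve. all: by end_near. Qed.

(** Index 0 is left out of the simple function because [T 0 = 0]; its level set
    is the only one of possibly infinite measure. *)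
Lemma best_index_sum (V : lmodType R[i]) (T : nat -> V) k t : T 0%N = 0 ->
  \sum_(i < k) (\1_[set t | best_index k t = i.+1] t : R[i]) *: T i.+1 =
  T (best_index k t).
Proof.
move=> T0; have := best_index_le k t; set c := best_index k t => ck.
have indE (i : nat) : (\1_[set t | best_index k t = i.+1] t : R[i]) = (c == i.+1)%:R.
  rewrite indicE (_ : (t \in _) = (c == i.+1))//.
  by apply/idP/eqP; rewrite in_setE.
case cE : c => [|c'].
  by rewrite T0 big1// => i _; rewrite indE cE scale0r.
have c'k : (c' < k)%N by rewrite -cE.
rewrite (bigD1 (Ordinal c'k))//= indE cE eqxx scale1r big1 ?addr0// => i ic.
rewrite indE cE eqSS; case: eqP => [e|]; last by rewrite scale0r.
by move/eqP: ic; case; apply: val_inj.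
Qed.

End best_approximation.
End simple_functions.

(** * Integrals of complex functions *)

Section complex_integral.
Context {R : realType} {d : measure_display} {X : measurableType d}.
Variable mu : {measure set X -> \bar R}.
Implicit Types (b : X -> R[i]).

Definition cmeasurable b :=
  measurable_fun setT (@complex.Re R \o b) /\
  measurable_fun setT (@complex.Im R \o b).

Definition cintegrable b :=
  mu.-integrable setT (fun t => (complex.Re (b t))%:E) /\
  mu.-integrable setT (fun t => (complex.Im (b t))%:E).

Definition cintegral b : R[i] :=
  (Rintegral mu setT (@complex.Re R \o b) +i*
   Rintegral mu setT (@complex.Im R \o b))%C.

Lemma measurable_rnorm b : cmeasurable b ->
  measurable_fun setT (fun t => rnorm (b t)).
Proof.
move=> [mr mi]; under eq_fun do rewrite rnormE.
apply: (@measurableT_comp _ _ _ _ _ _ (@Num.sqrt R)).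
  by apply: continuous_measurable_fun; exact: sqrt_continuous.
by apply: measurable_funD; exact: measurable_funX.
Qed.

Lemma cintegrable_measurable b : cintegrable b -> cmeasurable b.
Proof.
by move=> [/integrableP[mr _] /integrableP[mi _]]; split; exact/measurable_EFinP.
Qed.

Lemma integrable_rnorm b : cintegrable b ->
  mu.-integrable setT (fun t => (rnorm (b t))%:E).
Proof.
move=> ib; have mb := measurable_rnorm (cintegrable_measurable ib).
have iD := integrableD measurableT (integrable_abse ib.1) (integrable_abse ib.2).
apply: (le_integrable measurableT _ _ iD); first exact/measurable_EFinP.
move=> t _ /=; rewrite lee_fin ger0_norm ?rnorm_ge0// [leRHS]ger0_norm ?addr_ge0//.
exact: rnorm_leReIm.
Qed.

Lemma dominated_cintegrable b (W : X -> R) : cmeasurable b ->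
  mu.-integrable setT (EFin \o W) -> (forall t, rnorm (b t) <= W t) ->
  cintegrable b.
Proof.
move=> [mr mi] iW bW; split; apply: (le_integrable measurableT _ _ iW).
- exact/measurable_EFinP.
- move=> t _ /=; rewrite lee_fin (le_trans (normRe_le _))//.
  by rewrite (le_trans (bW t))// ler_norm.
- exact/measurable_EFinP.
- move=> t _ /=; rewrite lee_fin (le_trans (normIm_le _))//.
  by rewrite (le_trans (bW t))// ler_norm.
Qed.

Lemma measurable_EFin_rnorm b : cmeasurable b ->
  measurable_fun setT (fun t => (rnorm (b t))%:E).
Proof. by move=> mb; apply/measurable_EFinP; exact: measurable_rnorm. Qed.

Lemma cmeasurableB b b' : cmeasurable b -> cmeasurable b' ->
  cmeasurable (fun t => b t - b' t).
Proof.
move=> [m1 m2] [m1' m2']; split.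
  rewrite (_ : _ \o _ = (@complex.Re R \o b) \- (@complex.Re R \o b')).
    exact: measurable_funB.
  by apply/funext => t /=; rewrite raddfB.
rewrite (_ : _ \o _ = (@complex.Im R \o b) \- (@complex.Im R \o b')).
  exact: measurable_funB.
by apply/funext => t /=; rewrite raddfB.
Qed.

Section simple.
Variables (k : nat) (A : 'I_k -> set X).
Hypotheses (mA : forall i, measurable (A i)).
Hypothesis (fA : forall i, (mu (A i) < +oo)%E).

Lemma integrable_indic_fin (D : set X) : measurable D -> (mu D < +oo)%E ->
  mu.-integrable setT (fun t => (\1_D t : R)%:E).
Proof.
move=> mD fD; apply/integrableP; split; first exact/measurable_EFinP.
under eq_integral do rewrite gee0_abs ?lee_fin//.
by rewrite integral_indic// setIT.
Qed.

Lemma Rintegral_simple (r : 'I_k -> R) :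
  mu.-integrable setT (fun t => (\sum_(i < k) (\1_(A i) t : R) * r i)%:E) /\
  Rintegral mu setT (fun t => \sum_(i < k) (\1_(A i) t : R) * r i) =
  \sum_(i < k) fine (mu (A i)) * r i.
Proof.
have iA i : mu.-integrable setT (fun t => ((\1_(A i) t : R) * r i)%:E).
  by under eq_fun do rewrite EFinM; apply: integrableZr => //; exact: integrable_indic_fin.
split.
  under eq_fun do rewrite -sumEFin.
  by apply: integrable_sum => // i _; exact: iA.
rewrite /Rintegral; under eq_integral do rewrite -sumEFin.
rewrite integral_sum// -sum_fine; last by move=> i _; exact: integrable_fin_num.
apply: eq_bigr => i _; rewrite -[LHS]/(Rintegral _ _ _).
rewrite RintegralZr//; last exact: integrable_indic_fin.
by rewrite /Rintegral integral_indic// setIT.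
Qed.

Lemma indicZ_Re (D : set X) t (z : R[i]) :
  complex.Re ((\1_D t : R[i]) * z) = (\1_D t : R) * complex.Re z.
Proof. by rewrite !indicE; case: (t \in D); rewrite ?mul1r ?mul0r. Qed.

Lemma indicZ_Im (D : set X) t (z : R[i]) :
  complex.Im ((\1_D t : R[i]) * z) = (\1_D t : R) * complex.Im z.
Proof. by rewrite !indicE; case: (t \in D); rewrite ?mul1r ?mul0r. Qed.

Lemma realZ_Re (x : R) (z : R[i]) : complex.Re (x%:C%C * z) = x * complex.Re z.
Proof. by case: z => u v /=; rewrite mul0r subr0. Qed.

Lemma realZ_Im (x : R) (z : R[i]) : complex.Im (x%:C%C * z) = x * complex.Im z.
Proof. by case: z => u v /=; rewrite mul0r addr0. Qed.

Lemma cintegral_simple (r : 'I_k -> R[i]) :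
  cintegrable (fun t => \sum_(i < k) (\1_(A i) t : R[i]) * r i) /\
  cintegral (fun t => \sum_(i < k) (\1_(A i) t : R[i]) * r i) =
  \sum_(i < k) (fine (mu (A i)))%:C%C * r i.
Proof.
have reE : @complex.Re R \o (fun t => \sum_(i < k) (\1_(A i) t : R[i]) * r i) =
    (fun t => \sum_(i < k) (\1_(A i) t : R) * complex.Re (r i)).
  by apply/funext => t /=; rewrite raddf_sum; apply: eq_bigr => i _; exact: indicZ_Re.
have imE : @complex.Im R \o (fun t => \sum_(i < k) (\1_(A i) t : R[i]) * r i) =
    (fun t => \sum_(i < k) (\1_(A i) t : R) * complex.Im (r i)).
  by apply/funext => t /=; rewrite raddf_sum; apply: eq_bigr => i _; exact: indicZ_Im.
have [ir re] := Rintegral_simple (fun i => complex.Re (r i)).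
have [ii im] := Rintegral_simple (fun i => complex.Im (r i)).
split.
  split; [move: ir|move: ii]; apply: eq_integrable => // t _; congr EFin.
    by have /= -> := congr1 (@^~ t) reE.
  by have /= -> := congr1 (@^~ t) imE.
rewrite /cintegral reE imE re im; apply/eqP; rewrite eq_complex /= !raddf_sum /=.
apply/andP; split; apply/eqP; apply: eq_bigr => i _.
  by rewrite -realZ_Re.
by rewrite -realZ_Im.
Qed.

End simple.

(** The factor 2 is the price of estimating the real and imaginary parts
    separately.  It is harmless where the right-hand side tends to 0. *)
Lemma rnorm_cintegralB b b' : cintegrable b -> cintegrable b' ->
  ((rnorm (cintegral b - cintegral b'))%:E <=
   2%:E * \int[mu]_t (rnorm (b t - b' t))%:E)%E.
Proof.
move=> ib ib'.
have mB := cmeasurableB (cintegrable_measurable ib) (cintegrable_measurable ib').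
have bnd (p : R[i] -> R) : {morph p : u v / u - v} ->
    (forall z, `|p z| <= rnorm z) ->
    measurable_fun setT (p \o (fun t => b t - b' t)) ->
    mu.-integrable setT (EFin \o (p \o b)) -> mu.-integrable setT (EFin \o (p \o b')) ->
    (`|Rintegral mu setT (p \o b) - Rintegral mu setT (p \o b')|%:E <=
     \int[mu]_t (rnorm (b t - b' t))%:E)%E.
  move=> pB pn mp i1 i2; rewrite -RintegralB//.
  have iB : mu.-integrable setT (EFin \o (fun t => p (b t) - p (b' t))).
    by have := integrableB measurableT i1 i2; apply: eq_integrable.
  rewrite (le_trans (y := (Rintegral mu setT (fun t => `|p (b t) - p (b' t)|))%:E))//.
    by rewrite lee_fin le_normr_Rintegral.
  rewrite /Rintegral fineK; last first.
    by apply: integrable_fin_num => //; have := integrable_abse iB; apply: eq_integrable.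
  apply: ge0_le_integral => //.
  - by apply/measurable_EFinP; apply: measurableT_comp => //;
       move: mp; congr measurable_fun; apply/funext => t /=; rewrite pB.
  - exact: measurable_EFin_rnorm.
  - by move=> t _; rewrite lee_fin -pB pn.
rewrite mule_natl mule2n.
apply: (@le_trans _ _ (`|complex.Re (cintegral b - cintegral b')|%:E +
                       `|complex.Im (cintegral b - cintegral b')|%:E)%E).
  by rewrite -EFinD lee_fin rnorm_leReIm.
rewrite leeD// raddfB; apply: bnd; rewrite ?ib.1 ?ib.2 ?ib'.1 ?ib'.2//.
- exact: raddfB.
- exact: normRe_le.
- exact: mB.1.
- exact: raddfB.
- exact: normIm_le.
- exact: mB.2.
Qed.

End complex_integral.

(** * Bochner integrals of operator-valued functions *)

Section rational_points.
Context {R : realType}.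

(** The complex numbers with rational coordinates are listed with 0 in front,
    because 0 has to be the first candidate in the choice of a best value. *)
Definition rat_point (j : nat) : R[i] :=
  if j is j'.+1 then
    if @unpickle (rat * rat)%type j' is Some pq
    then (ratr pq.1 +i* ratr pq.2)%C else 0
  else 0.

Lemma rat_near (x e : R) : 0 < e -> exists q : rat, `|x - ratr q| < e.
Proof.
move=> e0; have [|q] := @rat_in_itvoo R (x - e) (x + e); first lra.
by rewrite in_itv /= => /andP[q1 q2]; exists q; rewrite ltr_norml; lra.
Qed.

Lemma rat_point_dense (z : R[i]) (e : R) : 0 < e ->
  exists j, rnorm (z - rat_point j) < e.
Proof.
move=> e0; have e2 : 0 < e / 2 by rewrite divr_gt0.
have [p hp] := rat_near (complex.Re z) e2.
have [q hq] := rat_near (complex.Im z) e2.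
exists (pickle (p, q)).+1.
have -> : rat_point (pickle (p, q)).+1 = (ratr p +i* ratr q)%C.
  by rewrite /rat_point pickleK.
apply: le_lt_trans (rnorm_leReIm _) _.
by rewrite !raddfB /= (splitr e) ltrD.
Qed.

End rational_points.

Section bochner.
Context {R : realType} {d : measure_display} {X : measurableType d}.
Variable mu : {measure set X -> \bar R}.

(** The approximation in mean of scalar functions, with the points of rational
    coordinates as values. *)
Lemma cintegral_approx (b : X -> R[i]) (e : R) : cintegrable mu b -> 0 < e ->
  exists k (A : 'I_k -> set X) (r : 'I_k -> R[i]),
  [/\ forall i, measurable (A i), forall i, (mu (A i) < +oo)%E,
      (\int[mu]_t (rnorm (b t - \sum_(i < k) (\1_(A i) t : R[i]) * r i))%:E
         < e%:E)%E &
      rnorm (\sum_(i < k) (fine (mu (A i)))%:C%C * r i - cintegral mu b)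
         <= 2 * e].
Proof.
move=> ib e0; pose N j t := rnorm (b t - rat_point j).
have mN j : measurable_fun setT (N j).
  apply: measurable_rnorm; apply: cmeasurableB; first exact: cintegrable_measurable ib.
  by split; exact: measurable_cst.
have intN : (\int[mu]_t (N 0%N t)%:E < +oo)%E.
  have /integrableP[_] := integrable_rnorm ib.
  apply: le_lt_trans; rewrite le_eqVlt; apply/orP; left; apply/eqP.
  by apply: eq_integral => t _; rewrite /N /= subr0 ger0_norm ?rnorm_ge0.
have N_away j : exists2 r, 0 < r & forall t, N j t < N 0%N t -> r <= N 0%N t.
  have [j0|j0] := eqVneq (rat_point j : R[i]) 0.
    by exists 1 => // t; rewrite /N j0 /= ltxx.
  exists (rnorm (rat_point j : R[i]) / 2).
    by rewrite divr_gt0// lt_neqAle rnorm_ge0 eq_sym rnorm_eq0 j0.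
  move=> t; rewrite /N /= subr0 => hlt.
  have := rnormB (b t) (b t - rat_point j); rewrite opprB addrCA subrr addr0; lra.
have N0 j t : 0 <= N j t by exact: rnorm_ge0.
have [k hk] := best_approximation mN N0 intN
  (fun t e e0 => rat_point_dense (b t) e0) e0.
pose A (i : 'I_k) := [set t | best_index N k t = i.+1].
pose r (i : 'I_k) : R[i] := rat_point i.+1.
have mA i : measurable (A i) by exact: (measurable_best_index mN k).1.
have fA i : (mu (A i) < +oo)%E by exact: best_index_finite.
have sE t : \sum_(i < k) (\1_(A i) t : R[i]) * r i = rat_point (best_index N k t).
  by rewrite -(@best_index_sum _ _ X N R[i]^o rat_point k t erefl).
have lt_e : (\int[mu]_t
    (rnorm (b t - \sum_(i < k) (\1_(A i) t : R[i]) * r i))%:E < e%:E)%E.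
  by under eq_integral do rewrite sE.
exists k, A, r; split=> //.
have [is_ <-] := cintegral_simple mA fA r.
rewrite -lee_fin rnorm_distC (le_trans (rnorm_cintegralB ib is_))//.
by rewrite EFinM lee_pmul2l// ltW.
Qed.

Context {B : completeNormedModType R[i]}.
Implicit Types (F : X -> B -> B) (T : nat -> B -> B) (S : B -> B).
Implicit Types (s : @simple_op_fun R B d X mu).

Lemma natSinv_lt (e : R) : 0 < e -> \forall k \near \oo, k.+1%:R^-1 < e.
Proof. by move=> e0; exact: near_infty_natSinv_lt (PosNum e0). Qed.

Lemma fctZE (a : R[i]) (f : B -> B) v : (a *: f) v = a *: f v.
Proof. by []. Qed.

Lemma fct_bigE (I : Type) (r : seq I) (f : I -> B -> B) v :
  (\sum_(i <- r) f i) v = \sum_(i <- r) f i v.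
Proof. by elim/big_rec2: _ => // i y1 y2 _ <-. Qed.

Lemma sof_evalE s t v :
  sof_eval s t v = \sum_i (\1_((@sof_set _ _ _ _ _ s i)) t : R[i]) *: (@sof_val _ _ _ _ _ s i) v.
Proof. by rewrite /sof_eval fct_bigE. Qed.

Lemma sof_integralE s v :
  sof_integral s v = \sum_i (fine (mu ((@sof_set _ _ _ _ _ s i))))%:C%C *: (@sof_val _ _ _ _ _ s i) v.
Proof. by rewrite /sof_integral fct_bigE. Qed.

Lemma bounded_op_sum (I : Type) (r : seq I) (f : I -> B -> B) :
  (forall i, bounded_op (f i)) -> bounded_op (\sum_(i <- r) f i).
Proof.
move=> bf; elim/big_ind: _ => // [|S T bS bT]; first exact: bounded_op0.
rewrite -[T]opprK; apply: bounded_opB => //; rewrite -[- T]add0r.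
by apply: bounded_opB => //; exact: bounded_op0.
Qed.

Lemma bounded_sof_integral s : bounded_op (sof_integral s).
Proof. by apply: bounded_op_sum => i; apply: bounded_opZ; exact: sof_bounded. Qed.

Lemma rnorm_le_opdist F s t v : rnorm v <= 1 ->
  ((rnorm (F t v - sof_eval s t v))%:E <= opdist F (sof_eval s) t)%E.
Proof. by move=> v1; apply: ereal_sup_ubound; exists v. Qed.

(** The two integrals are joined into that of a single simple function, indexed
    by the sum of the two index types. *)
Lemma sof_integral_cauchy F s s' (v : B) : rnorm v <= 1 ->
  measurable_fun setT (opdist F (sof_eval s)) ->
  measurable_fun setT (opdist F (sof_eval s')) ->
  (forall t, 0 <= opdist F (sof_eval s) t)%E ->
  (forall t, 0 <= opdist F (sof_eval s') t)%E ->
  ((rnorm (sof_integral s v - sof_integral s' v))%:E <=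
   \int[mu]_t opdist F (sof_eval s) t + \int[mu]_t opdist F (sof_eval s') t)%E.
Proof.
move=> v1 ms ms' s0 s'0; rewrite -ge0_integralD//.
pose A (i : 'I_(sof_size s) + 'I_(sof_size s')) :=
  match i with inl i => (@sof_set _ _ _ _ _ s i) | inr i => (@sof_set _ _ _ _ _ s' i) end.
pose u (i : 'I_(sof_size s) + 'I_(sof_size s')) :=
  match i with inl i => (@sof_val _ _ _ _ _ s i) v | inr i => - (@sof_val _ _ _ _ _ s' i) v end.
have mA i : measurable (A i) by case: i => i; exact: sof_measurable.
have fA i : (mu (A i) < +oo)%E by case: i => i; exact: sof_finite.
have := @rnorm_simple_integral _ _ _ mu B _ A u mA fA (index_enum _).
rewrite big_sumType /= -sof_integralE.
under [X in _ + X]eq_bigr do rewrite scalerN.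
rewrite sumrN -sof_integralE => /le_trans; apply.
apply: ge0_le_integral => //.
- by move=> t _; rewrite lee_fin rnorm_ge0.
- apply/measurable_EFinP.
  have := @measurable_rnorm_simple _ _ _ _ _ A u mA (index_enum _) setT 0 measurableT.
  by under eq_fun do rewrite add0r.
- exact: emeasurable_funD.
move=> t _; rewrite big_sumType /= -sof_evalE.
under [X in _ + X]eq_bigr do rewrite scalerN.
rewrite sumrN -sof_evalE.
rewrite (le_trans _ (leeD (rnorm_le_opdist F s t v1) (rnorm_le_opdist F s' t v1)))//.
rewrite -EFinD lee_fin rnorm_distC (_ : _ - _ = (F t v - sof_eval s t v) - (F t v - sof_eval s' t v)).
  exact: rnormB.
by rewrite opprB [RHS]addrC addrA subrK.
Qed.

(** Strong limits exist since [B] is complete, and the Cauchy estimates are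
    uniform on the unit ball. *)
Lemma sof_integral_cvg F (s : nat -> @simple_op_fun R B d X mu) :
  (forall k, measurable_fun setT (opdist F (sof_eval (s k)))) ->
  (forall k t, 0 <= opdist F (sof_eval (s k)) t)%E ->
  (forall k, \int[mu]_t opdist F (sof_eval (s k)) t < (k.+1%:R^-1)%:E)%E ->
  exists2 S, bounded_op S &
    forall k, (opnorm (sof_integral (s k) - S)%R <= (k.+1%:R^-1)%:E)%E.
Proof.
move=> ms s0 se.
have dist k l v : rnorm v <= 1 ->
    rnorm (sof_integral (s k) v - sof_integral (s l) v) <=
    k.+1%:R^-1 + l.+1%:R^-1.
  move=> v1; rewrite -lee_fin (le_trans (sof_integral_cauchy v1 (ms k) (ms l) _ _))//.
  by rewrite EFinD leeD// ltW.
have lS k := (bounded_sof_integral (s k)).1.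
have dist' k l v : rnorm (sof_integral (s k) v - sof_integral (s l) v) <=
    (k.+1%:R^-1 + l.+1%:R^-1) * rnorm v.
  have := @opnorm_le_rnorm _ _ (sof_integral (s k) - sof_integral (s l))
    (k.+1%:R^-1 + l.+1%:R^-1) v; apply; first exact: linear_subop.
  by apply: ge_ereal_sup => _ [u /= u1 <-]; rewrite lee_fin dist.
have cvgS v : exists l : B, sof_integral (s k) v @[k --> \oo] --> l.
  apply: cauchy_rnorm_cvg => e e0; pose K := 2 * rnorm v + 1.
  have K0 : 0 < K by rewrite ltr_wpDl// mulr_ge0// rnorm_ge0.
  have [N _ hN] := natSinv_lt (divr_gt0 e0 K0).
  exists N => k l /hN /= + /hN /=.
  move=> hk hl; apply: le_lt_trans (dist' k l v) _.
  apply: (@le_lt_trans _ _ (2 * (e / K) * rnorm v)).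
    by rewrite ler_wpM2r ?rnorm_ge0// mulr_natl mulr2n lerD// ltW.
  rewrite mulrAC mulrA -mulrA mulrC -mulrA gtr_pMr// mulrC ltr_pdivrMr// mul1r.
  by rewrite /K ltrDl.
have [S hS] := choice cvgS.
have bnd k v : rnorm (sof_integral (s k) v - S v) <= k.+1%:R^-1 * rnorm v.
  apply/ler_addgt0Pr => e e0; pose K := rnorm v + 1.
  have K0 : 0 < K by rewrite ltr_wpDl// rnorm_ge0.
  have e2 : 0 < e / 2 by rewrite divr_gt0.
  have near1 := natSinv_lt (divr_gt0 e2 K0).
  have /cvg_rnormP/(_ _ e2) near2 := hS v.
  have [l _ hl] := filterI near1 near2.
  have /= [l1 l2] := hl l (leqnn l).
  have -> : sof_integral (s k) v - S v = (sof_integral (s k) v - sof_integral (s l) v)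
      + (sof_integral (s l) v - S v) by rewrite addrA subrK.
  apply: le_trans (rnormD _ _) _; apply: le_trans (lerD (dist' k l v) (ltW l2)) _.
  rewrite mulrDl -addrA lerD2l [leRHS]splitr lerD2r.
  apply: le_trans (ler_wpM2r (rnorm_ge0 v) (ltW l1)) _.
  by rewrite mulrAC ler_pdivrMr// ler_pM2l// /K lerDl.
have lS' : linear S.
  move=> a u v.
  have hl : sof_integral (s k) (a *: u + v) @[k --> \oo] --> a *: S u + S v.
    under eq_cvg do rewrite lS.
    by apply: cvgD; [apply: cvgZl_tmp; exact: hS|exact: hS].
  exact: (cvg_unique (@norm_hausdorff _ _) (hS (a *: u + v)) hl).
have bS : bounded_op S.
  have [_ [K K0 [_ hK]]] := bounded_opP (bounded_sof_integral (s 0%N)).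
  apply: (@bounded_op_le _ _ _ (K + 1)) => //; last by rewrite addr_ge0.
  move=> v; have := bnd 0%N v; rewrite invr1 => b0.
  have -> : S v = sof_integral (s 0%N) v - (sof_integral (s 0%N) v - S v).
    by rewrite opprB addrC subrK.
  by rewrite (le_trans (rnormB _ _))// mulrDl lerD.
exists S => // k; apply: opnorm_le; last by rewrite invr_ge0.
exact: bnd.
Qed.

Lemma opnorm_subDr S S1 S2 : linear S -> linear S1 -> linear S2 ->
  (opnorm (S - S2)%R <= opnorm (S - S1)%R + opnorm (S1 - S2)%R)%E.
Proof.
move=> lS lT lU; apply: ge_ereal_sup => _ [v /= v1 <-].
have -> : (S - S2) v = (S - S1) v + (S1 - S2) v by rewrite !fctE addrA subrK.
apply: (@le_trans _ _ ((rnorm ((S - S1) v))%:E + (rnorm ((S1 - S2) v))%:E)%E).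
  by rewrite -EFinD lee_fin rnormD.
by apply: leeD; apply: ereal_sup_ubound; exists v.
Qed.

(** The simple functions take at each point the best of the first operators
    [T j].  Being closer to [T j] than to 0 forces a norm of at least half that of
    [T j], which makes the level sets finite. *)
Lemma bochner_integral_exists F T :
  (forall t, bounded_op (F t)) -> (forall j, bounded_op (T j)) -> T 0%N = 0 ->
  (forall j, measurable_fun setT (fun t => opnorm (F t - T j))) ->
  (\int[mu]_t opnorm (F t) < +oo)%E ->
  (forall t (e : R), 0 < e -> exists j, (opnorm (F t - T j)%R < e%:E)%E) ->
  exists S, is_bochner_integral mu F S.
Proof.
move=> bF bT T0 mFT intF denseT.
pose N j t := fine (opnorm (F t - T j)).
have NE j t : opnorm (F t - T j) = (N j t)%:E.
  by rewrite /N; have [_ [K _ [-> _]]] := bounded_opP (bounded_opB (bF t) (bT j)).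
have N_ge0 j t : 0 <= N j t.
  rewrite -lee_fin -NE; apply: opnorm_ge0.
  by apply: linear0; have [] := bounded_opB (bF t) (bT j).
have mN j : measurable_fun setT (N j).
  by apply/measurable_EFinP; rewrite (_ : _ \o _ = fun t => opnorm (F t - T j))//;
    apply/funext => t; rewrite NE.
have N0E t : (N 0%N t)%:E = opnorm (F t) by rewrite -NE T0 subr0.
have intN : (\int[mu]_t (N 0%N t)%:E < +oo)%E.
  by under eq_integral do rewrite N0E.
have N_dense t e : 0 < e -> exists j, N j t < e.
  by move=> /(denseT t)[j]; rewrite NE lte_fin; exists j.
have N_away j : exists2 r, 0 < r & forall t, N j t < N 0%N t -> r <= N 0%N t.
  have [lT [K K0 [TE _]]] := bounded_opP (bT j).
  have tri t : K <= N j t + N 0%N t.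
    rewrite -lee_fin EFinD -TE N0E.
    have -> : opnorm (F t) = opnorm (F t - 0) by rewrite subr0.
    have -> : opnorm (T j) = opnorm (T j - 0) by rewrite subr0.
    have [lF _] := bF t; have [l0 _] := @bounded_op0 R B.
    rewrite -NE (le_trans (opnorm_subDr lT lF l0))// leeD2r//.
    rewrite le_eqVlt; apply/orP; left; apply/eqP; congr ereal_sup.
    by apply/seteqP; split=> _ [v v1 <-]; exists v => //; rewrite !fctE rnorm_distC.
  have [K0'|K_neq0] := eqVneq K 0.
    exists 1 => // t; have := N_ge0 j t; have := N_ge0 0%N t.
    suff : N 0%N t <= N j t by lra.
    rewrite -lee_fin N0E -NE.
    (* When [T j = 0], it is never strictly better than [T 0 = 0]. *)
    have T0v v : T j v = 0.
      apply/eqP; rewrite -rnorm_eq0 eq_le rnorm_ge0 andbT.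
      have := @opnorm_le_rnorm _ _ (T j) K v lT; rewrite TE K0' mul0r; exact.
    have -> : F t - T j = F t by apply/funext => v; rewrite !fctE T0v subr0.
    by [].
  exists (K / 2); first by rewrite divr_gt0// lt_neqAle eq_sym K_neq0.
  by move=> t hlt; have := tri t; lra.
have inv_gt0 m : 0 < m.+1%:R^-1 :> R by rewrite invr_gt0.
have hk m := best_approximation mN N_ge0 intN N_dense (inv_gt0 m).
have [k hk'] := choice hk.
pose s m := @SimpleOpFun _ B _ _ mu (k m)
  (fun i : 'I_(k m) => [set t | best_index N (k m) t = i.+1])
  (fun i => T i.+1) (fun i => (measurable_best_index mN (k m)).1 _)
  (fun i => best_index_finite mN N_ge0 intN N_away (k m) (ltn0Sn i))
  (fun i => bT _).
have sE m t : opdist F (sof_eval (s m)) t = (N (best_index N (k m) t) t)%:E.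
  by rewrite -NE /opdist; congr (opnorm (_ - _)); exact: best_index_sum.
have ms m : measurable_fun setT (opdist F (sof_eval (s m))).
  apply: (eq_measurable_fun (fun t => (N (best_index N (k m) t) t)%:E)).
    by move=> t _; rewrite sE.
  by apply/measurable_EFinP; exact: (measurable_best_index mN (k m)).2.
have s0 m t : (0 <= opdist F (sof_eval (s m)) t)%E by rewrite sE lee_fin.
have se m : (\int[mu]_t opdist F (sof_eval (s m)) t < (m.+1%:R^-1)%:E)%E.
  by under eq_integral do rewrite sE.
have [S bS hS] := sof_integral_cvg ms s0 se.
have inv0 : (m.+1%:R^-1 : R)%:E @[m --> \oo] --> 0%E.
  by apply: cvg_EFin; [exact: nearW|exact: cvg_harmonic].
exists S; split=> //; exists s; split=> //.
- apply: (@squeeze_cvge _ _ _ _ (cst 0%E) _ (fun m => (m.+1%:R^-1 : R)%:E)) => //.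
    by apply: nearW => m; rewrite integral_ge0//= ltW.
  exact: cvg_cst.
- apply: (@squeeze_cvge _ _ _ _ (cst 0%E) _ (fun m => (m.+1%:R^-1 : R)%:E)) => //.
    apply: nearW => m; rewrite hS andbT; apply: opnorm_ge0; apply: linear0.
    by have [] := bounded_opB (bounded_sof_integral (s m)) bS.
  exact: cvg_cst.
Qed.

(** The triangle inequality for the integral of [F t v - b t *: v].  The operator
    part and the scalar part are approximated separately, and the two simple
    functions are then treated as one. *)
Lemma rnorm_bochner_sub F S (b : X -> R[i]) (W : X -> R) (v : B) :
  is_bochner_integral mu F S -> cintegrable mu b -> rnorm v = 1 ->
  measurable_fun setT W -> (forall t, rnorm (F t v - b t *: v) <= W t) ->
  ((rnorm (S v - cintegral mu b *: v))%:E <= \int[mu]_t (W t)%:E)%E.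
Proof.
move=> [bS [s [ms s_cvg int_cvg]]] ib v1 mW FbW.
have W0 t : 0 <= W t by exact: le_trans (rnorm_ge0 _) (FbW t).
apply/lee_addgt0Pr => e e0.
(* Five errors of size [e'] add up below. *)
pose e' : R := e / 8; have e'0 : 0 < e' by rewrite divr_gt0.
have [k [A [r [mA fA int_A cint_A]]]] := cintegral_approx ib e'0.
have s0 m t : (0 <= opdist F (sof_eval (s m)) t)%E.
  by apply: le_trans (rnorm_le_opdist F (s m) t (_ : rnorm v <= 1));
    rewrite ?v1// lee_fin rnorm_ge0.
have near1 : \forall m \near \oo, (\int[mu]_t opdist F (sof_eval (s m)) t < e'%:E)%E.
  have /fine_cvgP[f1 /cvgrPdist_lt /(_ _ e'0) f2] := s_cvg.
  apply: filterS (filterI f1 f2) => m /= [fm]; rewrite sub0r normrN.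
  by move=> /(le_lt_trans (ler_norm _)); rewrite -lte_fin fineK.
have near2 : \forall m \near \oo, (opnorm (sof_integral (s m) - S)%R < e'%:E)%E.
  have /fine_cvgP[f1 /cvgrPdist_lt /(_ _ e'0) f2] := int_cvg.
  apply: filterS (filterI f1 f2) => m /= [fm]; rewrite sub0r normrN.
  by move=> /(le_lt_trans (ler_norm _)); rewrite -lte_fin fineK.
have [m _ hm] := filterI near1 near2.
have /= [m1 m2] := hm m (leqnn m).
pose sm := s m.
pose C := \sum_(i < k) (fine (mu (A i)))%:C%C * r i.
pose cs t := \sum_(i < k) (\1_(A i) t : R[i]) * r i.
have d1 : rnorm (S v - sof_integral sm v) <= e'.
  rewrite rnorm_distC -lee_fin (le_trans _ (ltW m2))//.
  by apply: ereal_sup_ubound; exists v => //=; rewrite v1.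
have d2 : rnorm (C *: v - cintegral mu b *: v) <= 2 * e'.
  by rewrite -scalerBl rnormZ v1 mulr1.
have d3 : ((rnorm (sof_integral sm v - C *: v))%:E <=
    \int[mu]_t (W t)%:E + (2 * e')%:E)%E.
  pose A' (i : 'I_(sof_size sm) + 'I_k) :=
    match i with inl i => (@sof_set _ _ _ _ _ sm i) | inr i => A i end.
  pose u (i : 'I_(sof_size sm) + 'I_k) :=
    match i with inl i => (@sof_val _ _ _ _ _ sm i) v | inr i => - (r i *: v) end.
  have mA' i : measurable (A' i) by case: i => i /=; [exact: sof_measurable|exact: mA].
  have fA' i : (mu (A' i) < +oo)%E by case: i => i /=; [exact: sof_finite|exact: fA].
  have sumE t : \sum_i (\1_(A' i) t : R[i]) *: u i = sof_eval sm t v - cs t *: v.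
    rewrite big_sumType /= -sof_evalE; congr (_ + _).
    by rewrite scaler_suml -sumrN; apply: eq_bigr => i _; rewrite scalerN scalerA.
  have := @rnorm_simple_integral _ _ _ mu B _ A' u mA' fA' (index_enum _).
  rewrite big_sumType /= -sof_integralE.
  have -> : \sum_(i < k) (fine (mu (A i)))%:C%C *: - (r i *: v) = - (C *: v).
    by rewrite /C scaler_suml -sumrN; apply: eq_bigr => i _; rewrite scalerN scalerA.
  move=> /le_trans; apply.
  have mcs : cintegrable mu cs by have [] := cintegral_simple mA fA r.
  have mbc : measurable_fun setT (fun t => (rnorm (b t - cs t))%:E).
    apply: measurable_EFin_rnorm; apply: cmeasurableB.
      exact: cintegrable_measurable ib.
    exact: cintegrable_measurable mcs.
  have mWE : measurable_fun setT (fun t => (W t)%:E) by exact/measurable_EFinP.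
  have mWb := emeasurable_funD mWE mbc.
  apply: (@le_trans _ _ (\int[mu]_t (opdist F (sof_eval sm) t +
      ((W t)%:E + (rnorm (b t - cs t))%:E)))%E).
    apply: ge0_le_integral => //.
    - by move=> t _; rewrite lee_fin rnorm_ge0.
    - apply/measurable_EFinP.
      have := @measurable_rnorm_simple _ _ _ _ _ A' u mA' (index_enum _) setT 0 measurableT.
      by under eq_fun do rewrite add0r.
    - exact: (emeasurable_funD (ms m) mWb).
    - move=> t _; rewrite sumE.
      have -> : sof_eval sm t v - cs t *: v = - (F t v - sof_eval sm t v) +
          ((F t v - b t *: v) + (b t - cs t) *: v).
        by rewrite scalerBl opprB [X in _ = _ + X]addrA subrK addrA subrK.
      apply: (@le_trans _ _ ((rnorm (F t v - sof_eval sm t v))%:E + (rnorm (F t v - b t *: v)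
        + rnorm (b t - cs t))%:E)%E).
        rewrite -EFinD lee_fin (le_trans (rnormD _ _))// rnormN lerD2l.
        by rewrite (le_trans (rnormD _ _))// rnormZ v1 mulr1.
      rewrite leeD//; first by rewrite rnorm_le_opdist// v1.
      by rewrite -EFinD lee_fin lerD2r.
  have W0E t : setT t -> (0 <= (W t)%:E)%E by rewrite lee_fin.
  have bc0 t : setT t -> (0 <= (rnorm (b t - cs t))%:E)%E by rewrite lee_fin rnorm_ge0.
  have Wb0 t : setT t -> (0 <= (W t)%:E + (rnorm (b t - cs t))%:E)%E.
    by move=> _; rewrite adde_ge0// (W0E, bc0).
  rewrite (ge0_integralD mu measurableT (fun t _ => s0 m t) (ms m) Wb0 mWb).
  rewrite (ge0_integralD mu measurableT W0E mWE bc0 mbc).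
  by rewrite addeCA leeD2l// mulr_natl mulr2n EFinD leeD// ltW.
have -> : S v - cintegral mu b *: v = (S v - sof_integral sm v) +
   (sof_integral sm v - C *: v) + (C *: v - cintegral mu b *: v).
  by rewrite !subrKA.
apply: (@le_trans _ _ (e'%:E + (rnorm (sof_integral sm v - C *: v))%:E + (2 * e')%:E)%E).
  rewrite -!EFinD lee_fin (le_trans (rnormD _ _))// lerD//.
  by rewrite (le_trans (rnormD _ _))// lerD2r.
apply: (@le_trans _ _ (e'%:E + (\int[mu]_t (W t)%:E + (2 * e')%:E) + (2 * e')%:E)%E).
  by rewrite leeD2r// leeD2l.
rewrite addeCA -addeA leeD2l// -!EFinD lee_fin /e'; lra.
Qed.

End bochner.

(** * Continuous functions on the plane *)

Section plane_measurable.
Context {R : realType}.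

Lemma nbhs_box (p : R * R) (U : set (R * R)) : nbhs p U ->
  exists2 e : R, 0 < e & forall q : R * R,
    `|p.1 - q.1| < e -> `|p.2 - q.2| < e -> U q.
Proof.
move=> [[A C] /= [/nbhs_ballP[e1 /= e10 h1] /nbhs_ballP[e2 /= e20 h2]] AC].
exists (Num.min e1 e2); first by rewrite lt_min e10.
move=> q; rewrite !lt_min => /andP[q1 _] /andP[_ q2].
by apply: AC; split=> /=; [apply: h1|apply: h2]; rewrite -ball_normE.
Qed.

(** Every open subset of the plane is a countable union of open boxes with
    rational corners. *)
Lemma open_measurable2 (U : set (R * R)) : open U -> measurable U.
Proof.
move=> oU.
pose box (q : (rat * rat) * (rat * rat)) : set (R * R) :=
  `]ratr q.1.1, ratr q.1.2[%classic `*` `]ratr q.2.1, ratr q.2.2[%classic.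
pose C (n : nat) : set (R * R) :=
  if @unpickle ((rat * rat) * (rat * rat))%type n is Some q
  then if `[< box q `<=` U >] then box q else set0 else set0.
have -> : U = \bigcup_n C n.
  apply/seteqP; split=> p; last first.
    move=> [n _]; rewrite /C; case: unpickle => // q.
    by case: asboolP => // sub /sub.
  move=> Up; have /nbhs_box[e e0 he] : nbhs p U by exact: open_nbhs_nbhs.
  have rat_itv (x y : R) : x < y -> exists q : rat, x < ratr q < y.
    by move=> /rat_in_itvoo[q]; rewrite in_itv; exists q.
  have [q1 /andP[q11 q12]] : exists q : rat, p.1 - e < ratr q < p.1.
    by apply: rat_itv; rewrite gtrBl.
  have [q2 /andP[q21 q22]] : exists q : rat, p.1 < ratr q < p.1 + e.
    by apply: rat_itv; rewrite ltrDl.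
  have [q3 /andP[q31 q32]] : exists q : rat, p.2 - e < ratr q < p.2.
    by apply: rat_itv; rewrite gtrBl.
  have [q4 /andP[q41 q42]] : exists q : rat, p.2 < ratr q < p.2 + e.
    by apply: rat_itv; rewrite ltrDl.
  have [n hn] : exists n, @unpickle ((rat * rat) * (rat * rat))%type n =
      Some ((q1, q2), (q3, q4)) by eexists; exact: pickleK.
  exists n => //; rewrite /C hn.
  case: asboolP => [_|[]].
    by split; rewrite /= in_itv /= ?q12 ?q32.
  move=> r [] /=; rewrite !in_itv /= => /andP[r1 r2] /andP[r3 r4].
  by apply: he; rewrite ltr_norml; lra.
apply: bigcupT_measurable => n; rewrite /C; case: unpickle => // q.
by case: asboolP => // _; apply: measurableX; exact: measurable_itv.
Qed.

Lemma continuous_measurable_fun2 (D : set (R * R)) (f : R * R -> R) : open D ->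
  (forall p, D p -> f q @[q --> p] --> f p) -> measurable_fun D f.
Proof.
move=> oD cf; apply: (measurability _ (RGenOpens.measurableE R)).
move=> _ [_ [a [b ->] <-]]; apply: open_measurable2.
rewrite openE => p [Dp /= fp]; rewrite /interior.
have ofp : nbhs (f p) `]a, b[%classic.
  by apply: open_nbhs_nbhs; split=> //; exact: interval_open.
by apply: filterI; [exact: open_nbhs_nbhs|exact: cf].
Qed.

Lemma open_offaxis : open [set p : R * R | p.2 != 0].
Proof.
rewrite (_ : [set _ | _] = snd @^-1` [set y : R | y != 0]).
  by apply: open_comp; [move=> p _; exact: cvg_snd|exact: open_neq].
by [].
Qed.

(** The integrands over the plane are continuous except on the real axis, where
    they are constant. *)
Lemma measurable_fun_offaxis (f : R * R -> R) (k : R) :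
  (forall p, p.2 != 0 -> f q @[q --> p] --> f p) ->
  (forall p, p.2 = 0 -> f p = k) -> measurable_fun setT f.
Proof.
move=> cf f0; rewrite -(setvU [set p : R * R | p.2 != 0]).
have mo := open_measurable2 open_offaxis.
apply/measurable_funU => //; first exact: measurableC; split; last first.
  exact: continuous_measurable_fun2 open_offaxis cf.
apply: (eq_measurable_fun (cst k)) => // p; rewrite inE /= => /negP.
by rewrite negbK => /eqP /f0.
Qed.

End plane_measurable.

Section ccontinuous.
Context {R : realType} {T : topologicalType}.
Implicit Types (f g : T -> R[i]) (p : T).

(** Coordinatewise, so that the theory of real limits applies. *)
Definition ccontinuous_at f p :=
  complex.Re (f q) @[q --> p] --> complex.Re (f p) /\
  complex.Im (f q) @[q --> p] --> complex.Im (f p).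

Lemma ccontinuous_rnorm f p : ccontinuous_at f p -> forall e : R, 0 < e ->
  \forall q \near p, rnorm (f q - f p) < e.
Proof.
move=> [/cvgrPdist_lt cr /cvgrPdist_lt ci] e e0.
have e2 : 0 < e / 2 by rewrite divr_gt0.
apply: filterS (filterI (cr _ e2) (ci _ e2)) => q /= [h1 h2].
rewrite rnorm_distC; apply: le_lt_trans (rnorm_leReIm _) _.
by rewrite !raddfB (splitr e) ltrD.
Qed.

Lemma ccontinuous_cst (z : R[i]) p : ccontinuous_at (fun=> z) p.
Proof. by split; exact: cvg_cst. Qed.

Lemma ccontinuousD f g p : ccontinuous_at f p -> ccontinuous_at g p ->
  ccontinuous_at (fun q => f q + g q) p.
Proof.
by move=> [fr fi] [gr gi]; split; under eq_cvg do rewrite raddfD;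
  rewrite raddfD; exact: cvgD.
Qed.

Lemma ReM (a b : R[i]) : complex.Re (a * b) =
  complex.Re a * complex.Re b - complex.Im a * complex.Im b.
Proof. by case: a => ? ?; case: b => ? ?. Qed.

Lemma ImM (a b : R[i]) : complex.Im (a * b) =
  complex.Re a * complex.Im b + complex.Im a * complex.Re b.
Proof. by case: a => ? ?; case: b => ? ?. Qed.

Lemma ccontinuousM f g p : ccontinuous_at f p -> ccontinuous_at g p ->
  ccontinuous_at (fun q => f q * g q) p.
Proof.
move=> [fr fi] [gr gi]; split.
  under eq_cvg do rewrite ReM.
  by rewrite ReM; apply: cvgB; exact: cvgM.
under eq_cvg do rewrite ImM.
by rewrite ImM; apply: cvgD; exact: cvgM.
Qed.

Lemma ccontinuousX f p k : ccontinuous_at f p ->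
  ccontinuous_at (fun q => f q ^+ k) p.
Proof.
move=> cf; elim: k => [|k ih].
  under eq_fun do rewrite expr0; exact: ccontinuous_cst.
under eq_fun do rewrite exprS; exact: ccontinuousM.
Qed.

Lemma ccontinuous_sum (I : Type) (s : seq I) (F : I -> T -> R[i]) p :
  (forall i, ccontinuous_at (F i) p) ->
  ccontinuous_at (fun q => \sum_(i <- s) F i q) p.
Proof.
move=> cF; elim: s => [|i s ih].
  under eq_fun do rewrite big_nil; exact: ccontinuous_cst.
under eq_fun do rewrite big_cons; exact: ccontinuousD.
Qed.

Lemma ccontinuous_real (f : T -> R) p : f q @[q --> p] --> f p ->
  ccontinuous_at (fun q => (f q)%:C%C) p.
Proof. by split => //=; exact: cvg_cst. Qed.

Lemma ccontinuous_imag (f : T -> R) p : f q @[q --> p] --> f p ->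
  ccontinuous_at (fun q => (0 +i* f q)%C) p.
Proof. by split => //=; exact: cvg_cst. Qed.

Lemma ReV (a : R[i]) : complex.Re a^-1 =
  complex.Re a / (complex.Re a ^+ 2 + complex.Im a ^+ 2).
Proof. by case: a. Qed.

Lemma ImV (a : R[i]) : complex.Im a^-1 =
  - (complex.Im a / (complex.Re a ^+ 2 + complex.Im a ^+ 2)).
Proof. by case: a. Qed.

Lemma ReIm_sqr_neq0 (a : R[i]) : a != 0 ->
  complex.Re a ^+ 2 + complex.Im a ^+ 2 != 0.
Proof.
case: a => x y; apply: contraNN => /= /eqP h; rewrite eq_complex /=.
have := sqr_ge0 x; have := sqr_ge0 y => y0 x0.
by rewrite -!(sqrf_eq0 x) -(sqrf_eq0 y); apply/andP; split; apply/eqP; lra.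
Qed.

Lemma ccontinuousV f p : f p != 0 -> ccontinuous_at f p ->
  ccontinuous_at (fun q => (f q)^-1) p.
Proof.
move=> /ReIm_sqr_neq0 f0 [fr fi].
have dV : (complex.Re (f q) ^+ 2 + complex.Im (f q) ^+ 2)^-1 @[q --> p] -->
    (complex.Re (f p) ^+ 2 + complex.Im (f p) ^+ 2)^-1.
  by apply: cvgV => //; apply: cvgD; rewrite !expr2; exact: cvgM.
split.
  by under eq_cvg do rewrite ReV; rewrite ReV; exact: cvgM.
by under eq_cvg do rewrite ImV; rewrite ImV; apply: cvgN; exact: cvgM.
Qed.

End ccontinuous.

Section plane_operators.
Context {R : realType} {B : completeNormedModType R[i]}.
Local Notation mu2 := (@lebesgue_measure R \x @lebesgue_measure R)%E.

Lemma ccontinuous_cmeasurable (b : R * R -> R[i]) :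
  (forall p, p.2 != 0 -> ccontinuous_at b p) ->
  (forall p, p.2 = 0 -> b p = 0) -> cmeasurable b.
Proof.
move=> cb b0; split; apply: (@measurable_fun_offaxis _ _ 0) => [p /cb[]//|p /b0 /=].
- by move=> ->.
- by move=> ->.
Qed.

(** The values at points of rational coordinates are dense among the values off
    the axis, by continuity; the value 0 on the axis serves as [T 0]. *)
Lemma plane_bochner_exists (F : R * R -> B -> B) (W : R * R -> R) :
  (forall p, bounded_op (F p)) -> (forall p, p.2 = 0 -> F p = 0) ->
  (forall p, p.2 != 0 -> forall e : R, 0 < e ->
    \forall q \near p, (opnorm (F q - F p)%R <= e%:E)%E) ->
  mu2.-integrable setT (EFin \o W) ->
  (forall p, (opnorm (F p) <= (W p)%:E)%E) ->
  exists S, is_bochner_integral mu2 F S.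
Proof.
move=> bF F0 cF iW FW.
have lF p : linear (F p) by case: (bF p).
have NE p S : bounded_op S -> exists2 r : R, 0 <= r & opnorm (F p - S) = r%:E.
  by move=> bS; have [_ [K K0 [-> _]]] := bounded_opP (bounded_opB (bF p) bS); exists K.
have mF S : bounded_op S -> measurable_fun setT (fun p => opnorm (F p - S)).
  move=> bS; have lS := bS.1.
  pose N p := fine (opnorm (F p - S)).
  have NNE p : opnorm (F p - S) = (N p)%:E by have [r r0 h] := NE p S bS; rewrite /N h.
  apply: (eq_measurable_fun (EFin \o N)); first by move=> p _; rewrite /= -NNE.
  apply/measurable_EFinP; apply: (@measurable_fun_offaxis _ _ (fine (opnorm (- S)))).
    move=> p p0; apply/cvgrPdist_le => e e0.
    apply: filterS (cF p p0 e e0) => q hq.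
    have h1 : N q <= e + N p.
      rewrite -lee_fin EFinD -!NNE (le_trans (opnorm_subDr (lF q) (lF p) lS))//.
      exact: leeD2r.
    have h2 : N p <= e + N q.
      rewrite -lee_fin EFinD -!NNE (le_trans (opnorm_subDr (lF p) (lF q) lS))//.
      rewrite leeD2r// (le_trans _ hq)// le_eqVlt; apply/orP; left; apply/eqP.
      congr ereal_sup.
      by apply/seteqP; split=> _ [v v1 <-]; exists v => //; rewrite !fctE rnorm_distC.
    rewrite ler_norml; lra.
  by move=> p /F0 Fp; rewrite /N Fp sub0r.
pose T j : B -> B := F (complex.Re (rat_point j : R[i]), complex.Im (rat_point j : R[i])).
apply: (@bochner_integral_exists _ _ _ mu2 B F T) => //.
- by move=> j; exact: bF.
- by rewrite /T F0.
- by move=> j; apply: mF; exact: bF.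
- have m0 : measurable_fun setT (fun p => opnorm (F p)).
    have := mF 0 (@bounded_op0 R B); apply: eq_measurable_fun => p _.
    by rewrite subr0.
  have /integrableP[mW] := iW; apply: le_lt_trans; apply: ge0_le_integral => //.
  + by move=> p _; rewrite opnorm_ge0// linear0.
  + exact: measurableT_comp.
  + by move=> p _; rewrite (le_trans (FW p))// lee_abs.
move=> p e e0; have [p0|p0] := eqVneq p.2 0.
  exists 0%N; rewrite /T (F0 _ p0) F0//= subrr.
  have [l0 _] := @bounded_op0 R B.
  rewrite (@le_lt_trans _ _ 0%E)// ?lte_fin//; apply: opnorm_le => // v.
  by rewrite rnorm0 mul0r.
have e2 : 0 < e / 2 by rewrite divr_gt0.
have /nbhs_box[r r0 hr] := cF p p0 _ e2.
have [j hj] := rat_point_dense (p.1 +i* p.2)%C r0.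
exists j; have := hr (complex.Re (rat_point j : R[i]), complex.Im (rat_point j : R[i])).
move=> /= /(_ _ _)/le_lt_trans hlt.
have -> : opnorm (F p - T j) = opnorm (T j - F p).
  congr ereal_sup; apply/seteqP; split=> _ [v v1 <-]; exists v => //;
  by rewrite !fctE rnorm_distC.
apply: hlt; last by rewrite lte_fin; lra.
- by apply: le_lt_trans hj; have := normRe_le ((p.1 +i* p.2)%C - rat_point j); rewrite raddfB.
- by apply: le_lt_trans hj; have := normIm_le ((p.1 +i* p.2)%C - rat_point j); rewrite raddfB.
Qed.

(** Since [T - S = (z - w) S T], a small [|w - z| ||S||] bounds [T] in terms of
    [S], and then their difference. *)
Lemma resolvent_near (H : partial_op B) (z w : R[i]) (S T : B -> B) (K : R) :
  is_resolvent H z S -> is_resolvent H w T -> 0 <= K ->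
  (forall v, rnorm (S v) <= K * rnorm v) -> rnorm (w - z) * K <= 2^-1 ->
  forall v, rnorm (T v) <= 2 * K * rnorm v /\
    rnorm (T v - S v) <= rnorm (w - z) * (2 * K ^+ 2) * rnorm v.
Proof.
move=> rS rT K0 SK wzK v.
have d1 : rnorm (T v - S v) <= rnorm (w - z) * K * rnorm (T v).
  rewrite rnorm_distC (resolvent_identity v rS rT) rnormZ -mulrA.
  by rewrite ler_wpM2l ?rnorm_ge0.
have d2 : rnorm (T v) <= 2 * K * rnorm v.
  have := rnormD (T v - S v) (S v); rewrite subrK.
  have := ler_wpM2r (rnorm_ge0 (T v)) wzK; have := SK v; lra.
split=> //; apply: le_trans d1 _.
rewrite -mulrA -[leRHS]mulrA ler_wpM2l ?rnorm_ge0//.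
have := ler_wpM2l K0 d2; rewrite expr2; lra.
Qed.

(** Norm continuity off the real axis comes from the resolvent identity. *)
Lemma resolvent_bochner_exists (H : partial_op B) (a : R * R -> R[i])
    (W : R * R -> R) :
  (forall z, spectrum H z -> complex.Im z = 0) ->
  (forall p, p.2 != 0 -> ccontinuous_at a p) -> (forall p, p.2 = 0 -> a p = 0) ->
  mu2.-integrable setT (EFin \o W) -> (forall p, 0 <= W p) ->
  (forall p, p.2 != 0 -> forall v,
    rnorm (a p *: resolvent H (p.1 +i* p.2)%C v) <= W p * rnorm v) ->
  exists S, is_bochner_integral mu2
    (fun p => a p *: resolvent H (p.1 +i* p.2)%C) S.
Proof.
move=> realH ca a0 iW W0 aW.
pose z (p : R * R) := (p.1 +i* p.2)%C.
have rz p : p.2 != 0 -> is_resolvent H (z p) (resolvent H (z p)).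
  by move=> p0; apply: resolventP => /realH /= p0'; rewrite p0' eqxx in p0.
have F0 p : p.2 = 0 -> a p *: resolvent H (z p) = 0.
  by move=> /a0 ->; apply/funext => v; rewrite fctZE scale0r.
apply: (@plane_bochner_exists _ W) => //.
- move=> p; have [p0|p0] := eqVneq p.2 0; first by rewrite (F0 p p0); exact: bounded_op0.
  by apply: bounded_opZ; have [] := rz p p0.
- move=> p p0 e e0.
  have [bp _ _] := rz p p0; have [_ [K K0 [_ hK]]] := bounded_opP bp.
  pose A := rnorm (a p) + 1.
  have A0 : 0 < A by rewrite ltr_wpDl// rnorm_ge0.
  pose e1 := e / 2 / (2 * K + 1).
  have e10 : 0 < e1 by rewrite !divr_gt0// ltr_wpDl// mulr_ge0.
  pose r := Num.min (2^-1 / (K + 1)) (e / 2 / (A * (2 * K ^+ 2) + 1)).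
  have r0 : 0 < r.
    rewrite lt_min !divr_gt0//= ltr_wpDl// !mulr_ge0 ?sqr_ge0//; exact: ltW.
  have near_z : \forall q \near p, rnorm (z q - z p) < r.
    apply: (ccontinuous_rnorm (f := z)) r0.
    by split; [exact: cvg_fst|exact: cvg_snd].
  have near_a := ccontinuous_rnorm (ca p p0) e10.
  have near_y : \forall q \near p, q.2 != 0.
    by apply: open_nbhs_nbhs; split=> //; exact: open_offaxis.
  apply: filterS (filterI near_y (filterI near_z near_a)) => q /= [q0 [zq aq]].
  have zqK : rnorm (z q - z p) * K <= 2^-1.
    have : rnorm (z q - z p) * (K + 1) < 2^-1.
      by rewrite -ltr_pdivlMr ?ltr_wpDl// (lt_le_trans zq)// /r ge_min lexx.
    have := rnorm_ge0 (z q - z p); lra.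
  have near_v v := resolvent_near (rz p p0) (rz q q0) K0 hK zqK v.
  apply: opnorm_le; last exact: ltW.
  move=> v; have [v1 v2] := near_v v.
  have -> : (a q *: resolvent H (z q) - a p *: resolvent H (z p)) v =
    (a q - a p) *: resolvent H (z q) v +
    a p *: (resolvent H (z q) v - resolvent H (z p) v).
    by rewrite !fctE scalerBl scalerBr subrKA.
  rewrite (le_trans (rnormD _ _))// !rnormZ (splitr e) mulrDl lerD//.
    apply: (@le_trans _ _ (e1 * (2 * K * rnorm v))).
      by rewrite ler_pM ?rnorm_ge0// ltW.
    rewrite mulrA ler_wpM2r ?rnorm_ge0// /e1 mulrAC ler_pdivrMr.
      by rewrite ler_pM2l ?divr_gt0// lerDl.
    by rewrite ltr_wpDl// mulr_ge0.
  apply: (@le_trans _ _ (A * (r * (2 * K ^+ 2) * rnorm v))).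
    rewrite ler_pM ?rnorm_ge0//; first by rewrite lerDl.
    apply: le_trans v2 _; rewrite ler_wpM2r ?rnorm_ge0// ler_wpM2r ?mulr_ge0 ?sqr_ge0//.
    exact: ltW.
  rewrite [A * _]mulrA ler_wpM2r ?rnorm_ge0// mulrCA.
  have D0 : 0 <= A * (2 * K ^+ 2) by rewrite !mulr_ge0 ?sqr_ge0// ltW.
  apply: (@le_trans _ _ (r * (A * (2 * K ^+ 2) + 1))).
    by rewrite ler_pM2l// lerDl.
  by rewrite -ler_pdivlMr ?ltr_wpDl// /r ge_min lexx orbT.
- move=> p; have [p0|p0] := eqVneq p.2 0.
    rewrite (F0 p p0); apply: opnorm_le => // v.
    by rewrite rnorm0 mulr_ge0// rnorm_ge0.
  by apply: opnorm_le => // v; exact: aW.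
Qed.

End plane_operators.

(** * Improper integrals on the line *)

Section line_integrals.
Context {R : realType}.
Local Notation mu := (@lebesgue_measure R).
Implicit Types (f F : R -> R).

Lemma FTC2_itv f F (a b : R) : a <= b ->
  (forall x, a <= x <= b -> is_derive x 1 F (f x)) ->
  (forall x, a <= x <= b -> {for x, continuous f}) ->
  (\int[mu]_(x in `[a, b]) (f x)%:E = (F b - F a)%:E)%E.
Proof.
rewrite le_eqVlt => /predU1P[->|ab] dF cf.
  by rewrite set_itv1 integral_set1 subrr.
have cF x : a <= x <= b -> {for x, continuous F}.
  by move=> /dF h; apply/differentiable_continuous/derivable1_diffP.
rewrite EFinB; apply: continuous_FTC2 => //.
- by apply: continuous_in_subspaceT => x; rewrite inE /= in_itv /= => /cf.
- split.
  + by move=> x; rewrite in_itv /= => /andP[/ltW ax /ltW xb]; have [] := dF x;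
      rewrite ?ax.
  + by apply: cvg_at_right_filter; apply: cF; rewrite lexx ltW.
  + by apply: cvg_at_left_filter; apply: cF; rewrite lexx ltW.
- move=> x; rewrite in_itv /= => /andP[/ltW ax /ltW xb].
  by rewrite derive1E; apply: derive_val; apply: dF; rewrite ax.
Qed.

Let itvk (k : nat) : set R := `[- k%:R, k%:R]%classic.

Let itvk_nd : nondecreasing_seq itvk.
Proof.
move=> k l kl; apply/subsetPset => x; rewrite /itvk /= !in_itv /=.
have : (k%:R : R) <= l%:R by rewrite ler_nat.
move: (k%:R) (l%:R) => a b; lra.
Qed.

Let itvk_cover : \bigcup_k itvk k = setT.
Proof.
apply/seteqP; split=> // x _; exists (Num.bound `|x|) => //.
by rewrite /itvk /= in_itv /= -ler_norml ltW// archi_boundP.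
Qed.

Lemma ge0_integral_primitive f F (l m : R) : (forall x, 0 <= f x) ->
  continuous f -> (forall x : R, is_derive x 1 F (f x)) ->
  F k%:R @[k --> \oo] --> l -> F (- k%:R) @[k --> \oo] --> m ->
  (\int[mu]_x (f x)%:E = (l - m)%:E)%E.
Proof.
move=> f0 cf dF Fl Fm.
have mf : measurable_fun setT (EFin \o f).
  by apply/measurable_EFinP; exact: continuous_measurable_fun.
have lim1 : (\int[mu]_(x in itvk k) (f x)%:E)%E @[k --> \oo] -->
    (\int[mu]_x (f x)%:E)%E.
  rewrite -itvk_cover; apply: ge0_nondecreasing_set_cvg_integral => //.
  - by move=> k; exact: measurable_itv.
  - by move=> k; exact: measurable_funTS.
  - by move=> k x _; rewrite lee_fin.
have intE k : (\int[mu]_(x in itvk k) (f x)%:E = (F k%:R - F (- k%:R))%:E)%E.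
  by apply: FTC2_itv => // [|x _]; [have := ler0n R k; lra|exact: cf].
have lim2 : (\int[mu]_(x in itvk k) (f x)%:E)%E @[k --> \oo] --> ((l - m)%:E)%E.
  under eq_cvg do rewrite intE.
  by apply: cvg_EFin; [exact: nearW|exact: cvgB].
exact: (cvg_unique (@ereal_hausdorff R) lim1 lim2).
Qed.

Lemma integral_primitive f F (l m : R) :
  continuous f -> (forall x : R, is_derive x 1 F (f x)) ->
  mu.-integrable setT (EFin \o f) ->
  F k%:R @[k --> \oo] --> l -> F (- k%:R) @[k --> \oo] --> m ->
  (\int[mu]_x (f x)%:E = (l - m)%:E)%E.
Proof.
move=> cf dF intf Fl Fm.
have mf : measurable_fun setT f by exact: continuous_measurable_fun.
have lim1 : (\int[mu]_x (((f \_ (itvk k)) x)%:E))%E @[k --> \oo] -->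
    (\int[mu]_x (f x)%:E)%E.
  have := @dominated_cvg _ _ R mu setT measurableT
    (fun k x => ((f \_ (itvk k)) x)%:E) (EFin \o f) (fun x => (`|f x|)%:E).
  apply=> //.
  - move=> k; apply/measurable_EFinP; have mk : measurable (itvk k).
      exact: measurable_itv.
    by have [h _] := measurable_restrictT f mk; apply: h; exact: measurable_funTS.
  - move=> x _; apply: cvg_EFin; first exact: nearW.
    have : (\bigcup_k itvk k) x by rewrite itvk_cover.
    move=> [k _ xk]; apply: cvg_near_cst; exists k => // l' /= kl.
    by rewrite patchE mem_set//; have /subsetPset := itvk_nd kl; apply.
  - by have := integrable_abse intf.
  - move=> k x _ /=; rewrite lee_fin patchE; case: ifP => // _.
    by rewrite normr0.
have intE k : (\int[mu]_x (((f \_ (itvk k)) x)%:E) = (F k%:R - F (- k%:R))%:E)%E.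
  transitivity (\int[mu]_(x in itvk k) (f x)%:E)%E.
    rewrite [RHS]integral_mkcond; apply: eq_integral => x _.
    by rewrite !patchE; case: ifP.
  by apply: FTC2_itv => // [|x _]; [have := ler0n R k; lra|exact: cf].
have lim2 : (\int[mu]_x (((f \_ (itvk k)) x)%:E))%E @[k --> \oo] --> ((l - m)%:E)%E.
  under eq_cvg do rewrite intE.
  by apply: cvg_EFin; [exact: nearW|exact: cvgB].
exact: (cvg_unique (@ereal_hausdorff R) lim1 lim2).
Qed.

Lemma ge0_integral_even (h : R -> R) : measurable_fun setT h ->
  (forall x, 0 <= h x) -> (forall x, h (- x) = h x) ->
  (\int[mu]_x (h x)%:E = 2%:E * \int[mu]_(x in `]0%R, +oo[) (h x)%:E)%E.
Proof.
move=> mh h0 hN; have mhE : measurable_fun setT (EFin \o h) by exact/measurable_EFinP.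
have -> : [set: R] = `]-oo, 0%R] `|` `]0%R, +oo[ by rewrite -setCitvr setvU.
rewrite ge0_integral_setU//=; last 3 first.
- by apply: measurable_funTS.
- by move=> x _; rewrite lee_fin.
- by apply/disj_setPS => x [] /=; rewrite !in_itv /= andbT => ? ?; lra.
have /= := ge0_integration_by_substitution0 mhE (fun x => h0 x).
under [X in _ = X -> _]eq_integral do rewrite hN.
move=> <-.
rewrite -integral_itv_obnd_cbnd; last exact: measurable_funTS.
by rewrite mule_natl mule2n.
Qed.

(** The primitive is singular at 0, so the fundamental theorem is applied on
    [[Y / (k + 1), Y]]. *)
Lemma ge0_integral_power (g Y : R) : -1 < g -> 0 < Y ->
  (\int[mu]_(y in `]0%R, Y]) (y `^ g)%:E <= (Y `^ (g + 1) / (g + 1))%:E)%E.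
Proof.
move=> g1 Y0; have g0 : 0 < g + 1 by lra.
pose A (k : nat) : set R := `[Y / k.+1%:R, Y]%classic.
have kpos k : 0 < Y / k.+1%:R by rewrite divr_gt0.
have lim : (\int[mu]_(y in A k) (y `^ g)%:E)%E @[k --> \oo] -->
    (\int[mu]_(y in `]0%R, Y]) (y `^ g)%:E)%E.
  have -> : `]0%R, Y]%classic = \bigcup_k A k.
    apply/seteqP; split=> y.
      rewrite /= in_itv /= => /andP[y0 yY].
      exists (Num.bound (Y / y)) => //; rewrite /A /= in_itv /= yY andbT.
      rewrite ler_pdivrMr// mulrC -ler_pdivrMr//.
      have := archi_boundP (divr_ge0 (ltW Y0) (ltW y0)) => /ltW/le_trans; apply.
      by rewrite ler_nat.
    move=> [k _]; rewrite /A /= !in_itv /= => /andP[h ->]; rewrite andbT.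
    exact: lt_le_trans h.
  apply: ge0_nondecreasing_set_cvg_integral.
  - move=> k l kl; apply/subsetPset => y; rewrite /A /= !in_itv /=.
    move=> /andP[h ->]; rewrite andbT (le_trans _ h)// ler_pM2l//.
    by rewrite lef_pV2 ?posrE// ler_nat.
  - by move=> k; exact: measurable_itv.
  - by move=> k; apply: measurable_funTS; apply/measurable_EFinP; exact: measurable_powR.
  - by move=> k y _; rewrite lee_fin powR_ge0.
have le k : (\int[mu]_(y in A k) (y `^ g)%:E <= (Y `^ (g + 1) / (g + 1))%:E)%E.
  have -> : (\int[mu]_(y in A k) (y `^ g)%:E =
      (Y `^ (g + 1) / (g + 1) - (Y / k.+1%:R) `^ (g + 1) / (g + 1))%:E)%E.
    apply: (@FTC2_itv (fun y => y `^ g) (fun y => y `^ (g + 1) / (g + 1))).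
  - by rewrite ler_pdivrMr// ler_peMr ?ler1n// ltW.
  - move=> y /andP[y1 _]; have y0 : 0 < y by exact: lt_le_trans y1.
    have := is_derive1_powR (g + 1) y0; rewrite addrK => dy.
    have -> : (fun y => y `^ (g + 1) / (g + 1)) =
      (g + 1)^-1 \*: (fun y : R => y `^ (g + 1)).
      by apply/funext => x /=; rewrite mulrC.
    apply: is_derive_eq; rewrite /GRing.scale /= mulrA mulVf ?mul1r//.
    by rewrite gt_eqF.
  - move=> y /andP[y1 _]; have y0 : 0 < y by exact: lt_le_trans y1.
    apply/differentiable_continuous/derivable1_diffP.
    by have [] := is_derive1_powR g y0.
  by rewrite lee_fin gerBl divr_ge0 ?powR_ge0// ltW.
have -> : (\int[mu]_(y in `]0%R, Y]) (y `^ g)%:E =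
    limn (fun k => \int[mu]_(y in A k) (y `^ g)%:E))%E.
  by apply/esym/cvg_lim.
by apply: lime_le; [apply/cvg_ex; eexists; exact: lim|exact: nearW].
Qed.

Lemma ge0_integral_abs_power (g Y : R) : -1 < g -> 0 < Y ->
  (\int[mu]_y (if `|y| <= Y then `|y| `^ g else 0)%:E <=
   (2 * (Y `^ (g + 1) / (g + 1)))%:E)%E.
Proof.
move=> g1 Y0; pose h (y : R) : R := if `|y| <= Y then `|y| `^ g else 0.
have mabs : measurable_fun setT (fun y : R => `|y|) by exact: measurableT_comp.
have mh : measurable_fun setT h.
  apply: measurable_fun_ifT => //.
    by apply: measurable_fun_ler => //; exact: measurable_cst.
  by apply: (@measurableT_comp _ _ _ _ _ _ (fun y => y `^ g)) => //; exact: measurable_powR.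
rewrite (@ge0_integral_even h)//; last 2 first.
- by move=> y; rewrite /h; case: ifP => // _; exact: powR_ge0.
- by move=> y; rewrite /h normrN.
rewrite EFinM lee_pmul2l//; apply: le_trans (ge0_integral_power g1 Y0).
have -> : `]0%R, +oo[%classic = `]0%R, Y] `|` `]Y, +oo[ :> set R.
  apply/seteqP; split=> y; rewrite /= !in_itv /= !andbT.
    by move=> ->; have [|] := leP y Y; [left|right].
  by move=> [/andP[]//|]; exact: lt_trans.
rewrite ge0_integral_setU//=; last 3 first.
- by apply: measurable_funTS; exact/measurable_EFinP.
- by move=> y _; rewrite lee_fin /h; case: ifP => // _; exact: powR_ge0.
- by apply/disj_setPS => y [] /=; rewrite !in_itv /= andbT => ? ?; lra.
rewrite [X in (_ + X)%E]integral0_eq; last first.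
  move=> y; rewrite /= in_itv /= andbT => Yy; rewrite /h.
  by rewrite gtr0_norm ?(lt_trans Y0)// leNgt Yy.
rewrite adde0 le_eqVlt; apply/orP; left; apply/eqP.
apply: eq_integral => y; rewrite inE /= in_itv /= => /andP[y0 yY].
by rewrite /h gtr0_norm// yY.
Qed.

Lemma cvg_powR_pinfty (e : R) : e < 0 -> (1 + x) `^ e @[x --> +oo] --> (0 : R).
Proof.
move=> e0; have ne0 : 0 < - e by rewrite oppr_gt0.
apply/cvgrPdist_lt => d d0.
pose K : R := (d^-1) `^ (- e)^-1.
near=> x.
have Kx : K < x by near: x; apply: nbhs_pinfty_gt; exact: num_real.
have x0 : 0 < x by apply: le_lt_trans Kx; exact: powR_ge0.
have p0 : 0 < 1 + x by rewrite addr_gt0.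
rewrite sub0r normrN ger0_norm ?powR_ge0//.
rewrite -[e]opprK powRN -[d]invrK ltf_pV2 ?posrE ?invr_gt0 ?powR_gt0//.
have -> : d^-1 = K `^ (- e).
  by rewrite /K -powRrM mulVf ?gt_eqF// powRr1// invr_ge0 ltW.
apply: gt0_ltr_powR => //; rewrite ?nnegrE ?powR_ge0 ?(ltW p0)//.
by rewrite (lt_trans Kx)// ltrDr.
Unshelve. all: by end_near. Qed.

Lemma jap_ge_abs (x : R) : 1 + `|x| <= 2 * jap x%:C%C.
Proof.
have x0 := normr_ge0 x.
rewrite -ler_sqr ?nnegrE ?addr_ge0 ?mulr_ge0 ?(ltW (jap_gt0 _))//.
rewrite exprMn sqr_jap rnorm_real; have := sqr_ge0 (1 - `|x|).
rewrite !expr2; lra.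
Qed.

Lemma jap_le_abs (x : R) : jap x%:C%C <= 1 + `|x|.
Proof.
have x0 := normr_ge0 x.
rewrite -ler_sqr ?nnegrE ?addr_ge0 ?(ltW (jap_gt0 _))//.
by rewrite sqr_jap rnorm_real sqrrD expr1n mul1r lerD2r lerDl mulrn_wge0.
Qed.

Lemma jap_powR_le (x e : R) : e <= 0 ->
  jap x%:C%C `^ e <= 2 `^ (- e) * (1 + `|x|) `^ e.
Proof.
move=> e0; have ne0 : 0 <= - e by rewrite oppr_ge0.
have x0 : 0 < 1 + `|x| by rewrite ltr_pwDl.
have J0 := jap_gt0 x%:C%C.
move: ne0; rewrite -[e]opprK; move: (- e) => f; rewrite opprK => f0.
rewrite !powRN ler_pdivlMr ?powR_gt0// mulrC ler_pdivrMr ?powR_gt0//.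
rewrite -powRM ?(ltW J0)//.
by apply: ge0_ler_powR; rewrite ?nnegrE ?mulr_ge0 ?(ltW x0) ?(ltW J0)// jap_ge_abs.
Qed.

Lemma cvg_jap_powR_nat (e : R) : e < 0 ->
  jap (k%:R)%:C%C `^ e @[k --> \oo] --> (0 : R).
Proof.
move=> e0; have := (cvg_pinftyP _ _).1 (cvg_powR_pinfty e0) _ (@cvgr_idn R).
move=> lim; have h : 2 `^ (- e) * (1 + k%:R) `^ e @[k --> \oo] --> (0 : R).
  by rewrite -[X in _ --> X](mulr0 (2 `^ (- e))); apply: cvgM => //; exact: cvg_cst.
apply: (@squeeze_cvgr _ _ _ _ (fun=> 0) (fun k => 2 `^ (- e) * (1 + k%:R) `^ e)) => //.
  apply: nearW => k; rewrite powR_ge0/= (le_trans (jap_powR_le _ (ltW e0)))//.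
  by rewrite ger0_norm.
exact: cvg_cst.
Qed.

Lemma cvg_jap (x : R) : jap y%:C%C @[y --> x] --> jap x%:C%C.
Proof.
under eq_cvg do rewrite japE; rewrite japE.
apply: (@continuous_comp _ _ _ (fun y : R => 1 + y ^+ 2) (@Num.sqrt R)).
  by apply: cvgD; [exact: cvg_cst|exact: exprn_continuous].
exact: sqrt_continuous.
Qed.

Lemma cvg_powR_pos {T : Type} {G : set_system T} {FG : Filter G} (h : T -> R)
    (l e : R) : 0 < l -> h t @[t --> G] --> l -> h t `^ e @[t --> G] --> l `^ e.
Proof.
move=> l0 hl; have c : {for l, continuous (fun y : R => y `^ e)}.
  apply/differentiable_continuous/derivable1_diffP.
  by have [] := is_derive1_powR e l0.
exact: (cvg_comp _ _ hl c).
Qed.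

Lemma measurable_jap_powR (e : R) :
  measurable_fun setT (fun x : R => jap x%:C%C `^ e).
Proof.
apply: continuous_measurable_fun => x; apply: cvg_powR_pos; first exact: jap_gt0.
exact: cvg_jap.
Qed.

(** Compare with [(1 + |x|)^e], whose primitive on the half-line is explicit. *)
Lemma jap_powR_integrable (e : R) : e < -1 ->
  mu.-integrable setT (fun x => (jap x%:C%C `^ e)%:E).
Proof.
move=> e1; have ne0 : 0 < - (e + 1) by lra.
pose h (x : R) := (1 + `|x|) `^ e.
have hpos (x : R) : 0 < 1 + `|x| by rewrite ltr_pwDl.
have ch : continuous h.
  move=> x; apply: cvg_powR_pos => //; apply: cvgD; first exact: cvg_cst.
  exact: norm_continuous.
have mh : measurable_fun setT h by exact: continuous_measurable_fun.
have inth : (\int[mu]_x (h x)%:E < +oo)%E.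
  rewrite (@ge0_integral_even h)//; last 2 first.
  - by move=> x; exact: powR_ge0.
  - by move=> x; rewrite /h normrN.
  rewrite lte_mul_pinfty//.
  rewrite integral_itv_obnd_cbnd; last first.
    by apply: measurable_funTS; exact/measurable_EFinP.
  have -> : (\int[mu]_(x in `[0%R, +oo[) (h x)%:E =
      \int[mu]_(x in `[0%R, +oo[) ((1 + x) `^ e)%:E)%E.
    apply: eq_integral => x; rewrite inE /= in_itv /= andbT => x0.
    by rewrite /h ger0_norm.
  have dF (x : R) : 0 <= x -> is_derive x 1 (fun y : R => (1 + y) `^ (e + 1) / (e + 1))
      ((1 + x) `^ e).
    move=> x0; have x1 : 0 < 1 + x by rewrite ltr_pwDl.
    have d1 := is_derive1_powR (e + 1) x1; rewrite addrK in d1.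
    have d2 : is_derive x 1 (fun y : R => 1 + y) 1.
      have := is_deriveD (is_derive_cst (1 : R) x 1) (is_derive_id x 1).
      by rewrite add0r.
    have d3 := is_derive1_comp d1 d2.
    have -> : (fun y : R => (1 + y) `^ (e + 1) / (e + 1)) =
      (e + 1)^-1 \*: ((fun y : R => y `^ (e + 1)) \o (fun y : R => 1 + y)).
      by apply/funext => y /=; rewrite mulrC.
    apply: is_derive_eq; rewrite /GRing.scale /= mulr1 mulrA mulVf ?mul1r//.
    by rewrite lt_eqF// -oppr_gt0.
  have cF (x : R) : 0 <= x -> {for x, continuous (fun y : R => (1 + y) `^ (e + 1) / (e + 1))}.
    by move=> /dF hd; apply/differentiable_continuous/derivable1_diffP.
  rewrite (@ge0_continuous_FTC2y _ (fun x => (1 + x) `^ e)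
     (fun x => (1 + x) `^ (e + 1) / (e + 1)) 0 0).
  - by rewrite ltry.
  - by move=> x _; exact: powR_ge0.
  - apply: continuous_in_subspaceT => x; rewrite inE /= in_itv /= andbT => x0.
    apply: cvg_powR_pos; first by rewrite ltr_pwDl.
    by apply: cvgD => //; exact: cvg_cst.
  - rewrite -[X in _ --> X](mul0r (e + 1)^-1); apply: cvgM; last exact: cvg_cst.
    by apply: cvg_powR_pinfty; rewrite -oppr_gt0.
  - by move=> x /ltW /dF[].
  - by apply: cvg_at_right_filter; exact: cF.
  - move=> x; rewrite in_itv /= andbT => /ltW x0.
    by rewrite derive1E; apply: derive_val; exact: dF.
have ih0 : mu.-integrable setT (EFin \o h).
  apply/integrableP; split; first exact/measurable_EFinP.
  apply: le_lt_trans inth; rewrite le_eqVlt; apply/orP; left; apply/eqP.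
  by apply: eq_integral => x _ /=; rewrite ger0_norm// powR_ge0.
have ih := integrableZl measurableT (2 `^ (- e)) ih0.
apply: (le_integrable measurableT _ _ ih).
  by apply/measurable_EFinP; exact: measurable_jap_powR.
move=> x _ /=; rewrite lee_fin !ger0_norm ?mulr_ge0 ?powR_ge0//.
by apply: jap_powR_le; lra.
Qed.

End line_integrals.

(** * Integrable weights on the plane *)

Section weights.
Context {R : realType}.
Local Notation mu := (@lebesgue_measure R).
Local Notation mu2 := (@lebesgue_measure R \x @lebesgue_measure R)%E.

(** The common majorant of all the integrands below: they are supported in
    the cone that contains the support of the almost analytic extensions. *)
Definition weight (g d : R) (p : R * R) : R :=
  if `|p.2| <= 2 * jap p.1%:C%C then `|p.2| `^ g * jap p.1%:C%C `^ d else 0.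

Lemma weight_ge0 g d p : 0 <= weight g d p.
Proof. by rewrite /weight; case: ifP => // _; rewrite mulr_ge0// powR_ge0. Qed.

Lemma measurable_weight g d : measurable_fun setT (weight g d).
Proof.
have mabs : measurable_fun setT (fun p : R * R => `|p.2|).
  by apply: measurableT_comp => //; exact: measurable_snd.
have mJ (e : R) : measurable_fun setT (fun p : R * R => jap p.1%:C%C `^ e).
  apply: (@measurableT_comp _ _ _ _ _ _ (fun x : R => jap x%:C%C `^ e)).
    exact: measurable_jap_powR.
  exact: measurable_fst.
apply: measurable_fun_ifT => //.
  apply: measurable_fun_ler => //; apply: measurable_funM => //.
  have := mJ 1; under eq_fun do rewrite powRr1 ?(ltW (jap_gt0 _))//.
  by [].
apply: measurable_funM => //.
apply: (@measurableT_comp _ _ _ _ _ _ (fun y : R => y `^ g)) => //.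
Qed.

(** The integral over the section at [x] is of order [jap x `^ (g + d + 1)]. *)
Lemma weight_integrable g d : -1 < g -> g + d + 1 < -1 ->
  mu2.-integrable setT (EFin \o weight g d).
Proof.
move=> g1 gd1; have g0 : 0 < g + 1 by lra.
have mW : measurable_fun setT (EFin \o weight g d).
  by apply/measurable_EFinP; exact: measurable_weight.
have W0 p : (0 <= (EFin \o weight g d) p)%E by rewrite lee_fin weight_ge0.
apply/integrableP; split => //.
under eq_integral do rewrite gee0_abs//.
rewrite fubini_tonelli1//.
pose C : R := 2 * (2 `^ (g + 1) / (g + 1)).
have C0 : 0 <= C by rewrite mulr_ge0// divr_ge0 ?powR_ge0// ltW.
have le x : (fubini_F mu (EFin \o weight g d) x <=
    C%:E * (jap x%:C%C `^ (g + d + 1))%:E)%E.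
  have J0 := jap_gt0 x%:C%C.
  rewrite /fubini_F.
  have -> : (\int[mu]_y (EFin \o weight g d) (x, y) =
      \int[mu]_y ((jap x%:C%C `^ d)%:E *
        (if `|y| <= 2 * jap x%:C%C then `|y| `^ g else 0)%:E))%E.
    apply: eq_integral => y _; rewrite /= /weight /= -EFinM; congr EFin.
    by case: ifP => _; rewrite ?mulr0// mulrC.
  rewrite ge0_integralZl//; last 3 first.
  - apply/measurable_EFinP; apply: measurable_fun_ifT => //.
      by apply: measurable_fun_ler => //.
    apply: (@measurableT_comp _ _ _ _ _ _ (fun y : R => y `^ g)) => //.
  - by move=> y _; rewrite lee_fin; case: ifP => // _; exact: powR_ge0.
  - by rewrite lee_fin powR_ge0.
  have J2 : 0 < 2 * jap x%:C%C by rewrite mulr_gt0.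
  apply: (@le_trans _ _ ((jap x%:C%C `^ d)%:E *
     (2 * ((2 * jap x%:C%C) `^ (g + 1) / (g + 1)))%:E)%E).
    by rewrite lee_wpmul2l ?lee_fin ?powR_ge0//; exact: ge0_integral_abs_power.
  rewrite -!EFinM lee_fin powRM ?(ltW J0)//.
  have -> : g + d + 1 = d + (g + 1) by ring.
  rewrite [jap _ `^ (d + _)]powRD; last by apply/implyP => _; rewrite gt_eqF.
  by rewrite /C le_eqVlt; apply/orP; left; apply/eqP; ring.
apply: (@le_lt_trans _ _ (\int[mu]_x (C%:E * (jap x%:C%C `^ (g + d + 1))%:E))%E).
  apply: ge0_le_integral => //.
  - by move=> x _; apply: integral_ge0 => y _.
  - exact: measurable_fun_fubini_tonelli_F.
  - apply: emeasurable_funM => //; apply/measurable_EFinP.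
    exact: measurable_jap_powR.
  - by move=> x _; exact: le.
rewrite ge0_integralZl//.
- have /integrableP[_ h] := jap_powR_integrable gd1.
  rewrite lte_mul_pinfty//; apply: le_lt_trans h.
  rewrite le_eqVlt; apply/orP; left; apply/eqP.
  by apply: eq_integral => x _ /=; rewrite ger0_norm// powR_ge0.
- by apply/measurable_EFinP; exact: measurable_jap_powR.
- by move=> x _; rewrite lee_fin powR_ge0.
Qed.

End weights.

(** * Derivatives of complex functions of a real variable *)

Section cderivative.
Context {R : realType}.
Implicit Types (f g : R -> R[i]) (x : R) (l m : R[i]).

Definition is_cderive f x l :=
  is_derive x 1 (fun t => complex.Re (f t)) (complex.Re l) /\
  is_derive x 1 (fun t => complex.Im (f t)) (complex.Im l).

Lemma is_derive_congr (u v : R -> R) x (a b : R) : (forall t, u t = v t) ->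
  a = b -> is_derive x 1 u a -> is_derive x 1 v b.
Proof. by move=> /funext -> ->. Qed.

Lemma cderive1E f x l : is_cderive f x l -> cderive1 f x = l.
Proof.
move=> [dr di]; rewrite /cderive1 !derive1E.
rewrite -[@complex.Re R \o f]/(fun t => complex.Re (f t)).
rewrite -[@complex.Im R \o f]/(fun t => complex.Im (f t)).
by rewrite (@derive_val _ _ _ _ _ _ _ dr) (@derive_val _ _ _ _ _ _ _ di); case: (l).
Qed.

Lemma is_cderive_ext f g x l : (forall t, f t = g t) -> is_cderive f x l ->
  is_cderive g x l.
Proof. by move=> /funext ->. Qed.

Lemma is_cderive_near f g x l : (\forall t \near x, f t = g t) ->
  is_cderive f x l -> is_cderive g x l.
Proof.
move=> fg [dr di]; split; [move: dr|move: di];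
  by apply: near_eq_is_derive; apply: filterS fg => t ->.
Qed.

Lemma csmooth_is_cderive f : csmooth f -> forall n x,
  is_cderive (cderive1n n f) x (cderive1n n.+1 f x).
Proof.
move=> sf n x; have [dr di] := sf n x.
by split; rewrite /cderive1n iterS /cderive1 /= derive1E; exact: derivableP.
Qed.

Lemma is_cderive_continuous f x l : is_cderive f x l -> ccontinuous_at f x.
Proof.
by move=> [[dr _] [di _]]; split; apply/differentiable_continuous/derivable1_diffP.
Qed.

Lemma ReD (a b : R[i]) : complex.Re (a + b) = complex.Re a + complex.Re b.
Proof. exact: raddfD. Qed.

Lemma ImD (a b : R[i]) : complex.Im (a + b) = complex.Im a + complex.Im b.
Proof. exact: raddfD. Qed.

Lemma ReN (a : R[i]) : complex.Re (- a) = - complex.Re a.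
Proof. exact: raddfN. Qed.

Lemma ImN (a : R[i]) : complex.Im (- a) = - complex.Im a.
Proof. exact: raddfN. Qed.

Lemma is_cderive_cst (z : R[i]) x : is_cderive (fun=> z) x 0.
Proof. by split => /=; exact: is_derive_cst. Qed.

Lemma is_cderiveD f g x l m : is_cderive f x l -> is_cderive g x m ->
  is_cderive (fun t => f t + g t) x (l + m).
Proof.
move=> [fr fi] [gr gi]; split.
  by apply: is_derive_congr (is_deriveD fr gr) => [t|]; rewrite ReD.
by apply: is_derive_congr (is_deriveD fi gi) => [t|]; rewrite ImD.
Qed.

Lemma is_cderiveM f g x l m : is_cderive f x l -> is_cderive g x m ->
  is_cderive (fun t => f t * g t) x (l * g x + f x * m).
Proof.
move=> [fr fi] [gr gi]; split.
  apply: is_derive_congr (is_deriveB (is_deriveM fr gr) (is_deriveM fi gi)).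
    by move=> t; rewrite ReM.
  by rewrite ReD !ReM /GRing.scale /=; ring.
apply: is_derive_congr (is_deriveD (is_deriveM fr gi) (is_deriveM fi gr)).
  by move=> t; rewrite ImM.
by rewrite ImD !ImM /GRing.scale /=; ring.
Qed.

Lemma is_cderive_sum (I : Type) (s : seq I) (F : I -> R -> R[i]) x (l : I -> R[i]) :
  (forall i, is_cderive (F i) x (l i)) ->
  is_cderive (fun t => \sum_(i <- s) F i t) x (\sum_(i <- s) l i).
Proof.
move=> dF; elim: s => [|i s ih].
  by rewrite big_nil; apply: is_cderive_ext (is_cderive_cst 0 x) => t; rewrite big_nil.
rewrite big_cons; apply: is_cderive_ext (is_cderiveD (dF i) ih) => t.
by rewrite big_cons.
Qed.

Lemma is_cderiveX f x l k : is_cderive f x l ->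
  is_cderive (fun t => f t ^+ k) x (k%:R * f x ^+ k.-1 * l).
Proof.
move=> df; elim: k => [|k ih].
  by rewrite mul0r mul0r; apply: is_cderive_ext (is_cderive_cst 1 x) => t; rewrite expr0.
have := is_cderiveM df ih.
move/(@is_cderive_ext _ (fun t => f t ^+ k.+1)).
have -> : l * f x ^+ k + f x * (k%:R * f x ^+ k.-1 * l) = k.+1%:R * f x ^+ k.+1.-1 * l.
  case: k {ih} => [|k] /=; first by rewrite expr0; ring.
  by rewrite !exprS -[k.+2%:R]natr1; ring.
by apply=> t; rewrite exprS.
Qed.

Lemma is_cderiveV f x l : f x != 0 -> is_cderive f x l ->
  is_cderive (fun t => (f t)^-1) x (- l * (f x)^-1 ^+ 2).
Proof.
move=> fx0 [fr fi]; have N0 := ReIm_sqr_neq0 fx0.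
set N := (fun t : R => complex.Re (f t) ^+ 2 + complex.Im (f t) ^+ 2).
have dN : is_derive x 1 N (2 * (complex.Re (f x) * complex.Re l
    + complex.Im (f x) * complex.Im l)).
  apply: is_derive_congr (is_deriveD (is_deriveM fr fr) (is_deriveM fi fi)).
    by move=> t; rewrite /N !expr2.
  by rewrite /GRing.scale /=; ring.
have dV := is_deriveV (N0 : N x != 0) dN.
split.
  apply: is_derive_congr (is_deriveM fr dV); first by move=> t; rewrite ReV.
  rewrite /GRing.scale /= !(expr2, ReM, ImM, ReV, ImV, ReN, ImN) /N.
  by field.
apply: is_derive_congr (is_deriveN (is_deriveM fi dV)).
  by move=> t; rewrite ImV.
rewrite /GRing.scale /= !(expr2, ReM, ImM, ReV, ImV, ReN, ImN) /N.
by field.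
Qed.

Lemma is_cderive_comp f (h : R -> R) x l (a : R) : is_cderive f (h x) l ->
  is_derive x 1 h a -> is_cderive (fun t => f (h t)) x (a%:C%C * l).
Proof.
move=> [fr fi] dh; split.
  by have := is_derive1_comp fr dh; rewrite realZ_Re mulrC.
by have := is_derive1_comp fi dh; rewrite realZ_Im mulrC.
Qed.

Lemma is_cderive_imag (h : R -> R) x (a : R) : is_derive x 1 h a ->
  is_cderive (fun t => (0 +i* h t)%C) x (0 +i* a)%C.
Proof. by split => //=; exact: is_derive_cst. Qed.

Lemma is_derive_jap x :
  is_derive x 1 (fun t : R => jap t%:C%C) (x / jap x%:C%C).
Proof.
have p0 : 0 < 1 + x ^+ 2 by rewrite ltr_wpDr// sqr_ge0.
pose h (t : R) : R := 1 + t ^+ 2.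
have d1 : is_derive x 1 h (2 * x).
  apply: is_derive_congr (is_deriveD (is_derive_cst (1 : R) x 1)
    (is_deriveM (is_derive_id x 1) (is_derive_id x 1))).
    by move=> t; rewrite /h expr2.
  by rewrite /GRing.scale /=; ring.
have d2 := @is_derive1_comp _ (@Num.sqrt R) h x _ _ (is_derive1_sqrt p0) d1.
apply: is_derive_congr d2; first by move=> t; rewrite japE.
rewrite japE /h; field.
by rewrite sqrtr_eq0 -ltNge.
Qed.

End cderivative.

(** * Almost analytic extensions *)

Lemma powRB_nat {R : realType} (a e : R) (r : nat) : 0 < a ->
  a `^ (e - r%:R) * a ^+ r = a `^ e.
Proof.
move=> a0; rewrite -(powR_mulrn _ (ltW a0)) -powRD ?subrK//.
by rewrite (gt_eqF a0) implybT.
Qed.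

Lemma eq_ler {R : realType} (x y : R) : x = y -> x <= y.
Proof. by move=> ->. Qed.

Section cutoff_function.
Context {R : realType}.
Variable tau0 : R -> R[i].
Hypothesis htau : cutoff tau0.

Lemma cutoff_is_cderive (t : R) : is_cderive tau0 t (cderive1 tau0 t).
Proof. by case: htau => st _ _; exact: (csmooth_is_cderive st 0). Qed.

Lemma cutoff_derive_continuous (t : R) : ccontinuous_at (cderive1 tau0) t.
Proof.
by case: htau => st _ _; exact: is_cderive_continuous (csmooth_is_cderive st 1 t).
Qed.

(** The cutoff is constant near such points. *)
Lemma cutoff_derive_eq0 (t : R) : `|t| < 1 \/ 2 < `|t| -> cderive1 tau0 t = 0.
Proof.
case: htau => _ t1 t2 [h|h]; apply: cderive1E.
  apply: is_cderive_near (is_cderive_cst 1 t).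
  have : \forall s \near t, `|s| < 1.
    by apply: (cvgr_lt _ (@norm_continuous _ R t)).
  by apply: filterS => s /ltW /t1 ->.
apply: is_cderive_near (is_cderive_cst 0 t).
have : \forall s \near t, 2 < `|s|.
  by apply: (cvgr_gt _ (@norm_continuous _ R t)).
by apply: filterS => s /ltW /t2 ->.
Qed.

Lemma ccontinuous_bounded (g : R -> R[i]) : (forall t, ccontinuous_at g t) ->
  (forall t, 2 < `|t| -> g t = 0) -> exists2 K : R, 0 <= K & forall t, rnorm (g t) <= K.
Proof.
move=> cg g0.
have bnd (u : R -> R) : continuous u -> exists2 K : R, 0 <= K &
    forall t : R, `|t| <= 2 -> `|u t| <= K.
  move=> cu; have [||c _ hc] := @EVT_max R (fun t => `|u t|) (-2) 2; first lra.
    apply: continuous_subspaceT => t.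
    exact: (continuous_comp (cu t) (@norm_continuous _ R _)).
  exists `|u c| => // t; rewrite ler_norml => tt; apply: hc.
  by rewrite in_itv /=.
have [K1 K10 h1] := bnd _ (fun t => (cg t).1).
have [K2 K20 h2] := bnd _ (fun t => (cg t).2).
exists (K1 + K2); first exact: addr_ge0.
move=> t; have [tt|tt] := leP `|t| 2; last by rewrite g0// rnorm0 addr_ge0.
by apply: le_trans (rnorm_leReIm _) _; rewrite lerD// ?h1// h2.
Qed.

Lemma cutoff_bounded : exists2 K : R, 0 <= K &
  forall t, rnorm (tau0 t) <= K /\ rnorm (cderive1 tau0 t) <= K.
Proof.
have [|t t2|K1 K10 h1] := @ccontinuous_bounded tau0.
- by move=> t; exact: is_cderive_continuous (cutoff_is_cderive t).
- by case: htau => _ _; apply; exact: ltW.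
have [|t t2|K2 K20 h2] := @ccontinuous_bounded (cderive1 tau0).
- exact: cutoff_derive_continuous.
- by rewrite cutoff_derive_eq0//; right.
exists (K1 + K2); first exact: addr_ge0.
by move=> t; split; [rewrite ler_wpDr|rewrite ler_wpDl].
Qed.

End cutoff_function.

Section almost_analytic_extension.
Context {R : realType}.
Variables (tau0 : R -> R[i]) (n : nat) (f : R -> R[i]) (b : R).
Hypotheses (htau : cutoff tau0) (hf : symbol_class b f).

Local Notation J x := (jap x%:C%C).
Local Notation F := (almost_analytic tau0 n f).
Local Notation fr r := (cderive1n r f).

Let P (x y : R) : R[i] :=
  \sum_(r < n.+1) fr r x * (0 +i* y)%C ^+ r / (r`!)%:R.
Let Px (x y : R) : R[i] :=
  \sum_(r < n.+1) fr r.+1 x * (0 +i* y)%C ^+ r / (r`!)%:R.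
Let Py (x y : R) : R[i] :=
  'i%C * \sum_(r < n) fr r.+1 x * (0 +i* y)%C ^+ r / (r`!)%:R.

Definition aa_dx (x y : R) : R[i] :=
  Px x y * tau0 (y / J x) +
  P x y * ((- (y * x / J x ^+ 3))%:C%C * cderive1 tau0 (y / J x)).

Definition aa_dy (x y : R) : R[i] :=
  Py x y * tau0 (y / J x) + P x y * ((J x)^-1%:C%C * cderive1 tau0 (y / J x)).

Let df r x : is_cderive (fr r) x (fr r.+1 x).
Proof. by case: hf => sf _; exact: csmooth_is_cderive. Qed.

Let d_iy (y : R) : is_cderive (fun t => (0 +i* t)%C) y 'i%C.
Proof. exact: is_cderive_imag (is_derive_id y 1). Qed.

Lemma almost_analytic_dx x y : is_cderive (fun s => F s y) x (aa_dx x y).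
Proof.
have J0 : J x != 0 by rewrite gt_eqF// jap_gt0.
apply: is_cderiveM.
  apply: is_cderive_sum => r; rewrite -mulrA.
  have := is_cderiveM (df r x) (is_cderive_cst ((0 +i* y)%C ^+ r / (r`!)%:R) x).
  rewrite mulr0 addr0; apply: is_cderive_ext => t; exact: mulrA.
apply: (@is_cderive_comp _ tau0 (fun s : R => y / J s)).
  exact: cutoff_is_cderive.
have := is_deriveM (is_derive_cst y x 1) (@is_deriveV _ (fun t : R => J t) x _ 1 J0 (is_derive_jap x)).
apply: is_derive_congr => // ; rewrite /GRing.scale /= mulr0 addr0.
by field.
Qed.

Let Py_sum x y : Py x y = \sum_(r < n.+1)
   fr r x * (r%:R * (0 +i* y)%C ^+ r.-1 * 'i%C) / (r`!)%:R.
Proof.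
rewrite big_ord_recl /= !mul0r mulr0 mul0r add0r /Py mulr_sumr.
apply: eq_bigr => r _; rewrite /bump /= !add1n ?add0n factS natrM.
have r0 : (r.+1%:R : R[i]) != 0 by rewrite pnatr_eq0.
have f0 : (r`!%:R : R[i]) != 0 by rewrite pnatr_eq0 -lt0n fact_gt0.
move: r0 f0; move: (r.+1%:R) (r`!%:R) => u v u0 v0; field.
by rewrite u0 v0.
Qed.

Lemma almost_analytic_dy x y : is_cderive (fun t => F x t) y (aa_dy x y).
Proof.
apply: is_cderiveM.
  rewrite Py_sum; apply: is_cderive_sum => r.
  have := is_cderiveM (is_cderive_cst (fr r x) y)
    (is_cderiveM (is_cderiveX r (d_iy y)) (is_cderive_cst (r`!%:R)^-1 y)).
  rewrite mulr0 addr0 mul0r add0r mulrA.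
  by apply: is_cderive_ext => t; exact: mulrA.
apply: (@is_cderive_comp _ tau0 (fun t : R => t / J x)).
  exact: cutoff_is_cderive.
have := is_deriveM (is_derive_id y 1) (is_derive_cst (J x)^-1 y 1).
by apply: is_derive_congr => //; rewrite /GRing.scale /= mulr0 add0r mulr1.
Qed.

Lemma dbar_almost_analyticE x y :
  dbar F x y = 2^-1 * (aa_dx x y + 'i%C * aa_dy x y).
Proof.
rewrite /dbar (cderive1E (almost_analytic_dx x y)).
by rewrite (cderive1E (almost_analytic_dy x y)).
Qed.

(** The Cauchy-Riemann operator maps each Taylor term to a difference of two
    consecutive ones, so that only the last survives. *)
Lemma dbar_almost_analytic x y : dbar F x y = 2^-1 *
  (fr n.+1 x * (0 +i* y)%C ^+ n / (n`!)%:R * tau0 (y / J x) +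
   P x y * ((- (y * x / J x ^+ 3) +i* (J x)^-1)%C * cderive1 tau0 (y / J x))).
Proof.
rewrite dbar_almost_analyticE /aa_dx /aa_dy; congr (_ * _).
have -> : Px x y = \sum_(r < n) fr r.+1 x * (0 +i* y)%C ^+ r / (r`!)%:R +
    fr n.+1 x * (0 +i* y)%C ^+ n / (n`!)%:R by rewrite /Px big_ord_recr.
have -> : (- (y * x / J x ^+ 3) +i* (J x)^-1)%C =
    (- (y * x / J x ^+ 3))%:C%C + 'i%C * (J x)^-1%:C%C :> R[i].
  by apply/eqP; rewrite eq_complex /= !(mul0r, mulr0, mul1r, subr0, addr0, add0r) !eqxx.
rewrite /Py mulrDr !mulrA.
have ii : 'i%C * 'i%C = -1 :> R[i] by rewrite -expr2 sqr_i.
by rewrite ii; ring.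
Qed.

Lemma ccontinuous_comp {T : topologicalType} (g : R -> R[i]) (h : T -> R) (p : T) :
  ccontinuous_at g (h p) -> h q @[q --> p] --> h p ->
  ccontinuous_at (fun q => g (h q)) p.
Proof. by move=> [gr gi] ch; split; [exact: cvg_comp ch gr|exact: cvg_comp ch gi]. Qed.

Let c_fr r (p : R * R) : ccontinuous_at (fun q : R * R => fr r q.1) p.
Proof.
apply: (@ccontinuous_comp _ (fr r) fst); last exact: cvg_fst.
exact: is_cderive_continuous (df r p.1).
Qed.

Let c_ord (m : nat) (h : nat -> nat) (p : R * R) : ccontinuous_at
  (fun q : R * R => \sum_(r < m) fr (h r) q.1 * (0 +i* q.2)%C ^+ r / (r`!)%:R) p.
Proof.
apply: ccontinuous_sum => r; apply: ccontinuousM; last exact: ccontinuous_cst.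
apply: ccontinuousM; first exact: c_fr.
apply: ccontinuousX; apply: (@ccontinuous_imag _ _ snd); exact: cvg_snd.
Qed.

Let c_J (p : R * R) : J q.1 @[q --> p] --> J p.1.
Proof. by apply: (cvg_comp _ _ (@cvg_fst _ _ _ _ _) (@cvg_jap _ p.1)). Qed.

Let c_JV (p : R * R) : (J q.1)^-1 @[q --> p] --> (J p.1)^-1.
Proof. by apply: cvgV; [rewrite gt_eqF// jap_gt0|exact: c_J]. Qed.

Let c_yJ (p : R * R) : q.2 / J q.1 @[q --> p] --> p.2 / J p.1.
Proof. by apply: cvgM; [exact: cvg_snd|exact: c_JV]. Qed.

Let c_tau (p : R * R) : ccontinuous_at (fun q : R * R => tau0 (q.2 / J q.1)) p.
Proof.
apply: (@ccontinuous_comp _ tau0 (fun q : R * R => q.2 / J q.1)); last exact: c_yJ.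
exact: is_cderive_continuous (cutoff_is_cderive htau _).
Qed.

Let c_tau' (p : R * R) :
  ccontinuous_at (fun q : R * R => cderive1 tau0 (q.2 / J q.1)) p.
Proof.
apply: (@ccontinuous_comp _ (cderive1 tau0) (fun q : R * R => q.2 / J q.1)); last exact: c_yJ.
exact: cutoff_derive_continuous.
Qed.

Lemma almost_analytic_continuous (p : R * R) :
  ccontinuous_at (fun q : R * R => F q.1 q.2) p.
Proof. by apply: ccontinuousM; [exact: (@c_ord n.+1 id)|exact: c_tau]. Qed.

Lemma aa_dx_continuous (p : R * R) :
  ccontinuous_at (fun q : R * R => aa_dx q.1 q.2) p.
Proof.
apply: ccontinuousD.
  by apply: ccontinuousM; [exact: (@c_ord n.+1 succn)|exact: c_tau].
apply: ccontinuousM; first exact: (@c_ord n.+1 id).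
apply: ccontinuousM; last exact: c_tau'.
apply: (@ccontinuous_real _ _ (fun q : R * R => - (q.2 * q.1 / J q.1 ^+ 3))).
apply: cvgN; apply: cvgM; first by apply: cvgM; [exact: cvg_snd|exact: cvg_fst].
rewrite /= -exprVn; under eq_cvg do rewrite -exprVn !exprS expr0 mulr1.
rewrite !exprS expr0 mulr1.
by do !(apply: cvgM; first exact: c_JV); exact: c_JV.
Qed.

Lemma aa_dy_continuous (p : R * R) :
  ccontinuous_at (fun q : R * R => aa_dy q.1 q.2) p.
Proof.
apply: ccontinuousD.
  apply: ccontinuousM; last exact: c_tau.
  by apply: ccontinuousM; [exact: ccontinuous_cst|exact: (@c_ord n succn)].
apply: ccontinuousM; first exact: (@c_ord n.+1 id).
apply: ccontinuousM; last exact: c_tau'.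
apply: (@ccontinuous_real _ _ (fun q : R * R => (J q.1)^-1)); exact: c_JV.
Qed.

Lemma dbar_almost_analytic_continuous (p : R * R) :
  ccontinuous_at (fun q : R * R => dbar F q.1 q.2) p.
Proof.
under eq_fun do rewrite dbar_almost_analyticE.
apply: ccontinuousM; first exact: ccontinuous_cst.
apply: ccontinuousD; first exact: aa_dx_continuous.
by apply: ccontinuousM; [exact: ccontinuous_cst|exact: aa_dy_continuous].
Qed.

Let J0 (x : R) : 0 < J x.
Proof. exact: jap_gt0. Qed.

Let J_exp x (r : nat) : J x `^ (b - r%:R) * J x ^+ r = J x `^ b.
Proof. exact: (powRB_nat b r (J0 x)). Qed.

Let J_inv x : J x `^ b / J x = J x `^ (b - 1).
Proof.
by rewrite -(J_exp x 1) expr1 mulfK// gt_eqF.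
Qed.

Let fr_bound : exists2 A : R, 0 <= A & forall r x, (r <= n.+1)%N ->
  rnorm (fr r x) <= A * J x `^ (b - r%:R).
Proof.
case: hf => _ hb; elim: n.+1 => [|m [A A0 hA]].
  have [c c0 hc] := hb 0%N; exists c; first exact: ltW.
  by move=> r x; rewrite leqn0 => /eqP ->.
have [c c0 hc] := hb m.+1; exists (A + c); first by rewrite addr_ge0// ltW.
move=> r x; rewrite leq_eqVlt ltnS => /predU1P[->|rm].
  by rewrite (le_trans (hc x))// ler_wpM2r ?powR_ge0// lerDr.
by rewrite (le_trans (hA r x rm))// ler_wpM2r ?powR_ge0// lerDl ltW.
Qed.

Let factV_le1 (r : nat) : rnorm ((r`!%:R)^-1 : R[i]) <= 1.
Proof.
rewrite rnormV rnorm_nat invf_le1 ?ltr0n ?fact_gt0//.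
by rewrite -[1]/(1%:R) ler_nat fact_gt0.
Qed.

Let taylor_bound (A : R) (m j : nat) x y : 0 <= A ->
  (forall r x, (r <= n.+1)%N -> rnorm (fr r x) <= A * J x `^ (b - r%:R)) ->
  (m + j <= n.+2)%N -> `|y| <= 2 * J x ->
  rnorm (\sum_(r < m) fr (r + j) x * (0 +i* y)%C ^+ r / (r`!)%:R) <=
  A * (m%:R * 2 ^+ m) * J x `^ (b - j%:R).
Proof.
move=> A0 hA mj yJ; apply: le_trans (rnorm_sum _ _ _) _.
apply: (@le_trans _ _ (\sum_(r < m) A * 2 ^+ m * J x `^ (b - j%:R))); last first.
  by rewrite sumr_const card_ord -mulr_natl; apply: eq_ler; ring.
apply: ler_sum => r _; rewrite !rnormM rnormX rnorm_imag -mulrA.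
have rj : (r + j <= n.+1)%N by rewrite -ltnS (leq_trans _ mj)// ltn_add2r.
have hr := hA _ x rj.
apply: (@le_trans _ _ (A * J x `^ (b - (r + j)%:R) * ((2 * J x) ^+ r * 1))).
  apply: ler_pM => //; rewrite ?rnorm_ge0 ?mulr_ge0 ?exprn_ge0 ?rnorm_ge0//.
  apply: ler_pM => //; rewrite ?exprn_ge0 ?rnorm_ge0// lerXn2r// nnegrE mulr_ge0//.
  exact/ltW/J0.
have -> : J x `^ (b - j%:R) = J x `^ (b - (r + j)%:R) * J x ^+ r.
  by rewrite -(powRB_nat (b - j%:R) r (J0 x)) natrD opprD [- r%:R - _]addrC addrA.
rewrite mulr1 exprMn; have pow2 : 2 ^+ r <= 2 ^+ m :> R.
  by rewrite ler_weXn2l ?ler1n// ltnW.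
have := ler_wpM2l (mulr_ge0 (mulr_ge0 A0 (powR_ge0 (J x) (b - (r + j)%:R)))
  (exprn_ge0 r (ltW (J0 x)))) pow2.
by move=> h; apply: le_trans (le_trans _ h) _; apply: eq_ler; ring.
Qed.

(** On the support of [tau0 (y / <x>)] the quotient [|y| / <x>] is at most 2, so
    every Taylor term [f^(r)(x) (iy)^r / r!] is of order [<x>^b]; each derivative
    lowers the exponent by one.  In the last bound the Taylor part is of order
    [|y|^n <x>^(b-n-1)] because it telescopes, and the terms with the derivative of
    [tau0] live where [<x> <= |y|], so that any factor [<x>^n] can be traded
    for [|y|^n]. *)
Lemma almost_analytic_bounds : exists2 K : R, 0 <= K &
  (forall p : R * R, [/\ rnorm (F p.1 p.2) <= K * weight 0 b p,
    rnorm (aa_dx p.1 p.2) <= K * weight 0 (b - 1) p,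
    rnorm (aa_dy p.1 p.2) <= K * weight 0 (b - 1) p &
    rnorm (dbar F p.1 p.2) <= K * weight n%:R (b - n%:R - 1) p]).
Proof.
have [A A0 hA] := fr_bound; have [C C0 hC] := cutoff_bounded htau.
pose D : R := A * (n.+1%:R * 2 ^+ n.+1).
have D0 : 0 <= D by rewrite mulr_ge0// mulr_ge0// exprn_ge0.
pose K : R := D * C * 4 + A * C.
exists K; first by rewrite addr_ge0 ?mulr_ge0.
move=> [x y] /=; rewrite /weight /= powRr0 !mul1r; have Jx := J0 x.
have [yJ|yJ] := leP `|y| (2 * J x); last first.
  have t0 : tau0 (y / J x) = 0.
    case: htau => _ _; apply; rewrite normrM normfV [`|J x|]gtr0_norm//.
    by rewrite ler_pdivlMr// ltW.
  have t1 : cderive1 tau0 (y / J x) = 0.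
    apply: cutoff_derive_eq0 => //; right.
    by rewrite normrM normfV [`|J x|]gtr0_norm// ltr_pdivlMr.
  rewrite dbar_almost_analytic /aa_dx /aa_dy /almost_analytic t0 t1.
  by rewrite !mulr0 addr0 !mulr0 rnorm0; split.
have [hC1 hC2] := hC (y / J x).
have bP : rnorm (P x y) <= D * J x `^ b.
  have := @taylor_bound A n.+1 0 x y A0 hA _ yJ; rewrite addn0 subr0.
  move=> /(_ (leqnSn _)); apply: le_trans; apply: eq_ler; congr rnorm.
  by apply: eq_bigr => r _; rewrite addn0.
have bPx : rnorm (Px x y) <= D * J x `^ (b - 1).
  have := @taylor_bound A n.+1 1 x y A0 hA _ yJ; rewrite addn1.
  move=> /(_ (leqnn _)); apply: le_trans; apply: eq_ler; congr rnorm.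
  by apply: eq_bigr => r _; rewrite addn1.
have bPy : rnorm (Py x y) <= D * J x `^ (b - 1).
  have := @taylor_bound A n 1 x y A0 hA _ yJ; rewrite addn1 rnormM rnorm_i mul1r.
  move=> /(_ (leqnSn _)) h.
  have -> : \sum_(r < n) fr r.+1 x * (0 +i* y)%C ^+ r / (r`!)%:R =
      \sum_(r < n) fr (r + 1) x * (0 +i* y)%C ^+ r / (r`!)%:R.
    by apply: eq_bigr => r _; rewrite addn1.
  apply: le_trans h _; rewrite ler_wpM2r ?powR_ge0// ler_wpM2l//.
  by rewrite ler_pM ?exprn_ge0// ?ler_nat// ler_weXn2l// ler1n.
have Jb0 (e : R) : 0 <= J x `^ e by exact: powR_ge0.
have JV0 : 0 <= (J x)^-1 by rewrite invr_ge0 ltW.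
have xJ : `|x| <= J x by rewrite -rnorm_real rnorm_le_jap.
have coef1 : `|y * x / J x ^+ 3| <= 2 / J x.
  rewrite !normrM normfV [`|_ ^+ 3|]gtr0_norm ?exprn_gt0//.
  rewrite ler_pdivrMr ?exprn_gt0//.
  have -> : 2 / J x * J x ^+ 3 = (2 * J x) * J x.
    by rewrite !exprS expr0; field; rewrite gt_eqF.
  by rewrite ler_pM.
have KD : D * C * 4 <= K by rewrite lerDl mulr_ge0.
have KDC : D * C <= K by have := mulr_ge0 D0 C0; lra.
have KA : A * C <= K by rewrite lerDr !mulr_ge0.
split.
- rewrite /almost_analytic rnormM.
  apply: le_trans (ler_pM (rnorm_ge0 _) (rnorm_ge0 _) bP hC1) _.
  by rewrite mulrAC ler_wpM2r.
- rewrite /aa_dx; apply: le_trans (rnormD _ _) _; rewrite !rnormM rnorm_real normrN.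
  apply: (@le_trans _ _ (D * J x `^ (b - 1) * C + D * J x `^ b * (2 / J x * C))).
    apply: lerD; first by apply: ler_pM; rewrite ?rnorm_ge0.
    by apply: ler_pM; rewrite ?mulr_ge0 ?rnorm_ge0//; apply: ler_pM; rewrite ?rnorm_ge0.
  have -> : D * J x `^ b * (2 / J x * C) = D * C * 2 * (J x `^ b / J x) by ring.
  rewrite J_inv; have := ler_wpM2r (Jb0 (b - 1)) KD.
  have := mulr_ge0 (mulr_ge0 D0 C0) (Jb0 (b - 1)); lra.
- rewrite /aa_dy; apply: le_trans (rnormD _ _) _.
  rewrite [rnorm (Py x y * _)]rnormM [rnorm (P x y * _)]rnormM.
  rewrite [rnorm (_%:C%C * _)]rnormM rnorm_real.
  apply: (@le_trans _ _ (D * J x `^ (b - 1) * C + D * J x `^ b * ((J x)^-1 * C))).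
    apply: lerD; first by apply: ler_pM; rewrite ?rnorm_ge0.
    apply: ler_pM; rewrite ?mulr_ge0 ?rnorm_ge0//.
    by apply: ler_pM; rewrite ?rnorm_ge0// ger0_norm.
  have -> : D * J x `^ b * ((J x)^-1 * C) = D * C * (J x `^ b / J x) by ring.
  rewrite J_inv; have := ler_wpM2r (Jb0 (b - 1)) KD.
  have := mulr_ge0 (mulr_ge0 D0 C0) (Jb0 (b - 1)); lra.
rewrite dbar_almost_analytic rnormM rnormV rnorm_nat.
have Jn : J x `^ (b - n%:R - 1) * J x ^+ n = J x `^ (b - 1).
  by rewrite addrAC powRB_nat.
rewrite powR_mulrn//.
have y0 : 0 <= `|y| ^+ n by rewrite exprn_ge0.
have term1 : rnorm (fr n.+1 x * (0 +i* y)%C ^+ n / n`!%:R * tau0 (y / J x)) <=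
    A * C * (`|y| ^+ n * J x `^ (b - n%:R - 1)).
  rewrite !rnormM rnormX rnorm_imag.
  have h := hA n.+1 x (leqnn _).
  apply: (@le_trans _ _ (A * J x `^ (b - n.+1%:R) * `|y| ^+ n * 1 * C)).
    apply: ler_pM; rewrite ?mulr_ge0 ?rnorm_ge0//.
    apply: ler_pM; rewrite ?mulr_ge0 ?rnorm_ge0//.
    by apply: ler_pM; rewrite ?rnorm_ge0.
  have -> : b - n.+1%:R = b - n%:R - 1 by rewrite -natr1; ring.
  by apply: eq_ler; ring.
have term2 : rnorm (P x y * ((- (y * x / J x ^+ 3) +i* (J x)^-1)%C *
    cderive1 tau0 (y / J x))) <= D * C * 3 * (`|y| ^+ n * J x `^ (b - n%:R - 1)).
  have [y1|y1] := ltP `|y| (J x).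
    rewrite cutoff_derive_eq0 ?mulr0 ?rnorm0 ?mulr_ge0//; left.
    by rewrite normrM normfV [`|J x|]gtr0_norm// ltr_pdivrMr// mul1r.
  rewrite !rnormM.
  have coef : rnorm (- (y * x / J x ^+ 3) +i* (J x)^-1)%C <= 3 / J x.
    apply: le_trans (rnorm_leReIm _) _ => /=; rewrite normrN [X in _ + X]ger0_norm//.
    by have := coef1; lra.
  apply: (@le_trans _ _ (D * J x `^ b * (3 / J x * C))).
    by apply: ler_pM; rewrite ?mulr_ge0 ?rnorm_ge0//; apply: ler_pM; rewrite ?rnorm_ge0.
  have -> : D * J x `^ b * (3 / J x * C) = D * C * 3 * (J x `^ b / J x) by ring.
  rewrite J_inv -Jn ler_wpM2l ?mulr_ge0// mulrC ler_wpM2r//.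
  by rewrite lerXn2r// nnegrE// ltW.
have W0 := mulr_ge0 y0 (Jb0 (b - n%:R - 1)).
have hK := ler_wpM2r W0 (lexx K).
apply: (@le_trans _ _ (2^-1 * (A * C * (`|y| ^+ n * J x `^ (b - n%:R - 1)) +
   D * C * 3 * (`|y| ^+ n * J x `^ (b - n%:R - 1))))).
  by rewrite ler_wpM2l// (le_trans (rnormD _ _))// lerD.
have := mulr_ge0 (mulr_ge0 A0 C0) W0; have := mulr_ge0 (mulr_ge0 D0 C0) W0.
rewrite /K; move: (`|y| ^+ n * _) => w; lra.
Qed.

(** Near the axis the cutoff is 1, and the terms of positive degree are at most
    [|y| <x>^(b-1)] since [1 <= <x>]. *)
Lemma almost_analytic_near_axis : exists2 K : R, 0 <= K &
  forall x y : R, `|y| <= 1 -> rnorm (F x y - f x) <= K * `|y| * J x `^ (b - 1).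
Proof.
have [A A0 hA] := fr_bound; exists (A * n%:R); first by rewrite mulr_ge0.
move=> x y y1; have Jx := J0 x; have t1 : tau0 (y / J x) = 1.
  case: htau => _ + _; apply; rewrite normrM normfV [`|J x|]gtr0_norm//.
  by rewrite ler_pdivrMr// mul1r (le_trans y1)// jap_ge1.
rewrite /almost_analytic t1 mulr1 big_ord_recl /= expr0 mulr1 divr1.
rewrite addrC addrA addNr add0r.
apply: le_trans (rnorm_sum _ _ _) _.
apply: (@le_trans _ _ (\sum_(r < n) A * `|y| * J x `^ (b - 1))); last first.
  by rewrite sumr_const card_ord -mulr_natl; apply: eq_ler; ring.
apply: ler_sum => r _; rewrite !rnormM rnormX rnorm_imag.
apply: (@le_trans _ _ (A * J x `^ (b - 1) * `|y| * 1)); last by apply: eq_ler; ring.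
apply: ler_pM; rewrite ?mulr_ge0 ?rnorm_ge0 ?exprn_ge0//.
apply: ler_pM; rewrite ?rnorm_ge0 ?exprn_ge0//.
  have rn : (r.+1 <= n.+1)%N by rewrite ltnS ltnW// ltn_ord.
  apply: (@le_trans _ _ (A * J x `^ (b - r.+1%:R))); first exact: hA rn.
  rewrite ler_wpM2l// ler_powR ?jap_ge1// lerD2l lerN2.
  by rewrite -[1]/(1%:R) ler_nat.
by rewrite /bump /= exprS ler_piMr// exprn_ile1.
Qed.

End almost_analytic_extension.

(** * Dominated null sequences *)

Section null_sequences.
Context {R : realType} {d : measure_display} {X : measurableType d}.
Variable mu : {measure set X -> \bar R}.

(** The estimates below need integrals that are small, rather than a limit in the
    extended reals. *)
Lemma dominated_null (g : nat -> X -> R) (W : X -> R) :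
  (forall k, measurable_fun setT (g k)) -> (forall k t, 0 <= g k t <= W t) ->
  mu.-integrable setT (EFin \o W) ->
  {ae mu, forall t, setT t -> (g k t)%:E @[k --> \oo] --> 0%E} ->
  forall e : R, 0 < e -> \forall k \near \oo, (\int[mu]_t (g k t)%:E < e%:E)%E.
Proof.
move=> mg gW iW g0 e e0.
have [|||||_ _] := @dominated_convergence _ _ _ mu setT measurableT
  (fun k t => (g k t)%:E) (cst 0%E) (EFin \o W).
- by move=> k; exact/measurable_EFinP.
- exact: measurable_cst.
- exact: g0.
- exact: iW.
- apply: aeW => t k _ /=; have /andP[g1 g2] := gW k t.
  by rewrite lee_fin ger0_norm.
rewrite integral0 => /fine_cvgP[f1 /cvgrPdist_lt /(_ _ e0) f2].
apply: filterS (filterI f1 f2) => k /= [fk]; rewrite sub0r normrN.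
by move=> /(le_lt_trans (ler_norm _)); rewrite -lte_fin fineK.
Qed.

End null_sequences.

(** * Integrals off a strip around the axis *)

Section slit.
Context {R : realType}.
Local Notation mu := (@lebesgue_measure R).
Local Notation mu2 := (@lebesgue_measure R \x @lebesgue_measure R)%E.

(** Integrating a derivative outside [[-e, e]] leaves the values at the two
    ends of the gap, as [u] vanishes far away. *)
Lemma integral_primitive_slit (u du : R -> R) (e Y : R) : 0 < e ->
  (forall y : R, y != 0 -> is_derive y 1 u (du y)) ->
  (forall y, y != 0 -> {for y, continuous du}) ->
  (forall y, Y < `|y| -> u y = 0) -> (forall y, Y < `|y| -> du y = 0) ->
  (\int[mu]_y (if e < `|y| then du y else 0)%:E = (u (- e) - u e)%:E)%E.
Proof.
move=> e0 hu cdu u0 du0; pose Z := Num.max Y e + 1.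
have Ze : e <= Z by rewrite /Z ler_wpDr// le_max lexx orbT.
have ZY (y : R) : Z <= `|y| -> Y < `|y|.
  by apply: lt_le_trans; rewrite /Z ltr_pwDr// le_max lexx.
have piece (a b : R) : a <= b -> (forall x, a <= x <= b -> x != 0) ->
    mu.-integrable `[a, b] (EFin \o du) /\
    (\int[mu]_(y in `[a, b]) (du y)%:E = (u b - u a)%:E)%E.
  move=> ab ne0; split.
    apply: continuous_compact_integrable; first exact: segment_compact.
    by apply: continuous_in_subspaceT => x; rewrite inE /= in_itv /= => /ne0 /cdu.
  by apply: FTC2_itv => // x /ne0 x0; [exact: hu|exact: cdu].
have [|x /andP[h1 h2]|i1 I1] := piece (- Z) (- e); first by rewrite lerN2.
  by rewrite lt_eqF//; lra.
have [|x /andP[h1 h2]|i2 I2] := piece e Z => //.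
  by rewrite gt_eqF//; lra.
pose D : set R := `[- Z, - e[ `|` `]e, Z].
have Dabs (y : R) : D y -> e < `|y|.
  rewrite /D /= !in_itv /= lter_normr.
  by case=> /andP[h1 h2]; apply/orP; [right|left]; lra.
have DC (y : R) : `|y| < Z -> e < `|y| -> D y.
  rewrite ltr_norml lter_normr /D /= !in_itv /= => /andP[h1 h2].
  by case/orP => ey; [right|left]; lra.
transitivity (\int[mu]_(y in D) (du y)%:E)%E.
  rewrite [RHS]integral_mkcond; apply: eq_integral => y _; rewrite patchE.
  case: (boolP (y \in D)) => [/set_mem yD|/negP yD].
    by rewrite (Dabs _ yD).
  case: ifPn => // ey; rewrite du0//; apply: ZY.
  rewrite leNgt; apply/negP => yZ; apply: yD.
  exact/mem_set/DC.
have m1 : measurable (`[- Z, - e[ : set R) by exact: measurable_itv.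
have m2 : measurable (`]e, Z] : set R) by exact: measurable_itv.
have j1 : mu.-integrable `[- Z, - e[ (EFin \o du).
  by apply: (integrableS _ _ _ i1) => // x; rewrite /= !in_itv /= => /andP[-> /ltW].
have j2 : mu.-integrable `]e, Z] (EFin \o du).
  by apply: (integrableS _ _ _ i2) => // x; rewrite /= !in_itv /= => /andP[/ltW -> ].
have md1 : measurable_fun `[- Z, - e[ (EFin \o du) by case/integrableP: j1.
have md2 : measurable_fun `]e, Z] (EFin \o du) by case/integrableP: j2.
rewrite integral_setU//; last 2 first.
- exact/measurable_funU.
- by apply/disj_setPS => y [] /=; rewrite !in_itv /=; lra.
rewrite integral_itv_bndo_bndc// integral_itv_obnd_cbnd// I1 I2 -EFinD.
rewrite (u0 Z) ?(u0 (- Z)); first by congr EFin; ring.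
- by apply: ZY; rewrite normrN ler_norm.
- by apply: ZY; rewrite ler_norm.
Qed.

Lemma measurable_slit (h : R * R -> R) (e : R) : 0 <= e ->
  (forall p, p.2 != 0 -> h q @[q --> p] --> h p) ->
  measurable_fun setT (fun p : R * R => if e < `|p.2| then h p else 0).
Proof.
move=> e0 ch; pose D := [set p : R * R | e < `|p.2|].
have oD : open D.
  rewrite (_ : D = (fun p : R * R => `|p.2|) @^-1` [set y : R | e < y])//.
  apply: open_comp; last exact: open_gt.
  move=> p _; apply: (continuous_comp (f := snd)); first exact: cvg_snd.
  exact: norm_continuous.
have mD : measurable D by exact: open_measurable2.
rewrite -(setvU D); apply/measurable_funU => //; first exact: measurableC.
split.
  apply: (eq_measurable_fun (cst (0 : R))) => // p; rewrite inE /D /= => /negP.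
  by rewrite -leNgt => h1; rewrite ltNge h1.
apply: (eq_measurable_fun h); first by move=> p; rewrite inE /D /= => ->.
apply: continuous_measurable_fun2 => // p Dp; apply: ch.
by rewrite -normr_gt0; exact: le_lt_trans Dp.
Qed.

Lemma cmeasurable_slit (h : R * R -> R[i]) (e : R) : 0 <= e ->
  (forall p, p.2 != 0 -> ccontinuous_at h p) ->
  cmeasurable (fun p : R * R => if e < `|p.2| then h p else 0).
Proof.
move=> e0 ch; split.
  rewrite (_ : _ \o _ = fun p => if e < `|p.2| then complex.Re (h p) else 0).
    by apply: measurable_slit => // p /ch[].
  by apply/funext => p /=; case: ifP.
rewrite (_ : _ \o _ = fun p => if e < `|p.2| then complex.Im (h p) else 0).
  by apply: measurable_slit => // p /ch[].
by apply/funext => p /=; case: ifP.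
Qed.

Lemma weight_div g d (p : R * R) :
  weight g d p / jap p.1%:C%C = weight g (d - 1) p.
Proof.
rewrite /weight; case: ifP => _; last by rewrite mul0r.
have J0 := jap_gt0 p.1%:C%C.
by rewrite -mulrA -(powRB_nat d 1 J0) expr1 mulfK// gt_eqF.
Qed.

End slit.

(** * The Cauchy and Poisson kernels *)

Section cauchy_kernel.
Context {R : realType}.
Variable s : R.

(** The Cauchy kernel is the inverse of [z - s], for a real pole [s]. *)
Definition wker (x y : R) : R[i] := Complex (x - s) y.

Lemma rnorm_wker_y x y : `|y| <= rnorm (wker x y).
Proof. exact: (normIm_le (wker x y)). Qed.

Lemma rnorm_wker_x x y : `|x - s| <= rnorm (wker x y).
Proof. exact: (normRe_le (wker x y)). Qed.

Lemma wker_neq0 x y : y != 0 -> wker x y != 0.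
Proof. by move=> y0; rewrite eq_complex /= negb_and y0 orbT. Qed.

Lemma wker_dx x y : is_cderive (fun t => wker t y) x 1.
Proof.
split => /=; last exact: is_derive_cst.
by apply: is_derive_congr (is_deriveB (is_derive_id x 1) (is_derive_cst s x 1));
  rewrite ?subr0.
Qed.

Lemma wker_dy x y : is_cderive (fun t => wker x t) y 'i%C.
Proof. by split => /=; [exact: is_derive_cst|exact: is_derive_id]. Qed.

Lemma wker_continuous (p : R * R) : ccontinuous_at (fun q : R * R => wker q.1 q.2) p.
Proof.
split => /=; last exact: cvg_snd.
by apply: cvgB; [exact: cvg_fst|exact: cvg_cst].
Qed.

(** Away from the axis the kernel decays like [<x>^-1]; the constant depends on
    the distance to the axis. *)
Lemma rnorm_wkerV_le e x y : 0 < e -> e <= `|y| ->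
  rnorm (wker x y)^-1 <= ((1 + `|s|) / e + 1) / jap x%:C%C.
Proof.
move=> e0 ey; rewrite rnormV.
have w1 := rnorm_wker_y x y; have w2 := rnorm_wker_x x y.
have w0 : 0 < rnorm (wker x y) by rewrite (lt_le_trans e0)// (le_trans ey).
rewrite ler_pdivlMr ?jap_gt0// mulrC ler_pdivrMr//.
apply: le_trans (jap_le_abs x) _.
have := ler_normD (x - s) s; rewrite subrK => h.
have : (1 + `|s|) <= (1 + `|s|) / e * rnorm (wker x y).
  by rewrite mulrAC ler_pdivlMr// ler_wpM2l ?addr_ge0// (le_trans ey).
lra.
Qed.

End cauchy_kernel.

Section cintegral_linearity.
Context {R : realType} {d : measure_display} {X : measurableType d}.
Variable mu : {measure set X -> \bar R}.
Implicit Types b : X -> R[i].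

Lemma cintegralD b b' : cintegrable mu b -> cintegrable mu b' ->
  cintegral mu (fun t => b t + b' t) = cintegral mu b + cintegral mu b'.
Proof.
move=> [br bi] [br' bi']; apply/eqP; rewrite eq_complex ReD ImD /=.
rewrite -(RintegralD measurableT br br') -(RintegralD measurableT bi bi').
by apply/andP; split; apply/eqP; apply: eq_Rintegral => t _ /=; rewrite ?ReD ?ImD.
Qed.

Lemma cintegralZ (z : R[i]) b : cintegrable mu b ->
  cintegral mu (fun t => z * b t) = z * cintegral mu b.
Proof.
move=> [br bi]; apply/eqP; rewrite eq_complex ReM ImM /=.
have iZ (r : R) (g : X -> R) : mu.-integrable setT (EFin \o g) ->
    mu.-integrable setT (EFin \o (fun t => r * g t)).
  by move=> ig; have := integrableZl measurableT r ig.
rewrite -!RintegralZl//.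
rewrite -(RintegralB measurableT (iZ _ _ br) (iZ _ _ bi)).
rewrite -(RintegralD measurableT (iZ _ _ bi) (iZ _ _ br)).
by apply/andP; split; apply/eqP; apply: eq_Rintegral => t _ /=; rewrite ?ReM ?ImM.
Qed.

Lemma cintegrableZ (z : R[i]) b : cintegrable mu b ->
  cintegrable mu (fun t => z * b t).
Proof.
move=> [br bi]; split.
  apply: eq_integrable (integrableB measurableT (integrableZl measurableT (complex.Re z) br)
    (integrableZl measurableT (complex.Im z) bi)) => // t _.
  by rewrite ReM EFinB !EFinM.
apply: eq_integrable (integrableD measurableT (integrableZl measurableT (complex.Re z) bi)
  (integrableZl measurableT (complex.Im z) br)) => // t _.
by rewrite ImM EFinD !EFinM.
Qed.

Lemma cintegrableD b b' : cintegrable mu b -> cintegrable mu b' ->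
  cintegrable mu (fun t => b t + b' t).
Proof.
move=> [br bi] [br' bi']; split.
  apply: eq_integrable (integrableD measurableT br br') => // t _.
  by rewrite ReD EFinD.
apply: eq_integrable (integrableD measurableT bi bi') => // t _.
by rewrite ImD EFinD.
Qed.

End cintegral_linearity.

Section line_integral_lemmas.
Context {R : realType}.
Local Notation mu := (@lebesgue_measure R).
Local Notation mu2 := (@lebesgue_measure R \x @lebesgue_measure R)%E.

Lemma cintegral_fubini21 (g : R * R -> R[i]) (G : R -> R[i]) :
  cintegrable mu2 g ->
  (forall y, (\int[mu]_x (complex.Re (g (x, y)))%:E = (complex.Re (G y))%:E)%E) ->
  (forall y, (\int[mu]_x (complex.Im (g (x, y)))%:E = (complex.Im (G y))%:E)%E) ->
  cintegral mu2 g = cintegral mu G.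
Proof.
move=> [gr gi] hr hi; rewrite /cintegral /Rintegral.
rewrite -(integral21_prod_meas1 gr) -(integral21_prod_meas1 gi).
by congr (fine _ +i* fine _)%C; apply: eq_integral => y _; [exact: hr|exact: hi].
Qed.

Lemma cintegral_fubini12 (g : R * R -> R[i]) (G : R -> R[i]) :
  cintegrable mu2 g ->
  (forall x, (\int[mu]_y (complex.Re (g (x, y)))%:E = (complex.Re (G x))%:E)%E) ->
  (forall x, (\int[mu]_y (complex.Im (g (x, y)))%:E = (complex.Im (G x))%:E)%E) ->
  cintegral mu2 g = cintegral mu G.
Proof.
move=> [gr gi] hr hi; rewrite /cintegral /Rintegral.
rewrite -(integral12_prod_meas1 gr) -(integral12_prod_meas1 gi).
by congr (fine _ +i* fine _)%C; apply: eq_integral => y _; [exact: hr|exact: hi].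
Qed.

Lemma integral_primitive_decay (u du : R -> R) (A A' e e' : R) : e < 0 -> e' < -1 ->
  continuous du -> (forall x : R, is_derive x 1 u (du x)) ->
  (forall x, `|u x| <= A * jap x%:C%C `^ e) ->
  (forall x, `|du x| <= A' * jap x%:C%C `^ e') ->
  (\int[mu]_x (du x)%:E = 0)%E.
Proof.
move=> e0 e1 cdu hu uA duA.
have lim (v : nat -> R) : (forall k, `|v k| = k%:R) -> u (v k) @[k --> \oo] --> (0 : R).
  move=> hv; apply/cvgrPdist_le => eps eps0.
  have : A * jap (k%:R)%:C%C `^ e @[k --> \oo] --> (0 : R).
    by rewrite -[X in _ --> X](mulr0 A); apply: cvgM (cvg_jap_powR_nat e0); exact: cvg_cst.
  move=> /cvgrPdist_le/(_ _ eps0); apply: filterS => k; rewrite !sub0r !normrN => h.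
  apply: le_trans (uA _) _; apply: le_trans (ler_norm _) _.
  suff -> : jap (v k)%:C%C = jap (k%:R)%:C%C by [].
  by rewrite /jap !rnorm_real hv ger0_norm.
have idu : mu.-integrable setT (EFin \o du).
  have iJ := integrableZl measurableT A' (jap_powR_integrable e1).
  apply: (le_integrable measurableT _ _ iJ).
    by apply/measurable_EFinP; exact: continuous_measurable_fun.
  by move=> x _ /=; rewrite lee_fin (le_trans (duA x))// ler_norm.
rewrite (integral_primitive cdu hu idu (lim _ _) (lim _ _)) ?subrr// => k.
  by rewrite ger0_norm.
by rewrite normrN ger0_norm.
Qed.

(** A primitive is [atan ((x - s) / e)]. *)
Lemma integral_poisson (s e : R) : 0 < e ->
  (\int[mu]_x (e / ((x - s) ^+ 2 + e ^+ 2))%:E = pi%:E)%E.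
Proof.
move=> e0; have D0 (x : R) : 0 < (x - s) ^+ 2 + e ^+ 2.
  by rewrite ltr_wpDl ?sqr_ge0// exprn_gt0.
have aty (v : nat -> R) : v k @[k --> \oo] --> +oo ->
    atan (v k) @[k --> \oo] --> (pi / 2 : R).
  by move=> h; exact: (cvg_comp _ _ h (@cvgy_atan R)).
have -> : (pi : R) = pi / 2 - - (pi / 2) by lra.
apply: (@ge0_integral_primitive _ (fun x => e / ((x - s) ^+ 2 + e ^+ 2))
  (fun x => atan ((x - s) / e))).
- by move=> x; rewrite divr_ge0 ?ltW.
- move=> x; apply: cvgM; first exact: cvg_cst.
  apply: cvgV; first by rewrite gt_eqF.
  apply: cvgD; last exact: cvg_cst.
  by apply: cvgM; apply: cvgB; [exact: cvg_id|exact: cvg_cst|exact: cvg_id|exact: cvg_cst].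
- move=> x; have d1 : is_derive x 1 (fun t : R => (t - s) / e) e^-1.
    apply: is_derive_congr (is_deriveM (is_deriveB (is_derive_id x 1) (is_derive_cst s x 1))
      (is_derive_cst e^-1 x 1)) => //.
    by rewrite /GRing.scale /= subr0 mulr0 add0r mulr1.
  have := @is_derive1_comp _ atan _ _ _ _ (is_derive1_atan _) d1.
  apply: is_derive_congr => //.
  have e1 : e != 0 by rewrite gt_eqF.
  have := D0 x; move: (x - s) => t t0.
  have n1 : 1 + (t / e) ^+ 2 != 0 by rewrite gt_eqF// ltr_pwDl// sqr_ge0.
  by field; rewrite e1 gt_eqF//= addrC.
- apply: aty; apply/cvgryPge => A.
  near=> k; rewrite ler_pdivlMr// lerBrDr; near: k; exact: nbhs_infty_ger.
- have E (k : nat) : atan ((- k%:R - s) / e) = - atan ((k%:R + s) / e).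
    by rewrite -atanN -mulNr opprD.
  rewrite (_ : (fun k => _) = fun k => - atan ((k%:R + s) / e)); last exact/funext.
  apply: cvgN; apply: aty; apply/cvgryPge => A.
  near=> k; rewrite ler_pdivlMr// -lerBlDr; near: k; exact: nbhs_infty_ger.
Unshelve. all: by end_near.
Qed.

Lemma poisson_integrable (s e : R) : 0 < e ->
  mu.-integrable setT (fun x => (e / ((x - s) ^+ 2 + e ^+ 2))%:E).
Proof.
move=> e0; have D0 (x : R) : 0 < (x - s) ^+ 2 + e ^+ 2.
  by rewrite ltr_wpDl ?sqr_ge0// exprn_gt0.
apply/integrableP; split.
  apply/measurable_EFinP; apply: continuous_measurable_fun => x.
  apply: cvgM; first exact: cvg_cst.
  apply: cvgV; first by rewrite gt_eqF.
  apply: cvgD; last exact: cvg_cst.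
  by apply: cvgM; apply: cvgB; [exact: cvg_id|exact: cvg_cst|exact: cvg_id|exact: cvg_cst].
under eq_integral do rewrite gee0_abs ?lee_fin ?divr_ge0 ?ltW//.
by rewrite integral_poisson// ltry.
Qed.

(** For [|t| <= 1] the bound [m <= L |t|] and [2 |t| e <= t^2 + e^2] are used; for
    larger [t], the bound [m <= L] and [e <= 1].  The majorant does not depend on
    [e]. *)
Lemma poisson_dominated (t e L m : R) : 0 < e <= 1 -> 0 <= m -> m <= L -> m <= L * `|t| ->
  m * (e / (t ^+ 2 + e ^+ 2)) <= 2 * L / (t ^+ 2 + 1).
Proof.
move=> /andP[e0 e1] m0 mL mt; have L0 : 0 <= L by exact: le_trans mL.
have t2 : 0 <= t ^+ 2 by exact: sqr_ge0.
have D0 : 0 < t ^+ 2 + e ^+ 2 by rewrite ltr_wpDl// exprn_gt0.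
have E0 : 0 < t ^+ 2 + 1 by rewrite ltr_wpDl.
rewrite mulrA ler_pdivrMr// mulrAC ler_pdivlMr//.
rewrite -(real_normK (num_real t)) in t2 D0 E0 *; move: mt t2 D0 E0.
have := normr_ge0 t; move: `|t| => {}t t0 mt t2 D0 E0.
have [t1|t1] := leP t 1.
  apply: (@le_trans _ _ (L * t * e * 2)).
    apply: ler_pM; [exact: mulr_ge0 m0 (ltW e0)|exact: ltW| |nra].
    by rewrite ler_wpM2r ?(ltW e0).
  by have := mulr_ge0 L0 (sqr_ge0 (t - e)); nra.
apply: (@le_trans _ _ (L * (2 * t ^+ 2))).
  apply: ler_pM; [exact: mulr_ge0 m0 (ltW e0)|exact: ltW| |nra].
  by apply: le_trans (ler_wpM2l m0 e1) _; rewrite mulr1.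
have := mulr_ge0 L0 (sqr_ge0 e); nra.
Qed.

End line_integral_lemmas.

Section symbol_lipschitz.
Context {R : realType}.

(** The mean value inequality. *)
Lemma ler_dist_derive (u du : R -> R) (C : R) : (forall x : R, is_derive x 1 u (du x)) ->
  (forall x, `|du x| <= C) -> forall x y, `|u x - u y| <= C * `|x - y|.
Proof.
move=> hu hC; suff le x y : x <= y -> `|u y - u x| <= C * `|y - x|.
  move=> x y; have [|/ltW] := leP x y; last exact: le.
  by move=> /le; rewrite distrC (distrC y).
move=> xy; have [c _ ->] := MVT_segment xy (fun z _ => hu z)
  (derivable_within_continuous (fun z _ => @ex_derive _ _ _ _ _ _ _ (hu z))).
by rewrite normrM ler_wpM2r.
Qed.

(** Symbols of nonpositive order are bounded, and so are their derivatives. *)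
Lemma symbol_lipschitz (f : R -> R[i]) (b : R) : b <= 0 -> symbol_class b f ->
  exists2 L : R, 0 <= L &
    forall x y, rnorm (f x - f y) <= L /\ rnorm (f x - f y) <= L * `|x - y|.
Proof.
move=> b0 [sf hf]; have [c c0 hc] := hf 0; have [c1 c10 hc1] := hf 1%N.
have J1 (x e : R) : e <= 0 -> jap x%:C%C `^ e <= 1.
  move=> e0; rewrite -(powRr0 (jap x%:C%C)) ler_powR ?jap_ge1//.
have {}hc x : rnorm (f x) <= c.
  apply: le_trans (hc x) _; rewrite -[leRHS]mulr1 ler_wpM2l ?(ltW c0) ?(ltW c10)//.
  by apply: J1; rewrite subr0.
have {}hc1 x : rnorm (cderive1 f x) <= c1.
  apply: le_trans (hc1 x) _; rewrite -[leRHS]mulr1 ler_wpM2l ?(ltW c0) ?(ltW c10)//.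
  by apply: J1; lra.
exists (2 * c + 2 * c1); first lra.
move=> x y; split.
  by have := rnormB (f x) (f y); have := hc x; have := hc y; lra.
have d0 := csmooth_is_cderive sf 0.
have hr : `|complex.Re (f x) - complex.Re (f y)| <= c1 * `|x - y|.
  apply: (@ler_dist_derive (fun t => complex.Re (f t)) (fun t => complex.Re (cderive1 f t))) => [t|t].
    by case: (d0 t).
  by apply: le_trans (normRe_le _) _.
have hi : `|complex.Im (f x) - complex.Im (f y)| <= c1 * `|x - y|.
  apply: (@ler_dist_derive (fun t => complex.Im (f t)) (fun t => complex.Im (cderive1 f t))) => [t|t].
    by case: (d0 t).
  by apply: le_trans (normIm_le _) _.
apply: le_trans (rnorm_leReIm _) _; rewrite ReD ImD ReN ImN.
have := mulr_ge0 (ltW c0) (normr_ge0 (x - y)); lra.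
Qed.

End symbol_lipschitz.

(** * The Cauchy-Pompeiu formula for almost analytic extensions *)

Section sections_and_weights.
Context {R : realType}.
Local Notation J x := (jap x%:C%C).

Lemma ccontinuous_section_x (g : R * R -> R[i]) (x y : R) :
  ccontinuous_at g (x, y) -> ccontinuous_at (fun t => g (t, y)) x.
Proof.
have c : (t, y) @[t --> x] --> (x, y) by exact: (@cvg_pair _ _ _ (nbhs x) (nbhs x) (nbhs y) _ _ _ _ _ cvg_id (cvg_cst y)).
by move=> [gr gi]; split; [exact: cvg_comp c gr|exact: cvg_comp c gi].
Qed.

Lemma ccontinuous_section_y (g : R * R -> R[i]) (x y : R) :
  ccontinuous_at g (x, y) -> ccontinuous_at (fun t => g (x, t)) y.
Proof.
have c : (x, t) @[t --> y] --> (x, y) by exact: (@cvg_pair _ _ _ (nbhs y) (nbhs x) (nbhs y) _ _ _ _ _ (cvg_cst x) cvg_id).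
by move=> [gr gi]; split; [exact: cvg_comp c gr|exact: cvg_comp c gi].
Qed.

Lemma weight_divy g d (p : R * R) : p.2 != 0 ->
  weight g d p / `|p.2| = weight (g - 1) d p.
Proof.
move=> p0; rewrite /weight; case: ifP => _; last by rewrite mul0r.
have y0 : 0 < `|p.2| by rewrite normr_gt0.
by rewrite mulrAC -[X in X / _](powRB_nat g 1 y0) expr1 mulfK ?gt_eqF.
Qed.

Lemma weight0_le d (p : R * R) : weight 0 d p <= J p.1 `^ d.
Proof.
by rewrite /weight; case: ifP => _; rewrite ?powR_ge0// powRr0 mul1r.
Qed.

Lemma dbar_almost_analytic_axis (tau0 : R -> R[i]) (n : nat) (f : R -> R[i]) (b : R)
    (p : R * R) : cutoff tau0 -> symbol_class b f -> (0 < n)%N -> p.2 = 0 ->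
  dbar (almost_analytic tau0 n f) p.1 p.2 = 0.
Proof.
move=> htau hf n0 p0; have [K _ hK] := almost_analytic_bounds n htau hf.
have [_ _ _ hb] := hK p; apply/eqP; rewrite -rnorm_eq0 eq_le rnorm_ge0 andbT.
apply: le_trans hb _; rewrite /weight p0 normr0 powR0 ?mul0r ?if_same ?mulr0//.
by rewrite pnatr_eq0 -lt0n.
Qed.

Lemma ccontinuous_line_cmeasurable (g : R -> R[i]) :
  (forall x, ccontinuous_at g x) -> cmeasurable g.
Proof. by move=> cg; split; apply: continuous_measurable_fun => x; case: (cg x). Qed.

Lemma poisson_cintegrable (s : R) (z : R[i]) (e : R) : 0 < e ->
  let g (x : R) := (2 * (e / ((x - s) ^+ 2 + e ^+ 2)))%:C%C * z in
  cintegrable (@lebesgue_measure R) g /\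
  cintegral (@lebesgue_measure R) g = (2 * pi)%:C%C * z.
Proof.
move=> e0 g; pose p (x : R) : R[i] := (e / ((x - s) ^+ 2 + e ^+ 2))%:C%C.
have ip : cintegrable (@lebesgue_measure R) p.
  split; first exact: (poisson_integrable s e0).
  exact: (@integrable0 _ _ _ (@lebesgue_measure R) setT).
have gE : g = fun x => (2 * z) * p x.
  by apply/funext => x; rewrite /g /p rmorphM rmorph_nat; ring.
rewrite gE; split; first exact: cintegrableZ.
suff cp : cintegral (@lebesgue_measure R) p = pi%:C%C.
  by rewrite (cintegralZ _ ip) cp rmorphM rmorph_nat; ring.
rewrite /cintegral /Rintegral (integral_poisson s e0).
by rewrite (_ : (\int[_]_x _)%E = 0%E)//; exact: integral0_eq.
Qed.

End sections_and_weights.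

Section cauchy_pompeiu.
Context {R : realType}.
Variables (tau0 : R -> R[i]) (n : nat) (f : R -> R[i]) (b s : R).
Hypotheses (htau : cutoff tau0) (hf : symbol_class b f).
Hypotheses (b0 : b < 0) (n0 : (0 < n)%N).
Let b1 : b - 1 < -1. Proof. by have := b0; lra. Qed.
Let b2 : b - 2 < -1. Proof. by have := b0; lra. Qed.
Let bw0 : 0 + (b - 2) + 1 < -1. Proof. by have := b0; lra. Qed.
Let bwn : n%:R - 1 + (b - n%:R - 1) + 1 < -1 :> R. Proof. by have := b0; lra. Qed.
Let n1 : -1 < n%:R - 1 :> R. Proof. by rewrite ltrBrDl addrN ltr0n. Qed.
Variable K : R.
Hypothesis K0 : 0 <= K.
Hypothesis hK : forall p : R * R,
  [/\ rnorm (almost_analytic tau0 n f p.1 p.2) <= K * weight 0 b p,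
      rnorm (aa_dx tau0 n f p.1 p.2) <= K * weight 0 (b - 1) p,
      rnorm (aa_dy tau0 n f p.1 p.2) <= K * weight 0 (b - 1) p &
      rnorm (dbar (almost_analytic tau0 n f) p.1 p.2) <= K * weight n%:R (b - n%:R - 1) p].

Local Notation mu := (@lebesgue_measure R).
Local Notation mu2 := (@lebesgue_measure R \x @lebesgue_measure R)%E.
Local Notation J x := (jap x%:C%C).
Local Notation F := (almost_analytic tau0 n f).
Local Notation w := (wker s).

Let G (x y : R) : R[i] := F x y * (w x y)^-1.
Let Gx (x y : R) : R[i] :=
  aa_dx tau0 n f x y * (w x y)^-1 + F x y * (- 1 * (w x y)^-1 ^+ 2).
Let Gy (x y : R) : R[i] :=
  aa_dy tau0 n f x y * (w x y)^-1 + F x y * (- 'i%C * (w x y)^-1 ^+ 2).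

Let G_dx (x y : R) : y != 0 -> is_cderive (fun t => G t y) x (Gx x y).
Proof.
move=> y0; apply: is_cderiveM; first exact: (almost_analytic_dx n htau hf).
by apply: (@is_cderiveV _ (fun t => w t y)); [exact: wker_neq0|exact: wker_dx].
Qed.

Let G_dy (x y : R) : y != 0 -> is_cderive (fun t => G x t) y (Gy x y).
Proof.
move=> y0; apply: is_cderiveM; first exact: (almost_analytic_dy n f htau).
by apply: (@is_cderiveV _ (fun t => w x t)); [exact: wker_neq0|exact: wker_dy].
Qed.

(** The Cauchy-Riemann operator annihilates the kernel, so that it maps [G] to the
    integrand. *)
Let dbar_G x y : dbar F x y * (w x y)^-1 = 2^-1 * (Gx x y + 'i%C * Gy x y).
Proof.
rewrite (dbar_almost_analyticE n htau hf) /Gx /Gy.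
have : ('i%C : R[i]) * 'i%C = -1 by rewrite -expr2 sqr_i.
move: ('i%C : R[i]) (2^-1 : R[i]) (F x y) (aa_dx _ _ _ x y) (aa_dy _ _ _ x y) (w x y)^-1.
move=> i h u ux uy v ii; rewrite -[LHS]addr0 -[X in _ + X = _](mulr0 (h * u * v ^+ 2)).
by rewrite -[X in _ + _ * X](subrr (-1)) -[X in _ * (_ - X)]ii; ring.
Qed.

Let wV_continuous (p : R * R) : p.2 != 0 ->
  ccontinuous_at (fun q : R * R => (w q.1 q.2)^-1) p.
Proof.
move=> p0; apply: ccontinuousV; last exact: wker_continuous.
exact: wker_neq0.
Qed.

Let G_continuous (p : R * R) : p.2 != 0 ->
  ccontinuous_at (fun q : R * R => G q.1 q.2) p.
Proof.
move=> p0; apply: ccontinuousM; last exact: wV_continuous.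
exact: (almost_analytic_continuous n htau hf).
Qed.

Let Gx_continuous (p : R * R) : p.2 != 0 ->
  ccontinuous_at (fun q : R * R => Gx q.1 q.2) p.
Proof.
move=> p0; apply: ccontinuousD; apply: ccontinuousM.
- exact: (aa_dx_continuous n htau hf).
- exact: wV_continuous.
- exact: (almost_analytic_continuous n htau hf).
- apply: ccontinuousM; first exact: ccontinuous_cst.
  by apply: ccontinuousX; exact: wV_continuous.
Qed.

Let Gy_continuous (p : R * R) : p.2 != 0 ->
  ccontinuous_at (fun q : R * R => Gy q.1 q.2) p.
Proof.
move=> p0; apply: ccontinuousD; apply: ccontinuousM.
- exact: (aa_dy_continuous n htau hf).
- exact: wV_continuous.
- exact: (almost_analytic_continuous n htau hf).
- apply: ccontinuousM; first exact: ccontinuous_cst.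
  by apply: ccontinuousX; exact: wV_continuous.
Qed.

Let pompeiu_bound (p : R * R) :
  rnorm (dbar F p.1 p.2 * (w p.1 p.2)^-1) <= K * weight (n%:R - 1) (b - n%:R - 1) p.
Proof.
have [_ _ _ hb] := hK p; have [p0|p0] := eqVneq p.2 0.
  rewrite (dbar_almost_analytic_axis htau hf n0 p0) mul0r rnorm0.
  by rewrite mulr_ge0 ?weight_ge0.
rewrite rnormM rnormV -(weight_divy _ _ p0) mulrA.
have y0 : 0 < `|p.2| by rewrite normr_gt0.
apply: ler_pM => //; rewrite ?rnorm_ge0 ?invr_ge0 ?rnorm_ge0//.
have h := rnorm_wker_y s p.1 p.2.
by rewrite lef_pV2 ?posrE// (lt_le_trans y0).
Qed.

Let pompeiu_weight : mu2.-integrable setT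
  (EFin \o (fun p => K * weight (n%:R - 1) (b - n%:R - 1) p)).
Proof.
have iw : mu2.-integrable setT (EFin \o weight (n%:R - 1) (b - n%:R - 1)).
  exact: weight_integrable.
exact: (integrableZl measurableT K iw).
Qed.

Lemma cauchy_transform_integrable :
  cintegrable mu2 (fun p => dbar F p.1 p.2 * (w p.1 p.2)^-1).
Proof.
apply: dominated_cintegrable pompeiu_weight pompeiu_bound.
apply: ccontinuous_cmeasurable => p p0.
  apply: ccontinuousM; last exact: wV_continuous.
  exact: (dbar_almost_analytic_continuous n htau hf).
by rewrite (dbar_almost_analytic_axis htau hf n0 p0) mul0r.
Qed.

Let slit (e : R) (g : R -> R -> R[i]) (p : R * R) : R[i] :=
  if e < `|p.2| then g p.1 p.2 else 0.

Let C (e : R) : R := (1 + `|s|) / e + 1.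
Let C0 (e : R) : 0 < e -> 0 <= C e.
Proof. by move=> e0; rewrite addr_ge0// divr_ge0 ?addr_ge0// ltW. Qed.
Let M (e : R) : R := K * C e + K * C e ^+ 2.
Let M0 (e : R) : 0 < e -> 0 <= M e.
Proof. by move=> /C0 h; rewrite addr_ge0// mulr_ge0// exprn_ge0. Qed.

(** One bound for both partial derivatives of [G], which have the same shape. *)
Let kernel_bound (a c : R[i]) (e : R) (p : R * R) : 0 < e -> e <= `|p.2| ->
  rnorm a <= K * weight 0 (b - 1) p -> rnorm c <= 1 ->
  rnorm (a * (w p.1 p.2)^-1 + F p.1 p.2 * (c * (w p.1 p.2)^-1 ^+ 2)) <=
  M e * weight 0 (b - 2) p.
Proof.
move=> e0 ep ha hc; have [hF _ _ _] := hK p.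
have hw := rnorm_wkerV_le s p.1 e0 ep; rewrite -/(C e) in hw.
have Jp : 0 < J p.1 := jap_gt0 _.
have E2 : weight 0 (b - 2) p = weight 0 (b - 1) p / J p.1.
  by rewrite weight_div; congr weight; lra.
have E1 : weight 0 (b - 1) p = weight 0 b p / J p.1 by rewrite weight_div.
apply: le_trans (rnormD _ _) _; rewrite /M mulrDl; apply: lerD.
  rewrite rnormM E2 [leRHS](_ : _ = K * weight 0 (b - 1) p * (C e / J p.1)); last ring.
  by apply: ler_pM; rewrite ?rnorm_ge0.
rewrite [leLHS]rnormM (rnormM c) rnormX E2 E1.
rewrite [leRHS](_ : _ = K * weight 0 b p * (1 * (C e / J p.1) ^+ 2)); last first.
  by rewrite mul1r expr2; ring.
have hw2 : rnorm (w p.1 p.2)^-1 ^+ 2 <= (C e / J p.1) ^+ 2.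
  by rewrite !expr2; apply: ler_pM; rewrite ?rnorm_ge0.
by apply: (ler_pM _ _ hF (ler_pM _ _ hc hw2));
  rewrite ?mulr_ge0 ?exprn_ge0 ?rnorm_ge0.
Qed.

Let Gx_bound (e : R) (p : R * R) : 0 < e -> e <= `|p.2| ->
  rnorm (Gx p.1 p.2) <= M e * weight 0 (b - 2) p.
Proof.
by move=> e0 ep; apply: kernel_bound => //; [case: (hK p)|rewrite rnormN rnorm1].
Qed.

Let Gy_bound (e : R) (p : R * R) : 0 < e -> e <= `|p.2| ->
  rnorm (Gy p.1 p.2) <= M e * weight 0 (b - 2) p.
Proof.
by move=> e0 ep; apply: kernel_bound => //; [case: (hK p)|rewrite rnormN rnorm_i].
Qed.

Let slit_integrable (g : R -> R -> R[i]) (e : R) : 0 < e ->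
  (forall p : R * R, p.2 != 0 -> ccontinuous_at (fun q : R * R => g q.1 q.2) p) ->
  (forall p : R * R, e <= `|p.2| -> rnorm (g p.1 p.2) <= M e * weight 0 (b - 2) p) ->
  cintegrable mu2 (slit e g).
Proof.
move=> e0 cg hg.
have iw : mu2.-integrable setT (EFin \o weight 0 (b - 2)).
  by apply: weight_integrable => //; rewrite ltrN10.
apply: (dominated_cintegrable _ (integrableZl measurableT (M e) iw)).
  exact: (@cmeasurable_slit _ (fun p => g p.1 p.2) e (ltW e0)).
move=> p; rewrite /slit; case: ifPn => [/ltW/hg//|_].
by rewrite rnorm0 mulr_ge0 ?M0 ?weight_ge0.
Qed.

Let G_bound (e : R) (p : R * R) : 0 < e -> e <= `|p.2| ->
  rnorm (G p.1 p.2) <= K / e * J p.1 `^ b.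
Proof.
move=> e0 ep; have [hF _ _ _] := hK p.
rewrite /G rnormM rnormV mulrAC; apply: ler_pM; rewrite ?invr_ge0 ?rnorm_ge0//.
  by apply: le_trans hF _; rewrite ler_wpM2l// weight0_le.
have h := le_trans ep (rnorm_wker_y s p.1 p.2).
by rewrite lef_pV2 ?posrE// (lt_le_trans e0).
Qed.

(** On each horizontal line off the axis, [G] tends to 0 at both ends. *)
Let slit_dx (e : R) : 0 < e -> cintegral mu2 (slit e Gx) = 0.
Proof.
move=> e0; rewrite (@cintegral_fubini21 _ _ (fun=> (0 +i* 0)%C)); first last.
- move=> y; rewrite /slit /=; case: (boolP (e < `|y|)) => [ey|_]; last exact: integral0.
  have y0 : y != 0 by rewrite -normr_gt0 (lt_trans e0).
  have h := (@integral_primitive_decay R (fun x => complex.Im (G x y))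
    (fun x => complex.Im (Gx x y)) (K / e) (M e) b (b - 2) b0 b2); apply: h.
  + by move=> x; case: (ccontinuous_section_x (@Gx_continuous (x, y) y0)).
  + by move=> x; case: (G_dx x y0).
  + by move=> x; apply: le_trans (normIm_le _) (G_bound (p := (x, y)) e0 (ltW ey)).
  + move=> x; apply: le_trans (normIm_le _) _.
    apply: le_trans (Gx_bound (p := (x, y)) e0 (ltW ey)) _.
    by rewrite ler_wpM2l ?M0 ?weight0_le.
- move=> y; rewrite /slit /=; case: (boolP (e < `|y|)) => [ey|_]; last exact: integral0.
  have y0 : y != 0 by rewrite -normr_gt0 (lt_trans e0).
  have h := (@integral_primitive_decay R (fun x => complex.Re (G x y))
    (fun x => complex.Re (Gx x y)) (K / e) (M e) b (b - 2) b0 b2); apply: h.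
  + by move=> x; case: (ccontinuous_section_x (@Gx_continuous (x, y) y0)).
  + by move=> x; case: (G_dx x y0).
  + by move=> x; apply: le_trans (normRe_le _) (G_bound (p := (x, y)) e0 (ltW ey)).
  + move=> x; apply: le_trans (normRe_le _) _.
    apply: le_trans (Gx_bound (p := (x, y)) e0 (ltW ey)) _.
    by rewrite ler_wpM2l ?M0 ?weight0_le.
- by apply: slit_integrable => // p; exact: Gx_bound.
by rewrite /cintegral /Rintegral !integral0_eq.
Qed.

Let outside (x y : R) : 2 * J x < `|y| -> G x y = 0 /\ Gy x y = 0.
Proof.
move=> h; have [h1 _ h2 _] := hK (x, y).
have z (z : R[i]) d : rnorm z <= K * weight 0 d (x, y) -> z = 0.
  rewrite /weight /= [`|y| <= _]leNgt h /= mulr0 => hz; apply/eqP.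
  by rewrite -rnorm_eq0 eq_le hz rnorm_ge0.
by rewrite /G /Gy (z _ _ h1) (z _ _ h2) !mul0r addr0.
Qed.

(** On each vertical line, [G] has bounded support and a gap at the axis. *)
Let slit_dy (e : R) : 0 < e ->
  cintegral mu2 (slit e Gy) = cintegral mu (fun x => G x (- e) - G x e).
Proof.
move=> e0; apply: cintegral_fubini12 => [|x|x].
- by apply: slit_integrable => // p; exact: Gy_bound.
- have E (y : R) : complex.Re (slit e Gy (x, y)) =
    if e < `|y| then complex.Re (Gy x y) else 0 by rewrite /slit /=; case: ifP.
  under eq_integral do rewrite E.
  rewrite ReD ReN.
have h := (@integral_primitive_slit R (fun y => complex.Re (G x y)) (fun y => complex.Re (Gy x y)) e (2 * J x)); apply: (h e0).
  + by move=> y y0; case: (G_dy x y0).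
  + by move=> y y0; case: (ccontinuous_section_y (@Gy_continuous (x, y) y0)).
  + by move=> y /outside[-> _].
  + by move=> y /outside[_ ->].
have E (y : R) : complex.Im (slit e Gy (x, y)) =
  if e < `|y| then complex.Im (Gy x y) else 0 by rewrite /slit /=; case: ifP.
under eq_integral do rewrite E.
rewrite ImD ImN.
have h := (@integral_primitive_slit R (fun y => complex.Im (G x y)) (fun y => complex.Im (Gy x y)) e (2 * J x)); apply: (h e0).
- by move=> y y0; case: (G_dy x y0).
- by move=> y y0; case: (ccontinuous_section_y (@Gy_continuous (x, y) y0)).
- by move=> y /outside[-> _].
- by move=> y /outside[_ ->].
Qed.

Let slit_dbar (e : R) : 0 < e ->
  cintegral mu2 (slit e (fun x y => dbar F x y * (w x y)^-1)) =
  2^-1 * ('i%C * cintegral mu (fun x => G x (- e) - G x e)).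
Proof.
move=> e0; have ix : cintegrable mu2 (slit e Gx).
  by apply: slit_integrable => // p; exact: Gx_bound.
have iy : cintegrable mu2 (slit e Gy).
  by apply: slit_integrable => // p; exact: Gy_bound.
rewrite -(slit_dy e0) -(add0r ('i%C * _)) -(slit_dx e0).
rewrite -(cintegralZ 'i%C iy) -(cintegralD ix (cintegrableZ 'i%C iy)).
rewrite -(cintegralZ 2^-1 (cintegrableD ix (cintegrableZ 'i%C iy))).
congr (cintegral _ _); apply/funext => p; rewrite /slit.
by case: ifP => _; rewrite ?mulr0 ?addr0 ?mulr0// dbar_G.
Qed.

(** The jump of [G] across the strip, compared with the Poisson kernel: replacing
    [F] by its boundary value [f x] costs [O(e)], and replacing [f x] by [f s] is
    controlled by the Poisson kernel itself. *)
Let jump_bound (A e x : R) : 0 < e <= 1 -> 0 <= A ->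
  (forall x y : R, `|y| <= 1 -> rnorm (F x y - f x) <= A * `|y| * J x `^ (b - 1)) ->
  rnorm (G x (- e) - G x e - (2 * (e / ((x - s) ^+ 2 + e ^+ 2)))%:C%C * ('i%C * f s)) <=
  A * (2 * (e / rnorm (w x e))) * J x `^ (b - 1) +
  2 * (rnorm (f x - f s) * (e / ((x - s) ^+ 2 + e ^+ 2))).
Proof.
move=> /andP[e0 e1] A0 hA; set P := e / _.
have ne0 : e != 0 by rewrite gt_eqF.
have w1 : w x e != 0 by exact: wker_neq0.
have w2 : w x (- e) != 0 by apply: wker_neq0; rewrite oppr_eq0.
have wP : (w x (- e))^-1 - (w x e)^-1 = (2 * P)%:C%C * 'i%C.
  apply/eqP; rewrite eq_complex ReD ImD ReN ImN !ReV !ImV /= sqrrN.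
  rewrite !mul0r !mulr0 !mulr1 ?subr0 ?addr0 ?add0r addrN eqxx /= /P.
  by apply/eqP; ring.
have -> : G x (- e) - G x e - (2 * P)%:C%C * ('i%C * f s) =
    (F x (- e) - f x) * (w x (- e))^-1 - (F x e - f x) * (w x e)^-1 +
    (f x - f s) * ((2 * P)%:C%C * 'i%C).
  by rewrite (mulrA _ 'i%C (f s)) -wP /G; ring.
apply: le_trans (rnormD _ _) _; apply: lerD.
  apply: le_trans (rnormB _ _) _; rewrite !rnormM !rnormV.
  have -> : rnorm (w x (- e)) = rnorm (w x e) by rewrite !rnormE /= sqrrN.
  have h1 := hA x (- e); have h2 := hA x e.
  rewrite normrN (gtr0_norm e0) in h1; rewrite (gtr0_norm e0) in h2.
  rewrite -mulrDl [leRHS](_ : _ = 2 * (A * e * J x `^ (b - 1)) / rnorm (w x e)); last ring.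
  rewrite ler_wpM2r ?invr_ge0 ?rnorm_ge0//.
  by have := h1 e1; have := h2 e1; lra.
rewrite !rnormM rnorm_i rnorm_real mulr1 ger0_norm; first by rewrite mulrCA.
by rewrite mulr_ge0// divr_ge0 ?addr_ge0 ?sqr_ge0// ltW.
Qed.

Let G_decay (e : R) (p : R * R) : 0 < e -> e <= `|p.2| ->
  rnorm (G p.1 p.2) <= K * C e * J p.1 `^ (b - 1).
Proof.
move=> e0 ep; have [hF _ _ _] := hK p.
have hw := rnorm_wkerV_le s p.1 e0 ep; rewrite -/(C e) in hw.
rewrite /G rnormM; apply: (@le_trans _ _ (K * weight 0 b p * (C e / J p.1))).
  by apply: ler_pM; rewrite ?rnorm_ge0.
rewrite [leLHS](_ : _ = K * C e * (weight 0 b p / J p.1)); last ring.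
by rewrite weight_div ler_wpM2l ?weight0_le// mulr_ge0 ?C0.
Qed.

Let jump_integrable (e : R) : 0 < e -> cintegrable mu (fun x => G x (- e) - G x e).
Proof.
move=> e0; have ne0 : e != 0 by rewrite gt_eqF.
have iJ := integrableZl measurableT (2 * (K * C e)) (jap_powR_integrable b1).
apply: (dominated_cintegrable _ iJ).
  apply: cmeasurableB; apply: ccontinuous_line_cmeasurable => x.
    by apply: (@ccontinuous_section_x _ (fun q : R * R => G q.1 q.2)); apply: G_continuous; rewrite /= oppr_eq0.
  by apply: (@ccontinuous_section_x _ (fun q : R * R => G q.1 q.2)); exact: G_continuous.
move=> x /=; apply: le_trans (rnormB _ _) _.
have h1 := @G_decay e (x, - e) e0; have h2 := @G_decay e (x, e) e0.
rewrite /= normrN in h1; rewrite /= (gtr0_norm e0) in h1 h2.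
by rewrite -mulrA mulrDl mul1r; apply: lerD; [exact: h1|exact: h2].
Qed.

(** The difference is at most [2 A <x>^(b-1) + 4 L / (1 + (x - s)^2)]
    for all [e <= 1], and it tends to 0 at every [x] other than [s]. *)
Let jump_close (L A : R) : 0 <= L -> 0 <= A ->
  (forall x y : R, `|y| <= 1 -> rnorm (F x y - f x) <= A * `|y| * J x `^ (b - 1)) ->
  (forall x y, rnorm (f x - f y) <= L /\ rnorm (f x - f y) <= L * `|x - y|) ->
  forall d : R, 0 < d -> \forall k \near \oo,
    (\int[mu]_x (rnorm (G x (- k.+1%:R^-1) - G x k.+1%:R^-1 -
      (2 * (k.+1%:R^-1 / ((x - s) ^+ 2 + k.+1%:R^-1 ^+ 2)))%:C%C * ('i%C * f s)))%:E < d%:E)%E.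
Proof.
move=> L0 A0 hA hL d d0.
pose eps (k : nat) : R := k.+1%:R^-1.
have eps0 k : 0 < eps k by rewrite invr_gt0 ltr0n.
have eps1 k : eps k <= 1 by rewrite invf_le1 ?ltr0n// ler1n.
have eps01 k : 0 < eps k <= 1 by rewrite eps0 eps1.
have epscvg : eps k @[k --> \oo] --> (0 : R) by exact: cvg_harmonic.
pose W (x : R) := 2 * A * J x `^ (b - 1) + 4 * L * (1 / ((x - s) ^+ 2 + 1 ^+ 2)).
have iW : mu.-integrable setT (EFin \o W).
  have i1 := integrableZl measurableT (2 * A) (jap_powR_integrable b1).
  have i2 := integrableZl measurableT (4 * L) (poisson_integrable s (@ltr01 R)).
  exact: (integrableD measurableT i1 i2).
pose g k x := rnorm (G x (- eps k) - G x (eps k) -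
  (2 * (eps k / ((x - s) ^+ 2 + eps k ^+ 2)))%:C%C * ('i%C * f s)).
have gW k (x : R) : g k x <= W x.
  apply: (le_trans (@jump_bound A (eps k) x (eps01 k) A0 hA)); rewrite -/(eps k) /W; apply: lerD.
    rewrite ler_wpM2r ?powR_ge0// [leRHS]mulrC ler_wpM2l//.
    rewrite -[leRHS]mulr1 ler_wpM2l// ler_pdivrMr ?mul1r.
      by apply: le_trans (rnorm_wker_y s x (eps k)); rewrite gtr0_norm.
    by apply: lt_le_trans (rnorm_wker_y s x (eps k)); rewrite gtr0_norm.
  have [h1 h2] := hL x s; have := poisson_dominated (eps01 k) (rnorm_ge0 _) h1 h2.
  rewrite expr1n mul1r; lra.
apply: (@dominated_null _ _ _ mu g W _ _ iW _ d d0); rewrite /g.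
- move=> k; apply: measurable_rnorm; apply: cmeasurableB.
    exact: (cintegrable_measurable (jump_integrable (eps0 k))).
  exact: (cintegrable_measurable (poisson_cintegrable s ('i%C * f s) (eps0 k)).1).
- by move=> k x; rewrite rnorm_ge0 /=; exact: gW.
exists [set s]; split; [exact: measurable_set1|exact: lebesgue_measure_set1|].
move=> x /= hx; apply: contrapT => xs; apply: hx => _.
have t0 : x - s != 0 by rewrite subr_eq0; exact/eqP.
pose Q := A * 2 * J x `^ (b - 1) / `|x - s| + 2 * rnorm (f x - f s) / (x - s) ^+ 2.
apply/fine_cvgP; split; first exact: nearW.
have lim : eps k * Q @[k --> \oo] --> (0 : R).
  by rewrite -[X in _ --> X](mul0r Q); apply: cvgM epscvg _; exact: cvg_cst.
apply: (squeeze_cvgr _ (cvg_cst 0) lim); apply: nearW => k /=.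
rewrite rnorm_ge0 /=; apply: (le_trans (@jump_bound A (eps k) x (eps01 k) A0 hA)).
rewrite -/(eps k) /Q mulrDr; apply: lerD.
  rewrite [leRHS](_ : _ = A * (2 * (eps k / `|x - s|)) * J x `^ (b - 1)); last ring.
  rewrite ler_wpM2r ?powR_ge0// ler_wpM2l// ler_wpM2l// ler_wpM2l ?(ltW (eps0 k))//.
  rewrite lef_pV2 ?posrE ?normr_gt0 ?rnorm_wker_x//.
  by apply: lt_le_trans (rnorm_wker_x s x (eps k)); rewrite normr_gt0.
rewrite [leRHS](_ : _ = 2 * (rnorm (f x - f s) * (eps k / (x - s) ^+ 2))); last ring.
rewrite ler_wpM2l// ler_wpM2l ?rnorm_ge0// ler_wpM2l ?(ltW (eps0 k))//.
have t2 : 0 < (x - s) ^+ 2 by rewrite lt_neqAle sqr_ge0 eq_sym sqrf_eq0 t0.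
by rewrite lef_pV2 ?posrE// ?ltr_wpDr ?sqr_ge0// lerDl sqr_ge0.
Qed.

(** Off the axis the strip no longer contains a given point once it is thin
    enough; on the axis the integrand vanishes. *)
Let slit_close (d : R) : 0 < d -> \forall k \near \oo,
  (\int[mu2]_p (rnorm (dbar F p.1 p.2 * (w p.1 p.2)^-1 -
     slit k.+1%:R^-1 (fun x y => dbar F x y * (w x y)^-1) p))%:E < d%:E)%E.
Proof.
move=> d0; pose eps (k : nat) : R := k.+1%:R^-1.
have eps0 k : 0 < eps k by rewrite invr_gt0 ltr0n.
have epscvg : eps k @[k --> \oo] --> (0 : R) by exact: cvg_harmonic.
apply: (dominated_null _ _ pompeiu_weight _ d0).
- move=> k; apply: measurable_rnorm; apply: cmeasurableB.
    exact: cintegrable_measurable cauchy_transform_integrable.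
  apply: (@cmeasurable_slit _ (fun p => dbar F p.1 p.2 * (w p.1 p.2)^-1) (eps k)).
    exact: ltW.
  move=> p p0; apply: ccontinuousM; last exact: wV_continuous.
  exact: (dbar_almost_analytic_continuous n htau hf).
- move=> k p; rewrite rnorm_ge0 /= /slit; case: ifP => _.
    by rewrite subrr rnorm0 mulr_ge0 ?weight_ge0.
  by rewrite subr0 pompeiu_bound.
apply: aeW => p _; apply/fine_cvgP; split; first exact: nearW.
apply: cvg_near_cst; have [p0|p0] := eqVneq p.2 0.
  apply: nearW => k /=; rewrite /slit (dbar_almost_analytic_axis htau hf n0 p0) mul0r.
  by rewrite if_same subrr rnorm0.
have y0 : 0 < `|p.2| by rewrite normr_gt0.
near=> k; have h : eps k < `|p.2| by near: k; exact: (cvgr_lt _ epscvg _ y0).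
by rewrite /= /slit h subrr rnorm0.
Unshelve. all: by end_near.
Qed.

Lemma cauchy_pompeiu_bounded :
  cintegral mu2 (fun p => dbar F p.1 p.2 * (w p.1 p.2)^-1) = - pi%:C%C * f s.
Proof.
set q := (fun p : R * R => _); set I := cintegral _ _.
have iq : cintegrable mu2 q by exact: cauchy_transform_integrable.
have [L L0 hL] := symbol_lipschitz (ltW b0) hf.
have [A A0 hA] := almost_analytic_near_axis n htau hf.
apply/eqP; rewrite -subr_eq0 -rnorm_eq0 eq_le rnorm_ge0 andbT.
apply/ler_addgt0Pl => d d0; rewrite addr0.
have d4 : 0 < d / 4 by rewrite divr_gt0.
have [k [hj hs]] := filter_ex (filterI (jump_close L0 A0 hA hL d4) (slit_close d4)).
have e0 : 0 < k.+1%:R^-1 :> R by rewrite invr_gt0 ltr0n.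
move: (k.+1%:R^-1 : R) e0 hj hs => e e0 hj hs.
have ij := jump_integrable e0.
have [ip Ip] := poisson_cintegrable s ('i%C * f s) e0.
have is_ : cintegrable mu2 (slit e (fun x y => dbar F x y * (w x y)^-1)).
  apply: (dominated_cintegrable _ pompeiu_weight).
    apply: (@cmeasurable_slit _ (fun p => dbar F p.1 p.2 * (w p.1 p.2)^-1)); first exact: ltW.
    move=> p p0; apply: ccontinuousM; last exact: wV_continuous.
    exact: (dbar_almost_analytic_continuous n htau hf).
  move=> p; rewrite /slit; case: ifP => _; first exact: pompeiu_bound.
  by rewrite rnorm0 mulr_ge0 ?weight_ge0.
have small (x a : R) (y : \bar R) : (x%:E <= 2%:E * y)%E -> (y < a%:E)%E -> x <= 2 * a.
  by move=> xy ya; rewrite -lee_fin EFinM (le_trans xy)// lee_wpmul2l// ltW.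
have h1 := small _ _ _ (rnorm_cintegralB iq is_) hs.
have h2 := small _ _ _ (rnorm_cintegralB ij ip) hj.
rewrite (slit_dbar e0) in h1; rewrite Ip in h2.
have E : 2^-1 * ('i%C * ((2 * pi)%:C%C * ('i%C * f s))) = - pi%:C%C * f s.
  have two : (2 * pi)%:C%C = 2 * pi%:C%C :> R[i] by rewrite rmorphM rmorph_nat.
  have := sqr_i R; rewrite two; move: ('i%C : R[i]) => i ii.
  rewrite [LHS](_ : _ = i ^+ 2 * pi%:C%C * f s); last by field.
  by rewrite ii mulN1r.
rewrite -E -[X in rnorm X](subrKA (2^-1 * ('i%C * cintegral mu (fun x => G x (- e) - G x e)))).
apply: le_trans (rnormD _ _) _.
rewrite -!mulrBr rnormM (rnormM 'i%C) rnorm_i mul1r rnormV rnorm_nat.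
rewrite -/I in h1; lra.
Qed.

End cauchy_pompeiu.

(** Letting the width [e] of the strip tend to 0: the integral off the strip tends
    to the whole one, and it equals [i / 2] times the integral of the jump, which
    tends to [2 pi i f(s)]. *)
Theorem cauchy_pompeiu (R : realType) (tau0 : R -> R[i]) (n : nat) (f : R -> R[i]) (b s : R) :
  cutoff tau0 -> symbol_class b f -> b < 0 -> (0 < n)%N ->
  cintegrable (@lebesgue_measure R \x @lebesgue_measure R)%E
    (fun p => dbar (almost_analytic tau0 n f) p.1 p.2 * (wker s p.1 p.2)^-1) /\
  cintegral (@lebesgue_measure R \x @lebesgue_measure R)%E
    (fun p => dbar (almost_analytic tau0 n f) p.1 p.2 * (wker s p.1 p.2)^-1) =
  - pi%:C%C * f s.
Proof.
move=> htau hf b0 n0; have [K K0 hK] := almost_analytic_bounds n htau hf.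
split; first exact: (cauchy_transform_integrable s htau hf b0 n0 K0 hK).
exact: (cauchy_pompeiu_bounded s htau hf b0 n0 K0 hK).
Qed.

(** * Approximate eigenvalues of the functional calculus *)

Section approximate_eigenvalues.
Context {R : realType} {B : completeNormedModType R[i]}.
Variables (H : partial_op B) (c alpha : R).
Hypotheses (c_gt0 : 0 < c) (alpha_ge0 : 0 <= alpha).
Hypothesis hH : standing_hypothesis H c alpha.
Variables (tau0 : R -> R[i]) (n : nat) (f : R -> R[i]) (b : R).
Hypotheses (htau : cutoff tau0) (hn : alpha < n%:R).
Hypotheses (hf : symbol_class b f) (b0 : b < 0).

Local Notation mu2 := (@lebesgue_measure R \x @lebesgue_measure R)%E.
Local Notation J x := (jap x%:C%C).
Local Notation a p := (dbar (almost_analytic tau0 n f) p.1 p.2).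
Local Notation g := (n%:R - 1 - alpha).
Local Notation d := (b - n%:R - 1 + alpha).

Let n_gt0 : (0 < n)%N.
Proof. by rewrite -(ltr0n R) (le_lt_trans alpha_ge0). Qed.

Let g_gtN1 : -1 < g. Proof. by have := hn; lra. Qed.
Let gd_ltN1 : g + d + 1 < -1. Proof. by have := b0; lra. Qed.

(** On the cone [|y| <= 2 <x>] one has [<z> <= 3 <x>]. *)
Lemma resolvent_cone_bound (p : R * R) (v : B) : p.2 != 0 -> `|p.2| <= 2 * J p.1 ->
  rnorm (resolvent H (p.1 +i* p.2)%C v) <=
  c * 3 `^ alpha * (J p.1 `^ alpha * `|p.2| `^ (- 1 - alpha)) * rnorm v.
Proof.
move=> p0 pJ; case: hH => _ _ _ specH boundH.
have y0 : 0 < `|p.2| by rewrite normr_gt0.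
have J0 := jap_gt0 p.1%:C%C.
have [lT _] : bounded_op (resolvent H (p.1 +i* p.2)%C).
  by case: (@resolventP _ _ H (p.1 +i* p.2)%C) => // /specH /= /eqP; apply/negP.
apply: (opnorm_le_rnorm v lT); apply: le_trans (boundH _ _) _; first exact: p0.
rewrite lee_fin /= -!mulrA ler_wpM2l ?(ltW c_gt0)//.
have japz : jap (p.1 +i* p.2)%C <= 3 * J p.1.
  rewrite -ler_sqr ?nnegrE ?mulr_ge0 ?(ltW (jap_gt0 _))//.
  rewrite exprMn !sqr_jap !rnormE /= !sqr_sqrtr ?addr_ge0 ?sqr_ge0//.
  have : `|p.2| ^+ 2 <= (2 * J p.1) ^+ 2.
    by rewrite ler_sqr ?nnegrE ?mulr_ge0 ?(ltW J0).
  rewrite exprMn sqr_jap rnorm_real !real_normK ?num_real//.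
  have := sqr_ge0 p.1; rewrite expr0n /=; lra.
apply: (@le_trans _ _ (`|p.2|^-1 * (3 * J p.1 / `|p.2|) `^ alpha)).
  rewrite ler_wpM2l ?invr_ge0//; apply: ge0_ler_powR => //;
    rewrite ?nnegrE ?divr_ge0 ?mulr_ge0 ?(ltW (jap_gt0 _))//.
  by rewrite ler_wpM2r ?invr_ge0.
rewrite powRM ?mulr_ge0 ?invr_ge0 ?(ltW J0)// powRM ?(ltW J0)//.
rewrite -[`|p.2|^-1]powR_inv1 ?(ltW y0)// -powRrM mulN1r.
rewrite powRD ?(gt_eqF y0) ?implybT//.
by apply: eq_ler; ring.
Qed.

(** The factor [|y|^n] in the bound for the almost analytic extension absorbs the
    singularity of the resolvent at the axis, as [alpha < n]. *)
Lemma weighted_resolvent_bound : exists2 K : R, 0 <= K &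
  forall (p : R * R) (v : B), p.2 != 0 ->
    rnorm (a p *: resolvent H (p.1 +i* p.2)%C v) <= K * weight g d p * rnorm v.
Proof.
have [K K0 hK] := almost_analytic_bounds n htau hf.
have C0 : 0 <= c * 3 `^ alpha by rewrite mulr_ge0 ?powR_ge0// ltW.
exists (K * (c * 3 `^ alpha)); first exact: mulr_ge0.
move=> p v p0; have [_ _ _ ha] := hK p; rewrite rnormZ.
have y0 : 0 < `|p.2| by rewrite normr_gt0.
have J0 := jap_gt0 p.1%:C%C.
move: ha; rewrite /weight; case: ifPn => [pJ|_] ha; last first.
  have -> : rnorm (a p) = 0 by rewrite mulr0 in ha; apply/eqP; rewrite eq_le ha rnorm_ge0.
  by rewrite mul0r mulr0 mul0r.
apply: le_trans (ler_pM (rnorm_ge0 _) (rnorm_ge0 _) ha (resolvent_cone_bound v p0 pJ)) _.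
have -> : g = n%:R + (- 1 - alpha) by ring.
rewrite [_ `^ (n%:R + _)]powRD ?(gt_eqF y0) ?implybT//.
rewrite [_ `^ (b - n%:R - 1 + _)]powRD ?(gt_eqF J0) ?implybT//.
by apply: eq_ler; ring.
Qed.

(** The approximate eigenvectors of [H] for [s] serve for [f(H)] and [f(s)]. *)
Lemma funcalc_approx_eigenvector (s : R) : spectrum H s%:C%C -> forall e : R, 0 < e ->
  exists2 v : B, rnorm v = 1 & rnorm (funcalc tau0 n H f v - f s *: v) < e.
Proof.
move=> ss e e0; case: (hH) => linH closedH _ specH _.
have [K K0 hK] := weighted_resolvent_bound.
have [ib Ib] := cauchy_pompeiu s htau hf b0 n_gt0.
have mw : measurable_fun setT (fun p => K * weight g d p).
  by apply: measurable_funM; [exact: measurable_cst|exact: measurable_weight].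
have iw : mu2.-integrable setT (EFin \o (fun p => K * weight g d p)).
  exact: (integrableZl measurableT K (weight_integrable g_gtN1 gd_ltN1)).
pose T := bochner_integral mu2 (fun p => a p *: resolvent H (p.1 +i* p.2)%C).
have hT : is_bochner_integral mu2 (fun p => a p *: resolvent H (p.1 +i* p.2)%C) T.
  apply: xgetPex; apply: (resolvent_bochner_exists specH _ _ iw) => [p p0|p p0|p|p p0 v].
  - exact: (dbar_almost_analytic_continuous n htau hf).
  - exact: (dbar_almost_analytic_axis htau hf).
  - by rewrite mulr_ge0 ?weight_ge0.
  - exact: hK.
pose Q (p : R * R) := K * weight g d p + rnorm (a p * (wker s p.1 p.2)^-1).
have iQ : mu2.-integrable setT (EFin \o Q).
  exact: (integrableD measurableT iw (integrable_rnorm ib)).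
(* The second entry is the bound for an approximate eigenvector of defect
   [1 / (k + 1)]; it alone need not be integrable. *)
pose W (k : nat) (p : R * R) := Num.min (Q p) (k.+1%:R^-1 * (K * weight (g - 1) d p)).
have W0 k p : 0 <= W k p.
  by rewrite le_min addr_ge0 ?mulr_ge0 ?invr_ge0 ?rnorm_ge0 ?weight_ge0.
have mW k : measurable_fun setT (W k).
  apply: measurable_minr.
    exact: (measurable_funD mw (measurable_rnorm (cintegrable_measurable ib))).
  apply: measurable_funM; first exact: measurable_cst.
  by apply: measurable_funM; [exact: measurable_cst|exact: measurable_weight].
have epi : 0 < e * pi by rewrite mulr_gt0 ?pi_gt0.
have [||k _ /(_ _ (leqnn k)) hk] := @dominated_null _ _ _ mu2 W Q mW _ iQ _ _ epi.
- by move=> k p; rewrite W0 ge_min lexx.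
- apply: aeW => p _; apply/fine_cvgP; split; first exact: nearW.
  have lim : k.+1%:R^-1 * (K * weight (g - 1) d p) @[k --> \oo] --> (0 : R).
    rewrite -[X in _ --> X](mul0r (K * weight (g - 1) d p)).
    by apply: cvgM; [exact: cvg_harmonic|exact: cvg_cst].
  apply: (squeeze_cvgr _ (cvg_cst 0) lim); apply: nearW => k /=.
  by rewrite W0 ge_min lexx orbT.
have k0 : 0 < k.+1%:R^-1 :> R by rewrite invr_gt0 ltr0n.
have [v [dv v1 dfct]] := approx_eigenvector linH closedH specH k0 ss.
exists v => //.
have key (p : R * R) : rnorm (a p *: resolvent H (p.1 +i* p.2)%C v -
    (a p * (wker s p.1 p.2)^-1) *: v) <= W k p.
  have [p0|p0] := eqVneq p.2 0.
    rewrite (dbar_almost_analytic_axis htau hf n_gt0 p0) mul0r !scale0r subrr rnorm0.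
    exact: W0.
  rewrite le_min; apply/andP; split.
    apply: le_trans (rnormB _ _) _; apply: lerD.
      by apply: le_trans (hK p v p0) _; rewrite v1 mulr1.
    by rewrite rnormZ v1 mulr1.
  have rT : is_resolvent H (p.1 +i* p.2)%C (resolvent H (p.1 +i* p.2)%C).
    by apply: resolventP => /specH /= /eqP; apply/negP.
  have wE : (p.1 +i* p.2)%C - s%:C%C = wker s p.1 p.2.
    by apply/eqP; rewrite eq_complex /= subr0 !eqxx.
  have h := @resolvent_approx_eigenvector _ _ H _ s%:C%C _ v rT _ dv.
  rewrite wE -subr_eq0 wE in h; have {}h := h (wker_neq0 _ _ p0).
  rewrite -scalerA -scalerBr rnormZ.
  apply: le_trans (ler_wpM2l (rnorm_ge0 _) h) _.
  rewrite mulrCA -rnormZ rnormV.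
  have y0 : 0 < `|p.2| by rewrite normr_gt0.
  apply: (@le_trans _ _ (`|p.2|^-1 * (K * weight g d p * k.+1%:R^-1))).
    apply: ler_pM; rewrite ?invr_ge0 ?rnorm_ge0//.
      by rewrite lef_pV2 ?posrE ?rnorm_wker_y ?(lt_le_trans y0)// rnorm_wker_y.
    apply: le_trans (hK p _ p0) _; rewrite ler_wpM2l ?(ltW dfct)//.
    by rewrite mulr_ge0 ?weight_ge0.
  by rewrite -(weight_divy g d p0); apply: eq_ler; ring.
have h := rnorm_bochner_sub hT ib v1 (mW k) key.
have {h} := le_lt_trans h hk; rewrite lte_fin Ib => h.
have pi0 : (pi : R) != 0 by rewrite gt_eqF ?pi_gt0.
have -> : funcalc tau0 n H f v - f s *: v =
    - (pi^-1)%:C%C *: (T v - (- pi%:C%C * f s) *: v).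
  rewrite scalerBr scalerA mulrA mulrNN -rmorphM mulVf// mul1r.
  by rewrite /funcalc fctE.
rewrite rnormZ rnormN rnorm_real ger0_norm ?invr_ge0 ?pi_ge0//.
by rewrite mulrC ltr_pdivrMr ?pi_gt0.
Qed.

End approximate_eigenvalues.

Theorem corollary4p7 (R : realType) (B : completeNormedModType R[i])
    (H : partial_op B) (c alpha : R) (c_gt0 : 0 < c) (alpha_ge0 : 0 <= alpha)
    (hH : standing_hypothesis H c alpha)
    (tau0 : R -> R[i]) (htau0 : cutoff tau0)
    (n : nat) (hn : alpha < n%:R)
    (phi : R[i] * (R -> R[i])) (hphi : algAhat phi) :
  closure ([set ext_fun phi x | x in [set x : R | spectrum H (x%:C)%C]]
           : set (R[i])^o)
  `<=` spectrum (total_op (ext_funcalc tau0 n H phi)).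
Proof.
case: hphi => b b0 hf l cl [T [bT _ TK]].
have [_ [K K0 [_ hK]]] := bounded_opP bT.
(* Two errors of this size, multiplied by [K], stay below 1. *)
have e0 : 0 < (2 * (K + 1))^-1 by rewrite invr_gt0 mulr_gt0// ltr_wpDl.
have [_ [s ss <-] le] := closure_rnorm cl e0.
have [v v1 ve] := funcalc_approx_eigenvector c_gt0 alpha_ge0 hH htau0 hn hf b0 ss e0.
have Tv := TK v I; rewrite /= in Tv.
have : rnorm v <= K * (2 * (2 * (K + 1))^-1).
  rewrite -{1}Tv; apply: le_trans (hK _) _; rewrite ler_wpM2l//.
  have -> : l *: v - ext_funcalc tau0 n H phi v =
      (l - ext_fun phi s) *: v - (funcalc tau0 n H phi.2 v - phi.2 s *: v).
    rewrite /ext_funcalc /ext_fun scalerBl scalerDl opprB.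
    by rewrite -addrA; congr (_ + _); rewrite !opprD addrA subrK addrC.
  apply: le_trans (rnormB _ _) _; rewrite rnormZ v1 mulr1.
  by rewrite mulr_natl mulr2n; apply: lerD; apply: ltW.
rewrite v1 invfM mulVKf ?pnatr_eq0// ler_pdivlMr; last by rewrite ltr_wpDl.
by rewrite mul1r leNgt ltrDl ltr01.
Qed.
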